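(* Let $\kappa^+,\kappa^->0$, $\rho^\pm\in\mathbb{R}$ with $\rho^--\rho^+>0$ (Rayleigh–Taylor stable case), $h_2>0$ and $T>0$. Let $f\in C([0,T],H^3(\mathbb{T}))$ with $f>0$ be a smooth solution of the inhomogeneous Muskat equation $$ \partial_t f(x)=\frac{\kappa^+(\rho^--\rho^+)}{4\pi}\,\mathrm{P.V.}\!\int_{\mathbb{T}}\frac{\sin(\beta)(\partial_x f(x)-\partial_x f(x-\beta))}{\cosh(f(x)-f(x-\beta))-\cos(\beta)}\,d\beta+\frac{1}{4\pi}\,\mathrm{P.V.}\!\int_{\mathbb{T}}\frac{(\partial_x f(x)\sinh(f(x)+h_2)+\sin(x-\beta))\,\varpi_2(\beta)}{\cosh(f(x)+h_2)-\cos(x-\beta)}\,d\beta , $$ where $$ \varpi_2(\beta)=\mathcal{A}\,\mathrm{P.V.}\!\int_{\mathbb{T}}\frac{\sinh(h_2+f(\gamma))\,\partial_x f(\gamma)}{\cosh(h_2+f(\gamma))-\cos(\beta-\gamma)}\,d\gamma,\qquad \mathcal{A}=\frac{\kappa^+(\rho^--\rho^+)}{2\pi}\,\frac{\kappa^+-\kappa^-}{\kappa^++\kappa^-}. $$ Define $\langle f(x,0)\rangle=\frac{1}{2\pi}\int_{\mathbb{T}}f(x,0)\,dx$. Suppose that $$ \frac{1}{\cosh\!\big((\max_x f(x,0)-\min_x f(x,0))/2\big)}-\frac{8\left|\frac{\kappa^+-\kappa^-}{\kappa^++\kappa^-}\right|}{\pi^2\big(\cosh(h_2+\langle f(x,0)\rangle)-1\big)^3}\,\sinh\!\big(\langle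 f(x,0)\rangle+\max_x f(x,0)-\min_x f(x,0)+h_2\big)>0 . $$ Then there exists a (sufficiently small) constant $\mu>0$, depending only on the physical parameters $\kappa^\pm,\rho^\pm,h_2$ and the initial data $f(\cdot,0)$, such that for all $t\in[0,T]$ $$ \max_x f(x,t)-\min_x f(x,t)\le\big(\max_x f(x,0)-\min_x f(x,0)\big)e^{-\mu t}. $$ In particular, the solution remains non-negative and, for all $t\in[0,T]$, $$ \|f(t)\|_{L^\infty}\le\langle f(x,0)\rangle+\big(\max_x f(x,0)-\min_x f(x,0)\big)e^{-\mu t}. $$
   Context: $\mathbb{T}=[-\pi,\pi]$ with periodic boundary conditions; all functions of $x$ are real-valued and $2\pi$-periodic. $\mathrm{P.V.}$ denotes the Cauchy principal value. In the equation the time dependence is suppressed, $f(x)=f(x,t)$. $H^3(\mathbb{T})$ is the usual $L^2$-based Sobolev space and $L^\infty=L^\infty(\mathbb{T})$. Physically, $f$ is the graph of the interface between two fluids with densities $\rho^+$ (above) and $\rho^-$ (below) in a porous medium whose permeability is $\kappa^+$ for $y>-h_2$ and $\kappa^-$ for $y<-h_2$. *)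

(* Defs.v *)
From HB Require Import structures.
From mathcomp Require Import all_boot all_order all_algebra.
From mathcomp Require Import all_classical all_reals all_analysis.

Set Implicit Arguments.
Unset Strict Implicit.
Unset Printing Implicit Defensive.

Import Order.TTheory GRing.Theory Num.Theory.
Import numFieldNormedType.Exports.

Local Open Scope classical_set_scope.
Local Open Scope ring_scope.

Section hyperbolic.
Context {R : realType}.
Implicit Type y : R.

Definition sinh y : R := (expR y - expR (- y)) / 2.
Definition cosh y : R := (expR y + expR (- y)) / 2.

End hyperbolic.

(* Functions on the torus are 2pi-periodic functions u : R -> R; integrals,
   extrema and norms are taken over the fundamental domain [-pi, pi]. *)
Section torus.
Context {R : realType}.
Implicit Types (u g : R -> R) (k : int).

Definition torus : set R := `[- pi, pi].

Definition torus_max u : R := sup (u @` torus).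
Definition torus_min u : R := inf (u @` torus).
Definition osc u : R := torus_max u - torus_min u.

Definition torus_int u : R := \int[lebesgue_measure]_(x in torus) u x.
Definition mean u : R := (2 * pi)^-1 * torus_int u.

Definition Linfty_norm u : \bar R :=
  Lnorm lebesgue_measure +oo%E (EFin \o (u \_ torus)).

(* Principal value over one period of a 2pi-periodic integrand g whose only
   possible singularity modulo 2pi is c. The period is centred at c, so that
   the excised interval is symmetric about c and never wraps around. *)
Definition pv_int c g : R :=
  lim ((\int[lebesgue_measure]_(b in
          `[c - pi, c - e] `|` `[c + e, c + pi]) g b) @[e --> 0^'+]).

(* |u^(k)|^2 for u^(k) = (2 pi)^-1 \int u(x) e^{-ikx} dx with u real-valued. *)
Definition fourier_sq u k : R :=
  mean (fun x => u x * cos (k%:~R * x)) ^+ 2 +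
  mean (fun x => u x * sin (k%:~R * x)) ^+ 2.

Definition sobolev_norm (s : nat) u : \bar R :=
  ((\esum_(k in [set: int])
     ((1 + k%:~R ^+ 2) ^+ s * fourier_sq u k)%:E) `^ 2^-1)%E.

Definition in_sobolev (s : nat) u : Prop :=
  [/\ periodic u (pi *+ 2),
      u \_ torus \in Lfun lebesgue_measure 2%:E &
      (sobolev_norm s u < +oo)%E].

(* f \in C([0, T], H^s), with f t = f(., t). *)
Definition continuous_in_sobolev (s : nat) (T : R) (f : R -> R -> R) : Prop :=
  (forall t, 0 <= t <= T -> in_sobolev s (f t)) /\
  (forall t0, 0 <= t0 <= T ->
     sobolev_norm s (f t \- f t0) @[t --> within `[0, T] (nbhs t0)] --> 0%E).

End torus.

Section muskat.
Context {R : realType}.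
Variables (kp km rp rm h2 : R).
Implicit Type u : R -> R.

Definition perm_ratio : R := (kp - km) / (kp + km).

Definition amplitude : R := kp * (rm - rp) / (2 * pi) * perm_ratio.

Definition varpi2 u b : R :=
  amplitude * pv_int b (fun c =>
    sinh (h2 + u c) * derive1 u c / (cosh (h2 + u c) - cos (b - c))).

Definition muskat_rhs u x : R :=
  kp * (rm - rp) / (4 * pi) * pv_int 0 (fun b =>
    sin b * (derive1 u x - derive1 u (x - b)) / (cosh (u x - u (x - b)) - cos b)) +
  (4 * pi)^-1 * pv_int x (fun b =>
    (derive1 u x * sinh (u x + h2) + sin (x - b)) * varpi2 u b /
    (cosh (u x + h2) - cos (x - b))).

(* An element of H^3(T) is a class of functions modulo a.e. equality; the
   continuity of f t selects its continuous representative, which is of class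
   C^2, so that the space derivatives in muskat_rhs are classical. *)
Record smooth_solution (T : R) (f : R -> R -> R) : Prop := {
  sol_sobolev : continuous_in_sobolev 3 T f ;
  sol_continuous : forall t, 0 <= t <= T -> continuous (f t) ;
  sol_C1 : forall t x, 0 < t < T ->
    {for (t, x), continuous (fun p : R * R => derive1 (f^~ p.2) p.1)} ;
  sol_eq : forall t x, 0 < t < T ->
    is_derive t 1 (f^~ x) (muskat_rhs (f t) x)
}.

Definition decay_condition u : Prop :=
  0 < (cosh (osc u / 2))^-1 -
      8 * `|perm_ratio| / (pi ^+ 2 * (cosh (h2 + mean u) - 1) ^+ 3) *
      sinh (mean u + torus_max u - torus_min u + h2).

End muskat.

(* Main.v *)
(* Write l = f + h2 and P(s, z) = sinh s / (cosh s - cos z) for the Poisson kernel of the half-plane.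
   At a critical point x of f(t), integrating the first term by parts against
   2 atan (tanh (theta / 2) cot (b / 2)) and the second one by the convolution identity for the
   conjugate kernel sin z / (cosh y - cos z) gives
     d/dt f(x) = - kappa (int P(f(x) - f(x - b), b) db + r int (P(l(x) + l(x - b), b) - 1) db)
   with r the permeability ratio, |r| < 1. Subadditivity of P in s and its shifted variant bound
   the difference of these expressions at a maximum and at a minimum from below by a multiple of
   tanh (osc / 2); for r < 0 and l small at the minimum this uses the smallness condition, which
   involves only the oscillation and the mean of l, and the mean is conserved since both terms of
   the equation are x-derivatives. The exponential barrier (osc f(0) + eps) exp (- mu t) can then
   never be touched: at a first contact time the differentiable function
   f(t, xM) - f(t, xm) - barrier has a nonnegative left derivative, contradicting the bound.
   H^3 enters through Abel-Poisson summation of the Fourier series, which makes f(t) of class C^{1,1}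
   and bounds the uniform norm by the Sobolev norm. *)
Require Import Defs.
From mathcomp Require Import all_boot all_order all_algebra.
From mathcomp Require Import all_classical all_reals all_analysis.
From mathcomp Require Import measurable_realfun ess_sup_inf ring lra.

Set Implicit Arguments.
Unset Strict Implicit.
Unset Printing Implicit Defensive.

Import Order.TTheory GRing.Theory Num.Theory.
Import numFieldNormedType.Exports.

Local Open Scope classical_set_scope.
Local Open Scope ring_scope.

(** * Hyperbolic functions and the Poisson kernel *)

Section hyperbolic_theory.
Context {R : realType}.
Implicit Types s t w x y z : R.

(** The unfavourable sign is r < 0: the kernel of the sum l(x) + l(x - b) then works against the
    dissipation. At the maximum it costs at most half of the local gain (K = 1/2 in
    [poisson_le_shift]), at the minimum at most all of it (K = 1), as long as tanh of the minimum of
    l is at least 5/8 tanh (osc/2) or at least 1/2. Otherwise the minimum lies close to the jump,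
    and what is left is the relative height p of the mean between minimum and maximum: the chord of
    the concave function tanh, integrated against l, bounds the gain from below by (1 - p) tanh
    (osc/2) at the maximum and by p tanh (osc/2) at the minimum, up to the factor 2 pi. Whether this
    suffices is a numerical inequality in osc, the minimum and p. With a the mean of l, cosh a - 1 =
    2 sinh^2 (a/2) turns the smallness condition into |r| cosh (osc/2) sinh (a + osc) < pi^2 sinh^6
    (a/2), and the safety factor 97/100 comes out of that inequality. The condition is used at some
    w1 slightly above osc f(0), which leaves room for the barrier; w1, hence mu, is chosen from the
    initial data and the parameters alone. *)

Definition tanh y : R := sinh y / cosh y.

Lemma sinhN y : sinh (- y) = - sinh y.
Proof. by rewrite /sinh opprK -mulNr opprB. Qed.

Lemma coshN y : cosh (- y) = cosh y.
Proof. by rewrite /cosh opprK addrC. Qed.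

Lemma sinh0 : sinh (0 : R) = 0.
Proof. by rewrite /sinh oppr0 subrr mul0r. Qed.

Lemma cosh2Bsinh2 y : cosh y ^+ 2 - sinh y ^+ 2 = 1.
Proof.
have := expRxMexpNx_1 y; rewrite /cosh /sinh; move: (expR y) (expR (- y)) => a b.
by move=> ab; have -> : ((a + b) / 2) ^+ 2 - ((a - b) / 2) ^+ 2 = a * b by field.
Qed.

Lemma sinhD x y : sinh (x + y) = sinh x * cosh y + cosh x * sinh y.
Proof. by rewrite /sinh /cosh opprD !expRD; field. Qed.

Lemma coshD x y : cosh (x + y) = cosh x * cosh y + sinh x * sinh y.
Proof. by rewrite /sinh /cosh opprD !expRD; field. Qed.

Lemma cosh_gt0 y : 0 < cosh y.
Proof. by rewrite /cosh divr_gt0// addr_gt0 ?expR_gt0. Qed.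

Lemma cosh_ge1 y : 1 <= cosh y.
Proof. by have := cosh2Bsinh2 y; have := cosh_gt0 y; nra. Qed.

Lemma is_derive_compf (f g : R -> R) x (df dg : R) :
  is_derive (g x) 1 f df -> is_derive x 1 g dg ->
  is_derive x 1 (fun z => f (g z)) (df * dg).
Proof. by move=> df_ dg_; exact: (@is_derive1_comp R f g x df dg df_ dg_). Qed.

Lemma is_derive_expRN x : is_derive x 1 (fun y => expR (- y)) (- expR (- x)).
Proof. by apply: is_derive_eq; rewrite mulrN1. Qed.

Lemma is_derive_sinh x : is_derive x 1 (@sinh R) (cosh x).
Proof.
have ? := is_derive_expRN x.
rewrite /sinh /cosh; apply: is_derive_eq.
by rewrite /GRing.scale /=; field.
Qed.

Lemma is_derive_cosh x : is_derive x 1 (@cosh R) (sinh x).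
Proof.
have ? := is_derive_expRN x.
rewrite /sinh /cosh; apply: is_derive_eq.
by rewrite /GRing.scale /=; field.
Qed.

Lemma is_derive_tanh x : is_derive x 1 tanh ((cosh x ^+ 2)^-1).
Proof.
have ? := is_derive_sinh x; have ? := is_derive_cosh x.
have c0 : cosh x != 0 by rewrite gt_eqF// cosh_gt0.
have dV := is_deriveV (f := cosh) c0.
rewrite /tanh; apply: is_derive_eq; rewrite /GRing.scale/=.
by rewrite -[RHS]mul1r -(cosh2Bsinh2 x); field.
Qed.

Lemma continuous_sinh : continuous (@sinh R).
Proof.
by move=> x; apply/differentiable_continuous/derivable1_diffP; have [] := is_derive_sinh x.
Qed.

Lemma continuous_cosh : continuous (@cosh R).
Proof.
by move=> x; apply/differentiable_continuous/derivable1_diffP; have [] := is_derive_cosh x.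
Qed.

(** Most elementary bounds below on hyperbolic, trigonometric and exponential functions come from
    applying this to the difference of the two sides, sometimes several times in a row. *)
Lemma is_derive_ge0_le (f df : R -> R) :
  (forall x, is_derive x 1 f (df x)) -> (forall x, 0 <= x -> 0 <= df x) ->
  forall x, 0 <= x -> f 0 <= f x.
Proof.
move=> fdf df0 x x0.
have [|c] := @MVT_segment _ f df 0 x x0 (fun z _ => fdf z).
  by apply: derivable_within_continuous => z _; have [] := fdf z.
rewrite in_itv/= => /andP[c0 _] E; rewrite -subr_ge0 E subr0 mulr_ge0// df0//.
Qed.

Lemma le_sinh x y : x <= y -> sinh x <= sinh y.
Proof.
move=> xy; have e1 : expR x <= expR y by rewrite ler_expR.
have e2 : expR (- y) <= expR (- x) by rewrite ler_expR lerN2.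
by rewrite /sinh; lra.
Qed.

Lemma sinh_ge0 x : 0 <= x -> 0 <= sinh x.
Proof. by move=> x0; rewrite -sinh0 le_sinh. Qed.

Lemma ge_id_sinh x : 0 <= x -> x <= sinh x.
Proof.
have df (y : R) : is_derive y 1 (fun z => sinh z - z) (cosh y - 1).
  by have ? := is_derive_sinh y; apply: is_derive_eq.
move=> /(is_derive_ge0_le df); rewrite sinh0 subr0 subr_ge0; apply => y _.
by rewrite subr_ge0 cosh_ge1.
Qed.

Lemma sinh_gt0 x : 0 < x -> 0 < sinh x.
Proof. by move=> x0; rewrite (lt_le_trans x0)// ge_id_sinh// ltW. Qed.

Lemma le_cosh x y : 0 <= x -> x <= y -> cosh x <= cosh y.
Proof.
move=> x0 xy; have := le_sinh xy; have := sinh_ge0 x0.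
have := cosh2Bsinh2 x; have := cosh2Bsinh2 y; have := cosh_gt0 x; have := cosh_gt0 y.
by nra.
Qed.

Lemma tanh0 : tanh 0 = 0.
Proof. by rewrite /tanh sinh0 mul0r. Qed.

Lemma tanhN y : tanh (- y) = - tanh y.
Proof. by rewrite /tanh sinhN coshN mulNr. Qed.

Lemma tanh_ge0 x : 0 <= x -> 0 <= tanh x.
Proof. by move=> x0; rewrite divr_ge0 ?sinh_ge0// ltW// cosh_gt0. Qed.

Lemma tanh_gt0 x : 0 < x -> 0 < tanh x.
Proof. by move=> x0; rewrite divr_gt0 ?sinh_gt0// cosh_gt0. Qed.

Lemma tanh_lt1 x : tanh x < 1.
Proof.
rewrite /tanh ltr_pdivrMr ?cosh_gt0// mul1r.
by have := expR_gt0 (- x); rewrite /sinh /cosh; lra.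
Qed.

Lemma sqr_tanh_lt1 x : tanh x ^+ 2 < 1.
Proof.
rewrite /tanh expr_div_n ltr_pdivrMr ?exprn_gt0 ?cosh_gt0//.
by have := cosh2Bsinh2 x; lra.
Qed.

Lemma tanhD x y : tanh (x + y) = (tanh x + tanh y) / (1 + tanh x * tanh y).
Proof.
have cx := cosh_gt0 x; have cy := cosh_gt0 y; have cxy := cosh_gt0 (x + y).
rewrite /tanh sinhD coshD in cxy *.
by field; rewrite !gt_eqF//= andbT.
Qed.

Lemma le_tanh x y : x <= y -> tanh x <= tanh y.
Proof.
move=> xy; have [|c _] := @MVT_segment _ _ _ x y xy (fun z _ => is_derive_tanh z).
  by apply: derivable_within_continuous => z _; have [] := is_derive_tanh z.
move=> E; rewrite -subr_ge0 E mulr_ge0 ?subr_ge0//.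
by rewrite invr_ge0 exprn_ge0// ltW// cosh_gt0.
Qed.

Lemma tanh_le_id x : 0 <= x -> tanh x <= x.
Proof.
have df (y : R) : is_derive y 1 (fun z => z - tanh z) (1 - (cosh y ^+ 2)^-1).
  by have ? := is_derive_tanh y; apply: is_derive_eq.
move=> /(is_derive_ge0_le df); rewrite tanh0 subr0 subr_ge0; apply => y _.
by rewrite subr_ge0 invf_le1 ?exprn_gt0 ?cosh_gt0// exprn_ege1// cosh_ge1.
Qed.

(** Concavity on the half-line together with [tanh 0 = 0]. Differentiating in [x] leaves only the
    monotonicity of [cosh]. *)
Lemma tanh_concave (l x : R) : 0 <= l <= 1 -> 0 <= x -> l * tanh x <= tanh (l * x).
Proof.
move=> /andP[l0 l1].
have df (y : R) : is_derive y 1 (fun z => tanh (l * z) - l * tanh z)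
    (l * (cosh (l * y) ^+ 2)^-1 - l * (cosh y ^+ 2)^-1).
  have ? := is_derive_tanh y; have ? := is_derive_tanh (l * y).
  have ? : is_derive y 1 (fun z => l * z) l.
    by apply: is_derive_eq; rewrite /GRing.scale/= mulr1.
  have ? := is_derive_compf (is_derive_tanh (l * y)) (_ : is_derive y 1 (fun z => l * z) l).
  by apply: is_derive_eq; rewrite /GRing.scale/= [_ * l]mulrC.
move=> /(is_derive_ge0_le df); rewrite mulr0 tanh0 mulr0 subr0 subr_ge0; apply => y y0.
rewrite -mulrBr mulr_ge0// subr_ge0 lef_pV2 ?posrE ?exprn_gt0 ?cosh_gt0//.
rewrite ler_sqr ?nnegrE; [|exact/ltW/cosh_gt0|exact/ltW/cosh_gt0].
by rewrite le_cosh ?mulr_ge0// ler_piMl.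
Qed.

(** Denominator-free form of tanh x >= 3 x / (3 + x^2), a convergent of Lambert's continued
    fraction. The derivative of the difference is x (x cosh x - sinh x), nonnegative by
    [tanh_le_id]. *)
Lemma cosh_le_expsqr_sinh x : 0 <= x -> 3 * (x * cosh x) <= (3 + x ^+ 2) * sinh x.
Proof.
have df (y : R) : is_derive y 1 (fun z => (3 + z ^+ 2) * sinh z - 3 * (z * cosh z))
    (y * (y * cosh y - sinh y)).
  have ? := is_derive_sinh y; have ? := is_derive_cosh y.
  by apply: is_derive_eq; rewrite /GRing.scale/=; ring.
move=> /(is_derive_ge0_le df); rewrite sinh0 !(mulr0,mul0r) subr0 subr_ge0; apply => y y0.
rewrite mulr_ge0// subr_ge0 -ler_pdivrMr ?cosh_gt0//.
exact: tanh_le_id.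
Qed.

Lemma tanh_ge_rational x : 0 <= x -> 3 * x <= (3 + x ^+ 2) * tanh x.
Proof.
move=> /cosh_le_expsqr_sinh h.
by rewrite /tanh mulrA ler_pdivlMr ?cosh_gt0// -mulrA.
Qed.

(** By cosh^2 = 1 + sinh^2 this is sinh x >= x. The resulting lower bound tends to 1 at infinity,
    where that of [tanh_ge_rational] degenerates. *)
Lemma sqr_tanh_ge x : 0 <= x -> x ^+ 2 <= (1 + x ^+ 2) * tanh x ^+ 2.
Proof.
move=> x0; rewrite /tanh expr_div_n mulrA ler_pdivlMr ?exprn_gt0 ?cosh_gt0//.
have := cosh2Bsinh2 x; have := ge_id_sinh x0; nra.
Qed.

Definition poisson s z : R := sinh s / (cosh s - cos z).

Lemma sinh_half s : sinh s = 2 * tanh (s / 2) * cosh (s / 2) ^+ 2.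
Proof.
rewrite [in LHS](splitr s) sinhD /tanh; field.
by rewrite gt_eqF ?cosh_gt0.
Qed.

Lemma cosh_half s : cosh s = (1 + tanh (s / 2) ^+ 2) * cosh (s / 2) ^+ 2.
Proof.
rewrite [in LHS](splitr s) coshD /tanh; field.
by rewrite gt_eqF ?cosh_gt0.
Qed.

Lemma cosh_half1 s : (1 - tanh (s / 2) ^+ 2) * cosh (s / 2) ^+ 2 = 1.
Proof.
have := cosh2Bsinh2 (s / 2) => E; rewrite /tanh -[RHS]E; field.
by rewrite gt_eqF ?cosh_gt0.
Qed.

(** With p = tanh (s/2), j = 1 - cos z and k = 1 + cos z the kernel is 2 p / (j + k p^2), where j, k
    >= 0 and j + k = 2. Through [tanhD], comparisons of kernels become polynomial inequalities. *)
Lemma poisson_tanh s z :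
  poisson s z = 2 * tanh (s / 2) / ((1 - cos z) + (1 + cos z) * tanh (s / 2) ^+ 2).
Proof.
rewrite /poisson (cosh_half s) (sinh_half s); have E := cosh_half1 s; move: E.
set p := tanh _; set c := cos z; set A := cosh _ => E.
have A0 : A ^+ 2 != 0 by rewrite expf_neq0// gt_eqF// cosh_gt0.
have -> : (1 + p ^+ 2) * A ^+ 2 - c = ((1 - c) + (1 + c) * p ^+ 2) * A ^+ 2.
  by transitivity ((1 + p ^+ 2) * A ^+ 2 - c * ((1 - p ^+ 2) * A ^+ 2)); [rewrite E mulr1|ring].
by rewrite -mulf_div divff// mulr1.
Qed.

(** The minimum over [z] is attained at cos z = -1: since p^2 <= 1, the denominator j + k p^2 is at
    most 2. *)
Lemma poisson_ge_tanh s z : 0 <= s -> tanh (s / 2) <= poisson s z.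
Proof.
move=> s0; rewrite poisson_tanh; have c1 := cos_le1 z; have c2 := cos_geN1 z.
have p1 := sqr_tanh_lt1 (s / 2); have : 0 <= tanh (s / 2) by rewrite tanh_ge0// divr_ge0.
rewrite le_eqVlt => /predU1P[<-|]; first by rewrite mulr0 mul0r.
set p := tanh _ in p1 * => p0; set c := cos z in c1 c2 *.
have p20 : 0 < p ^+ 2 by rewrite exprn_gt0.
have h : 0 <= (1 + c) * (1 - p ^+ 2) by rewrite mulr_ge0; lra.
have h' : 0 < (1 - c) + (1 + c) * p ^+ 2.
  have : 0 <= (1 - c) * (1 - p ^+ 2) by rewrite mulr_ge0; lra.
  by nra.
by rewrite ler_pdivlMr// mulrC ler_pM2r//; lra.
Qed.

Lemma poisson_ge0 s z : 0 <= s -> 0 <= poisson s z.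
Proof.
by move=> s0; rewrite (le_trans _ (poisson_ge_tanh z s0))// tanh_ge0// divr_ge0.
Qed.

(** For cos z > 0 the kernel exceeds its limit 1 at large [s] and is therefore not concave in [s],
    so subadditivity is checked algebraically in the half-angle variables. *)
Lemma poisson_subadditive s t z : 0 <= s -> 0 <= t ->
  poisson (s + t) z <= poisson s z + poisson t z.
Proof.
rewrite le_eqVlt => /predU1P[<- _|s0].
  by rewrite add0r /poisson sinh0 mul0r add0r.
rewrite le_eqVlt => /predU1P[<-|t0].
  by rewrite addr0 /poisson sinh0 mul0r addr0.
rewrite !poisson_tanh (mulrDl s t) tanhD.
have c1 := cos_le1 z; have c2 := cos_geN1 z.
have := sqr_tanh_lt1 (s / 2); have := sqr_tanh_lt1 (t / 2).
have := tanh_lt1 (s / 2); have := tanh_lt1 (t / 2).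
have : 0 < tanh (s / 2) by rewrite tanh_gt0// divr_gt0.
have : 0 < tanh (t / 2) by rewrite tanh_gt0// divr_gt0.
move: (tanh (s / 2)) (tanh (t / 2)) => p w; set j := 1 - cos z; set k := 1 + cos z.
move=> w0 p0 w1 p1 w21 p21.
have j0 : 0 <= j by rewrite subr_ge0.
have k0 : 0 <= k by rewrite /k; lra.
have jk : j + k = 2 by rewrite /j /k; ring.
have pw0 : 0 < p * w by rewrite mulr_gt0.
have pw1 : p * w <= 1 by nra.
have p20 : 0 < p ^+ 2 by rewrite exprn_gt0.
have w20 : 0 < w ^+ 2 by rewrite exprn_gt0.
have dp : 0 < j + k * p ^+ 2.
  have : 0 <= j * (1 - p ^+ 2) by rewrite mulr_ge0; lra.
  by nra.
have dw : 0 < j + k * w ^+ 2.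
  have : 0 <= j * (1 - w ^+ 2) by rewrite mulr_ge0; lra.
  by nra.
have d1 : 0 < 1 + p * w by lra.
have d : 0 < j * (1 + p * w) ^+ 2 + k * (p + w) ^+ 2.
  have : 0 < (1 + p * w) ^+ 2 by rewrite exprn_gt0.
  have : 0 < (p + w) ^+ 2 by rewrite exprn_gt0// addr_gt0.
  by nra.
have -> : 2 * ((p + w) / (1 + p * w)) / (j + k * ((p + w) / (1 + p * w)) ^+ 2) =
    2 * (p + w) * (1 + p * w) / (j * (1 + p * w) ^+ 2 + k * (p + w) ^+ 2).
  by field; rewrite !gt_eqF// -?expr2 -?exprMn//.
have -> : 2 * p / (j + k * p ^+ 2) + 2 * w / (j + k * w ^+ 2) =
    2 * (p + w) * (j + k * (p * w)) / ((j + k * p ^+ 2) * (j + k * w ^+ 2)).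
  by field; rewrite !gt_eqF// -?expr2 -?exprMn//.
rewrite ler_pdivrMr// [leRHS]mulrAC ler_pdivlMr ?mulr_gt0//.
rewrite -!mulrA ler_pM2l// ler_pM2l ?addr_gt0//.
rewrite -subr_ge0.
(* The second factor is a quadratic form in j and k whose coefficients are nonnegative for p and w
   between 0 and 1. *)
have -> : (j + k * (p * w)) * (j * (1 + p * w) ^+ 2 + k * (p + w) ^+ 2) -
  (1 + p * w) * ((j + k * p ^+ 2) * (j + k * w ^+ 2)) =
  p * w * (j ^+ 2 * (1 + p * w) + j * k * (2 + (1 + p * w) ^+ 2 - (p ^+ 2 + w ^+ 2))
    + k ^+ 2 * (p ^+ 2 + w ^+ 2 + p * w * (1 - p * w))) by ring.
rewrite mulr_ge0 ?(ltW pw0)// !addr_ge0//.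
- by rewrite mulr_ge0 ?sqr_ge0// ltW.
- by rewrite !mulr_ge0//; have := sqr_ge0 (1 + p * w); lra.
- by rewrite mulr_ge0 ?sqr_ge0// !addr_ge0 ?sqr_ge0// mulr_ge0 ?(ltW pw0)// subr_ge0.
Qed.

(* The condition on tanh is the case cos z = 1, the extremal one as soon as K >= 1/2. *)
Lemma poisson_le_shift K s t z : 0 <= s -> 0 < t -> 1 / 2 <= K ->
  tanh (s / 2) ^+ 2 * (1 - tanh (t / 2) ^+ 2) <=
    K * (tanh (t / 2) * (tanh (s / 2) + tanh (t / 2))) ->
  poisson t z <= poisson (t + s) z + K * poisson s z.
Proof.
rewrite le_eqVlt => /predU1P[<- _ _ _|s0 t0 K2].
  by rewrite addr0 /poisson sinh0 mul0r mulr0 addr0.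
rewrite !poisson_tanh (addrC t) (mulrDl s t) tanhD.
have c1 := cos_le1 z; have c2 := cos_geN1 z.
have := sqr_tanh_lt1 (s / 2); have := sqr_tanh_lt1 (t / 2).
have : 0 < tanh (s / 2) by rewrite tanh_gt0// divr_gt0.
have : 0 < tanh (t / 2) by rewrite tanh_gt0// divr_gt0.
move: (tanh (s / 2)) (tanh (t / 2)) => p w; set j := 1 - cos z; set k := 1 + cos z.
move=> w0 p0 w21 p21 h.
have j0 : 0 <= j by rewrite subr_ge0.
have k0 : 0 <= k by rewrite /k; lra.
have jk : j + k = 2 by rewrite /j /k; ring.
have pw0 : 0 < p * w by rewrite mulr_gt0.
have p20 : 0 < p ^+ 2 by rewrite exprn_gt0.
have w20 : 0 < w ^+ 2 by rewrite exprn_gt0.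
have dp : 0 < j + k * p ^+ 2.
  have : 0 <= j * (1 - p ^+ 2) by rewrite mulr_ge0; lra.
  by nra.
have dw : 0 < j + k * w ^+ 2.
  have : 0 <= j * (1 - w ^+ 2) by rewrite mulr_ge0; lra.
  by nra.
have d1 : 0 < 1 + p * w by lra.
have d : 0 < j * (1 + p * w) ^+ 2 + k * (p + w) ^+ 2.
  have : 0 < (1 + p * w) ^+ 2 by rewrite exprn_gt0.
  have : 0 < (p + w) ^+ 2 by rewrite exprn_gt0// addr_gt0.
  by nra.
have -> : 2 * ((p + w) / (1 + p * w)) / (j + k * ((p + w) / (1 + p * w)) ^+ 2) =
    2 * (p + w) * (1 + p * w) / (j * (1 + p * w) ^+ 2 + k * (p + w) ^+ 2).
  by field; rewrite !gt_eqF// -?expr2 -?exprMn//.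
rewrite -lerBlDl.
have -> : 2 * w / (j + k * w ^+ 2) -
    2 * (p + w) * (1 + p * w) / (j * (1 + p * w) ^+ 2 + k * (p + w) ^+ 2) =
    2 * p * ((1 - w ^+ 2) * (k * (w * (p + w)) - j * (1 + p * w))) /
    ((j + k * w ^+ 2) * (j * (1 + p * w) ^+ 2 + k * (p + w) ^+ 2)).
  by field; rewrite !gt_eqF// -?expr2 -?exprMn//.
rewrite [leRHS]mulrA ler_pdivlMr// [leLHS]mulrAC ler_pdivrMr ?mulr_gt0//.
rewrite (mulrC K) -!mulrA ler_pM2l// ler_pM2l//.
rewrite -subr_ge0.
set q := p * w; set v := w * (p + w).
have v0 : 0 < v by rewrite mulr_gt0// addr_gt0.
(* The coefficient of k^2 is nonnegative by the hypothesis on tanh; the mixed coefficient uses K >=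
   1/2, through v <= ((p + w)^2 + w^2) / 2. *)
have -> : K * ((j + k * w ^+ 2) * (j * (1 + q) ^+ 2 + k * (p + w) ^+ 2)) -
   (1 - w ^+ 2) * ((k * v - j * (1 + q)) * (j + k * p ^+ 2)) =
   j ^+ 2 * (K * (1 + q) ^+ 2 + (1 - w ^+ 2) * (1 + q)) +
   j * k * (K * ((p + w) ^+ 2 + w ^+ 2 * (1 + q) ^+ 2) - (1 - w ^+ 2) * v +
     (1 - w ^+ 2) * (p ^+ 2 * (1 + q))) +
   k ^+ 2 * (v * (K * v - p ^+ 2 * (1 - w ^+ 2))) by rewrite /q /v; ring.
have K0 : 0 < K by lra.
have w1 : 0 <= 1 - w ^+ 2 by lra.
have q1 : 0 < 1 + q by [].
rewrite !addr_ge0//.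
- rewrite mulr_ge0 ?sqr_ge0// addr_ge0// mulr_ge0//; [exact: ltW|exact: sqr_ge0|exact: ltW].
- rewrite !mulr_ge0// addr_ge0//; last by rewrite !mulr_ge0// ltW.
  have h1 : (p + w) ^+ 2 + w ^+ 2 <= (p + w) ^+ 2 + w ^+ 2 * (1 + q) ^+ 2.
    by rewrite lerD2l ler_peMr ?(ltW w20)// exprn_ege1// lerDl ltW.
  have h2 : 0 <= K * ((p + w) ^+ 2 + w ^+ 2 * (1 + q) ^+ 2 - ((p + w) ^+ 2 + w ^+ 2)).
    by rewrite mulr_ge0 ?(ltW K0)// subr_ge0.
  have h3 : 0 <= (K - 1 / 2) * ((p + w) ^+ 2 + w ^+ 2).
    by rewrite mulr_ge0 ?subr_ge0// addr_ge0 ?sqr_ge0.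
  have h4 : v <= 1 / 2 * ((p + w) ^+ 2 + w ^+ 2) by rewrite /v; have := sqr_ge0 p; nra.
  have h5 : 0 <= w ^+ 2 * v by rewrite mulr_ge0 ?ltW.
  by lra.
- rewrite mulr_ge0 ?sqr_ge0// mulr_ge0 ?(ltW v0)// subr_ge0; exact: h.
Qed.

End hyperbolic_theory.

(** * Integrals over intervals *)

Section integral_toolkit.
Context {R : realType}.
Notation mu := (@lebesgue_measure R).
Implicit Types (f g F : R -> R) (a b c C : R).

(** The denominators cosh (u x - u (x - b)) - cos b vanish at b = 0. Inversion, with 0^-1 = 0, is
    discontinuous there but still measurable, which makes every quotient below measurable without a
    case distinction. *)
Lemma measurable_fun_inv : measurable_fun [set: R] (@GRing.inv R).
Proof.
pose D := [set x : R | x != 0].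
have mD : measurable D.
  rewrite (_ : D = ~` [set 0]); first exact: measurableC.
  by apply/seteqP; split => x /= /eqP.
rewrite -(setUv D); apply/measurable_funU => //; first exact: measurableC.
split; last first.
  rewrite (_ : ~` D = [set 0]); first exact: measurable_fun_set1.
  apply/seteqP; split => x /=; rewrite /D/=; first by move/negP; rewrite negbK => /eqP.
  by move=> ->; rewrite eqxx.
apply: open_continuous_measurable_fun; first exact: open_neq.
by move=> x; rewrite inE/= => x0; exact: inv_continuous.
Qed.

Lemma measurable_funV d (T : measurableType d) (D : set T) (h : T -> R) :
  measurable_fun D h -> measurable_fun D (fun x => (h x)^-1).
Proof. by move=> mh; exact: (measurableT_comp measurable_fun_inv mh). Qed.

Lemma measurable_funM_inv d (T : measurableType d) (D : set T) (h k : T -> R) :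
  measurable_fun D h -> measurable_fun D k -> measurable_fun D (fun x => h x / k x).
Proof. by move=> mh mk; apply: measurable_funM => //; exact: measurable_funV. Qed.

Lemma integrable_bounded a b g C : measurable_fun [set: R] g ->
  (forall x, a <= x <= b -> `|g x| <= C) -> mu.-integrable `[a, b] (EFin \o g).
Proof.
move=> mg gC; apply: measurable_bounded_integrable => //.
- rewrite /= lebesgue_measure_itv/=; case: ifPn => // _.
  by rewrite -EFinB ltry.
- exact: measurable_funS mg.
- exists C; split; rewrite ?num_real// => M CM x /=; rewrite in_itv/= => abx.
  by rewrite (le_trans (gC _ abx))// ltW.
Qed.

Lemma integrable_continuous a b g : continuous g -> mu.-integrable `[a, b] (EFin \o g).
Proof.
move=> cg; apply: continuous_compact_integrable; first exact: segment_compact.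
by apply: continuous_subspaceT.
Qed.

Lemma Rintegral_itv_cat a b c g : a <= b -> b <= c ->
  mu.-integrable `[a, c] (EFin \o g) ->
  \int[mu]_(x in `[a, c]) g x = \int[mu]_(x in `[a, b]) g x + \int[mu]_(x in `[b, c]) g x.
Proof.
move=> ab bc ig.
have := @Rintegral_itvB R g (BLeft a) (BRight c) b ig.
rewrite !bnd_simp => /(_ ab bc) E; rewrite -(@Rintegral_itv_obnd_cbnd R b (BRight c) g); last first.
  apply: integrableS ig => //; apply: subset_itvr; rewrite bnd_simp//.
by rewrite -E addrC subrK.
Qed.

Lemma le_normr_Rintegral_bounded a b g C : a <= b -> measurable_fun [set: R] g ->
  (forall x, a <= x <= b -> `|g x| <= C) ->
  `|\int[mu]_(x in `[a, b]) g x| <= C * (b - a).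
Proof.
move=> ab mg gC; have ig := integrable_bounded mg gC.
have ic : mu.-integrable `[a, b] (EFin \o cst C).
  by apply: integrable_continuous => x; exact: cvg_cst.
apply: (le_trans (le_normr_Rintegral _ ig)) => //.
apply: (@le_trans _ _ (\int[mu]_(x in `[a, b]) (cst C) x)).
  apply: le_Rintegral => //.
    by apply: (@integrable_bounded _ _ _ C); [exact: measurableT_comp|move=> x /gC; rewrite normr_id].
rewrite Rintegral_cst//= [X in fine X](_ : _ = (b - a)%:E)//.
rewrite /= lebesgue_measure_itv/= lte_fin -EFinB.
by case: ltP => // ba; rewrite (_ : a = b) ?subrr//; apply/le_anti/andP.
Qed.

Lemma continuous_is_derive_FTC2 a b F g : a <= b -> {within `[a, b], continuous F} ->
  (forall x, x \in `]a, b[ -> is_derive x 1 F (g x)) ->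
  {within `[a, b], continuous g} -> \int[mu]_(x in `[a, b]) g x = F b - F a.
Proof.
rewrite le_eqVlt => /predU1P[-> _ _ _|ab cF dF cg].
  by rewrite set_itv1 Rintegral_set1 subrr.
rewrite /Rintegral (@continuous_FTC2 R g F a b)//.
  have [] := (continuous_within_itvP F ab).1 cF => cF1 Fa Fb.
  by split => // x xab; have [] := dF x xab.
by move=> x xab; rewrite derive1E; have dFx := dF _ xab; rewrite derive_val.
Qed.

Lemma is_derive_continuous (h dh : R -> R) :
  (forall x : R, is_derive x 1 h (dh x)) -> continuous h.
Proof.
by move=> dh_ x; apply/differentiable_continuous/derivable1_diffP; have [] := dh_ x.
Qed.

Lemma is_derive_FTC2 a b F g : a <= b -> (forall x : R, is_derive x 1 F (g x)) ->
  continuous g -> \int[mu]_(x in `[a, b]) g x = F b - F a.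
Proof.
move=> ab dF cg; apply: (@continuous_is_derive_FTC2 a b F g) => //.
- by apply: continuous_subspaceT; exact: is_derive_continuous dF.
- exact: continuous_subspaceT.
Qed.

(* [g] need not have limits at the end points of the interval. *)
Lemma bounded_is_derive_FTC2 a b F g C : a < b -> {within `[a, b], continuous F} ->
  (forall x, x \in `]a, b[ -> is_derive x 1 F (g x)) -> {in `]a, b[, continuous g} ->
  measurable_fun [set: R] g -> (forall x, a <= x <= b -> `|g x| <= C) ->
  \int[mu]_(x in `[a, b]) g x = F b - F a.
Proof.
move=> ab cF dF cg mg gC; have ig := integrable_bounded mg gC.
have [_ Fa Fb] := (continuous_within_itvP F ab).1 cF.
have C0 : 0 <= C by rewrite (le_trans (normr_ge0 (g a)))// gC// lexx ltW.
(* Error of cutting off a length [e] at both ends: [C * e] for each lost integral, plus the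
   variation of [F] near each end. *)
pose K e := C * e + C * e + `|F (a + e) - F a| + `|F (b - e) - F b|.
have key e : 0 < e -> e < (b - a) / 2 ->
    `|\int[mu]_(x in `[a, b]) g x - (F b - F a)| <= K e.
  move=> e0 eba; have ae : a < a + e by rewrite ltrDl.
  have be : b - e < b by rewrite ltrBlDr ltrDl.
  have aebe : a + e < b - e by lra.
  rewrite (Rintegral_itv_cat (b := a + e)) ?(ltW ae)//; last by lra.
  rewrite (Rintegral_itv_cat (a := a + e) (b := b - e)) ?(ltW aebe) ?(ltW be)//; last first.
    by apply: integrableS ig => //; apply: subset_itvr; rewrite bnd_simp ltW.
  have s : `[a + e, b - e] `<=` `]a, b[.
    by move=> x /=; rewrite !in_itv/= => /andP[h1 h2]; rewrite (lt_le_trans ae)//= (le_lt_trans h2).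
  have -> : \int[mu]_(x in `[a + e, b - e]) g x = F (b - e) - F (a + e).
    have H := @continuous_is_derive_FTC2 (a + e) (b - e) F g (ltW aebe).
    apply H.
  - by apply: continuous_subspaceW cF => x /s; exact: subset_itv_oo_cc.
  - by move=> x /subset_itv_oo_cc xab; apply: dF; exact: s.
  - by apply: continuous_in_subspaceT => x; rewrite inE => /s; exact: cg.
  rewrite /K; set I1 := Rintegral _ _ _; set I2 := Rintegral _ _ _.
  have l1 : `|I1| <= C * e.
    have h x : a <= x <= a + e -> `|g x| <= C by move=> /andP[h1 h2]; apply: gC; lra.
    by have := le_normr_Rintegral_bounded (ltW ae) mg h; rewrite addrAC subrr add0r.
  have l2 : `|I2| <= C * e.
    have h x : b - e <= x <= b -> `|g x| <= C by move=> /andP[h1 h2]; apply: gC; lra.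
    by have := le_normr_Rintegral_bounded (ltW be) mg h; rewrite opprB addrCA subrr addr0.
  rewrite (_ : _ - _ = I1 + I2 - (F (a + e) - F a) + (F (b - e) - F b)); last by ring.
  apply: (le_trans (ler_normD _ _)); rewrite lerD2r.
  apply: (le_trans (ler_normB _ _)); rewrite lerD2r.
  by apply: (le_trans (ler_normD _ _)); rewrite lerD.
apply/eqP; rewrite -subr_eq0 -normr_le0; apply/ler_addgt0Pr => eps eps0; rewrite add0r.
have e4 : 0 < eps / 4 by rewrite divr_gt0.
have /cvgrPdist_le /(_ _ e4) [d1 /= d10 hd1] := Fa.
have /cvgrPdist_le /(_ _ e4) [d2 /= d20 hd2] := Fb.
have C10 : 0 < C + 1 by rewrite ltr_wpDl.
pose e := Num.min (Num.min (d1 / 2) (d2 / 2)) (Num.min ((b - a) / 4) (eps / 4 / (C + 1))).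
have e0 : 0 < e by rewrite !lt_min !divr_gt0// subr_gt0.
have ed1 : e <= d1 / 2 by rewrite !ge_min lexx.
have ed2 : e <= d2 / 2 by rewrite !ge_min lexx ?orbT.
have eba : e <= (b - a) / 4 by rewrite !ge_min lexx ?orbT.
have eC : e <= eps / 4 / (C + 1) by rewrite !ge_min lexx ?orbT.
apply: (le_trans (key e e0 _)); first by lra.
have hC : C * e <= eps / 4.
  by move: eC; rewrite ler_pdivlMr// => eC; lra.
have h1 : `|F (a + e) - F a| <= eps / 4.
  rewrite distrC; apply: hd1; last by rewrite ltrDl.
  by rewrite /= opprD addrA subrr sub0r normrN gtr0_norm//; lra.
have h2 : `|F (b - e) - F b| <= eps / 4.
  rewrite distrC; apply: hd2; last by rewrite ltrBlDr ltrDl.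
  by rewrite /= opprB addrC subrK gtr0_norm//; lra.
by rewrite /K; lra.
Qed.

End integral_toolkit.

Section primitives.
Context {R : realType}.
Notation mu := (@lebesgue_measure R).
Implicit Types (f g F : R -> R) (a b c C x y T : R).

(** A primitive on the whole line turns reflection and translation of integrals into identities
    between its values, in place of a change of variables. *)
Lemma continuous_primitive g : continuous g -> exists F : R -> R, forall x, is_derive x 1 F (g x).
Proof.
move=> cg; pose I a x := \int[mu]_(y in `[a, x]) g y.
pose F x := if 0 <= x then I 0 x else - I x 0.
exists F => x; pose N := `|x| + 1; have N0 : 0 < N by rewrite ltr_wpDl.
have xN : - N < x < N by rewrite -ltr_norml ltrDl.
have FE y : - N < y < N -> I (- N) y - I (- N) 0 = F y.
  move=> /andP[Ny yN]; rewrite /F; case: ifPn => [y0|]; last rewrite -ltNge => y0.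
    rewrite /I (@Rintegral_itv_cat _ (- N) 0 y) ?oppr_le0 ?(ltW N0)//; last exact: integrable_continuous.
    by ring.
  rewrite /I (@Rintegral_itv_cat _ (- N) y 0) ?(ltW y0) ?(ltW Ny)//; last exact: integrable_continuous.
  by ring.
have /andP[Nx xN'] := xN.
have [dI I'] := continuous_FTC1_closed xN' (integrable_continuous (- N) N cg) Nx (cg x).
have dI1 : is_derive x 1 (I (- N)) (g x).
  apply: (DeriveDef dI).
  by rewrite -derive1E; exact: I'.
apply: (@near_eq_is_derive R _ _ (fun y => I (- N) y - I (- N) 0) F x 1).
- have : x \in `]- N, N[ by rewrite in_itv/=.
  by move=> /near_in_itvoo; apply: filterS => y; rewrite in_itv/= => /FE.
- by apply: is_derive_eq; rewrite subr0.
Qed.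

Lemma is_derive_const_eq (h : R -> R) : (forall x, is_derive x 1 h 0) -> forall x y, h x = h y.
Proof. by move=> dh x y; apply: is_derive_0_is_cst. Qed.

Lemma is_derive_shiftf g c x (dg : R) :
  is_derive (x + c) 1 g dg -> is_derive x 1 (fun y => g (y + c)) dg.
Proof.
move=> h; rewrite -[dg]mulr1; apply: is_derive_compf => //.
by apply: is_derive_eq; rewrite addr0.
Qed.

Lemma is_derive_reflect g c x (dg : R) :
  is_derive (c - x) 1 g dg -> is_derive x 1 (fun y => g (c - y)) (- dg).
Proof.
move=> h; rewrite -mulrN1; apply: is_derive_compf => //.
by apply: is_derive_eq; rewrite add0r mul1r.
Qed.

Lemma Rintegral_reflect a b c g : a <= b -> continuous g ->
  \int[mu]_(x in `[a, b]) g (c - x) = \int[mu]_(x in `[c - b, c - a]) g x.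
Proof.
move=> ab cg; have [F dF] := continuous_primitive cg.
have cab : c - b <= c - a by rewrite lerD2l lerN2.
rewrite (is_derive_FTC2 cab dF cg).
have dG x : is_derive x 1 (fun y => - F (c - y)) (g (c - x)).
  by have ? := is_derive_reflect (dF (c - x)); apply: is_derive_eq; rewrite opprK.
rewrite (is_derive_FTC2 ab dG) 1?addrC ?opprK//.
move=> x; apply: (@continuous_comp _ _ _ (fun y => c - y)); last exact: cg.
by apply: continuousB => //; exact: cst_continuous.
Qed.

Lemma Rintegral_periodic g T a b : 0 <= T -> continuous g -> (forall x, g (x + T) = g x) ->
  \int[mu]_(x in `[a, a + T]) g x = \int[mu]_(x in `[b, b + T]) g x.
Proof.
move=> T0 cg gT; have [F dF] := continuous_primitive cg.
rewrite !(is_derive_FTC2 _ dF cg) ?lerDl//.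
apply: (@is_derive_const_eq (fun x => F (x + T) - F x)) => x.
have ? := is_derive_shiftf (dF (x + T)).
by apply: is_derive_eq; rewrite gT subrr.
Qed.

End primitives.

(** * Fubini's theorem for bounded functions on rectangles *)

Section fubini_bounded.
Context {R : realType}.
Notation mu := (@lebesgue_measure R).
Implicit Types (G : R * R -> R) (a b c d C x y : R).

(** Extension by zero: Fubini's theorem is applied to integrals over the whole lines. *)
Let H G (A B : set R) (z : R * R) : R := G z * (\1_A z.1 * \1_B z.2).

Let measurable_H G A B : measurable A -> measurable B ->
  measurable_fun [set: R * R] G -> measurable_fun [set: R * R] (H G A B).
Proof.
move=> mA mB mG; apply: measurable_funM => //; apply: measurable_funM.
- exact: (measurableT_comp (measurable_indic mA) measurable_fst).
- exact: (measurableT_comp (measurable_indic mB) measurable_snd).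
Qed.

Let Rintegral_indic (A : set R) (g : R -> R) : measurable A ->
  \int[mu]_(y in A) g y = \int[mu]_y (g y * \1_A y).
Proof.
move=> mA; rewrite Rintegral_mkcond; apply: eq_Rintegral => y _.
by rewrite patchE indicE; case: (y \in A); rewrite ?mulr1 ?mulr0.
Qed.

(** Integrability is not assumed: the inner integral is the finite part of a difference of integrals
    of positive and negative parts, each measurable by Tonelli. *)
Lemma measurable_fun_Rintegral G (B : set R) : measurable B -> measurable_fun [set: R * R] G ->
  measurable_fun [set: R] (fun x => \int[mu]_(y in B) G (x, y)).
Proof.
move=> mB mG; pose K (z : R * R) : \bar R := (H G setT B z)%:E.
have mK : measurable_fun [set: R * R] K by apply/measurable_EFinP; exact: measurable_H.
have -> : (fun x => \int[mu]_(y in B) G (x, y)) =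
    (fun x => fine ((\int[mu]_y K^\+ (x, y)) - (\int[mu]_y K^\- (x, y)))%E).
  apply/funext => x; rewrite Rintegral_indic// /Rintegral; congr fine.
  rewrite [LHS]integralE; congr (_ - _)%E; apply: eq_integral => y _.
    by rewrite !funeposE /K /H indicT mul1r.
  by rewrite !funenegE /K /H indicT mul1r.
apply: measurableT_comp => //.
by apply: emeasurable_funB; apply: measurable_fun_fubini_tonelli_F => //;
  [exact: measurable_funepos|exact: measurable_funeneg].
Qed.

Let fine_iterated (k : R -> R -> R) a b c d C :
  (forall x, measurable_fun [set: R] (k x)) ->
  (forall x y, a <= x <= b -> c <= y <= d -> `|k x y| <= C) ->
  \int[mu]_(x in `[a, b]) (\int[mu]_(y in `[c, d]) k x y) =
  fine (\int[mu]_x \int[mu]_y (k x y * (\1_`[a, b] x * \1_`[c, d] y))%:E)%E.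
Proof.
move=> mk kC; rewrite Rintegral_indic// {1}/Rintegral; congr fine.
apply: eq_integral => x _; rewrite indicE mem_setE.
have [xab|] := boolP (x \in `[a, b]); last first.
  by under eq_integral do rewrite mul0r mulr0; rewrite mulr0 integral0.
have ik : mu.-integrable `[c, d] (EFin \o k x).
  by apply: (@integrable_bounded _ _ _ _ C) => // y ycd; apply: kC => //; rewrite in_itv in xab.
under eq_integral do rewrite mul1r; rewrite mulr1.
rewrite Rintegral_indic// /Rintegral fineK// integrable_fin_num//.
suff -> : (fun y => (k x y * \1_`[c, d] y)%:E) = (EFin \o k x) \_ `[c, d].
  by apply: (proj1 (integrable_mkcond _ _) ik).
apply/funext => y; rewrite patchE indicE; case: ifP => _; first by rewrite mulr1.
by rewrite mulr0.
Qed.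

Lemma Rintegral_Fubini_bounded G a b c d C : measurable_fun [set: R * R] G ->
  (forall x y, a <= x <= b -> c <= y <= d -> `|G (x, y)| <= C) ->
  \int[mu]_(x in `[a, b]) (\int[mu]_(y in `[c, d]) G (x, y)) =
  \int[mu]_(y in `[c, d]) (\int[mu]_(x in `[a, b]) G (x, y)).
Proof.
move=> mG GC; pose A : set R := `[a, b]%classic; pose B : set R := `[c, d]%classic.
have mA : measurable A by exact: measurable_itv.
have mB : measurable B by exact: measurable_itv.
have mx x : measurable_fun [set: R] (fun y => G (x, y)).
  apply: (measurableT_comp (g := fun y => (x, y)) mG); exact: measurable_fun_pair.
have my y : measurable_fun [set: R] (fun x => G (x, y)).
  apply: (measurableT_comp (g := fun x => (x, y)) mG); exact: measurable_fun_pair.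
rewrite [LHS](@fine_iterated (fun x y => G (x, y)) a b c d C)//.
have GC' y x : c <= y <= d -> a <= x <= b -> `|G (x, y)| <= C by move=> ? ?; exact: GC.
rewrite [RHS](@fine_iterated (fun y x => G (x, y)) c d a b C my GC').
pose K z := (H G A B z)%:E.
have iK : ((mu \x mu)%E).-integrable setT K.
  have -> : K = (EFin \o G) \_ (A `*` B).
    apply/funext => -[x y]; rewrite patchE /K /H !indicE in_setX/=.
    by case: (x \in A); case: (y \in B); rewrite ?mulr1 ?mulr0.
  have mAB : measurable (A `*` B : set (measurableTypeR R * measurableTypeR R)).
    by apply: measurableX; exact: measurable_itv.
  have h := @integrable_mkcond _ _ R (mu \x mu)%E _ (EFin \o G) mAB.
  apply: (proj1 h).
  apply: (measurable_bounded_integrable mAB).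
  - have fin (e f : R) : (mu `[e, f] < +oo)%E.
      by rewrite lebesgue_measure_itv/=; case: ifPn => // _; rewrite -EFinB ltry.
    rewrite /= [ltLHS]product_measure1E; [|exact: measurable_itv..].
    apply: lte_mul_pinfty; [exact: measure_ge0| |exact: fin].
    by rewrite ge0_fin_numE; [exact: fin|exact: measure_ge0].
  - have mG' : measurable_fun [set: (measurableTypeR R * measurableTypeR R)%type] G by exact: mG.
    exact: measurable_funS mG'.
  - exists C; split; rewrite ?num_real// => M CM [x y] /= [xA yB].
    by rewrite (le_trans (GC _ _ xA yB))// ltW.
have := Fubini iK; rewrite /K /H /= => ->; apply: (congr1 fine).
apply: eq_integral => y _; apply: eq_integral => x _.
by rewrite (mulrC (\1_`[c, d] y)).
Qed.

End fubini_bounded.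

Section principal_value.
Context {R : realType}.
Notation mu := (@lebesgue_measure R).
Implicit Types (g : R -> R) (c C : R).

(** The excised interval contributes at most 2 C e. Every principal value in the equation is of this
    kind: the first integrand is bounded because f(t) is of class C^{1,1}, the others because l >=
    h2 > 0. *)
Lemma pv_intE c g C : measurable_fun [set: R] g ->
  (forall b, c - pi <= b <= c + pi -> `|g b| <= C) ->
  pv_int c g = \int[mu]_(b in `[c - pi, c + pi]) g b.
Proof.
move=> mg gC; have pi0 := @pi_gt0 R; have ig := integrable_bounded mg gC.
have C0 : 0 <= C by rewrite (le_trans (normr_ge0 (g c)))// gC// ?lerBlDr lerDl andbb ltW.
rewrite /pv_int; apply: cvg_lim => //; apply/cvgrPdist_le => /= eps eps0.
exists (Num.min pi (eps / (2 * C + 1))) => /=.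
  by rewrite lt_min pi0/= divr_gt0// ltr_wpDl// mulr_ge0.
move=> e; rewrite /= sub0r normrN => he e0; move: he; rewrite gtr0_norm// lt_min => /andP[epi ee].
have ce : c - pi <= c - e by lra.
have ce' : c - e <= c + e by lra.
have ce'' : c + e <= c + pi by lra.
have i1 : mu.-integrable `[c - e, c + pi] (EFin \o g).
  by apply: integrableS ig => //; apply: subset_itvr; rewrite bnd_simp.
have -> : \int[mu]_(b in `[c - pi, c + pi]) g b = \int[mu]_(b in `[c - pi, c - e]) g b +
    (\int[mu]_(b in `[c - e, c + e]) g b + \int[mu]_(b in `[c + e, c + pi]) g b).
  rewrite (@Rintegral_itv_cat _ (c - pi) (c - e) (c + pi))//; last exact: le_trans ce''.
  by rewrite (@Rintegral_itv_cat _ (c - e) (c + e) (c + pi)).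
have -> : \int[mu]_(b in `[c - pi, c - e] `|` `[c + e, c + pi]) g b =
    \int[mu]_(b in `[c - pi, c - e]) g b + \int[mu]_(b in `[c + e, c + pi]) g b.
  rewrite Rintegral_setU//.
    apply: integrableS ig => //; first exact: measurableU.
    by move=> x /= []; rewrite !in_itv/= => /andP[? ?]; apply/andP; split; lra.
  apply/disj_setPS => x /= []; rewrite !in_itv/= => /andP[? ?] /andP[? ?]; lra.
rewrite (_ : _ - _ = \int[mu]_(b in `[c - e, c + e]) g b); last by ring.
apply: (@le_trans _ _ (C * (c + e - (c - e)))).
  by apply: le_normr_Rintegral_bounded => // x /andP[? ?]; apply: gC; lra.
have : 2 * C * e <= (2 * C + 1) * e by rewrite ler_wpM2r ?(ltW e0)// lerDl.
move: ee; rewrite ltr_pdivlMr; last by rewrite ltr_wpDl// mulr_ge0.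
by move=> ? ?; lra.
Qed.

End principal_value.

(** * Numerical inequalities *)

Section pi_bound.
Context {R : realType}.
Implicit Types x : R.

Lemma sin_le_id x : 0 <= x -> sin x <= x.
Proof.
have df (y : R) : is_derive y 1 (fun z => z - sin z) (1 - cos y) by apply: is_derive_eq.
move=> /(is_derive_ge0_le df); rewrite sin0 subr0 subr_ge0; apply => y _.
by rewrite subr_ge0 cos_le1.
Qed.

Lemma cos_ge_quadratic x : 0 <= x -> 1 - x ^+ 2 / 2 <= cos x.
Proof.
have df (y : R) : is_derive y 1 (fun z => cos z - (1 - z ^+ 2 / 2)) (y - sin y).
  by apply: is_derive_eq; rewrite /GRing.scale/=; field.
move=> /(is_derive_ge0_le df); rewrite cos0 expr0n/= mul0r subr0 subrr subr_ge0; apply => y y0.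
by rewrite subr_ge0 sin_le_id.
Qed.

Lemma sin_ge_cubic x : 0 <= x -> x - x ^+ 3 / 6 <= sin x.
Proof.
have df (y : R) : is_derive y 1 (fun z => sin z - (z - z ^+ 3 / 6)) (cos y - (1 - y ^+ 2 / 2)).
  by apply: is_derive_eq; rewrite /GRing.scale/=; field.
move=> /(is_derive_ge0_le df); rewrite sin0 expr0n/= mul0r !subr0 subr_ge0; apply => y y0.
by rewrite subr_ge0 cos_ge_quadratic.
Qed.

Lemma cos_le_quartic x : 0 <= x -> cos x <= 1 - x ^+ 2 / 2 + x ^+ 4 / 24.
Proof.
have df (y : R) : is_derive y 1 (fun z => 1 - z ^+ 2 / 2 + z ^+ 4 / 24 - cos z)
    (sin y - (y - y ^+ 3 / 6)).
  by apply: is_derive_eq; rewrite /GRing.scale/=; field.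
move=> /(is_derive_ge0_le df); rewrite cos0 !expr0n/= !mul0r subr0 addr0 subrr subr_ge0.
by apply => y y0; rewrite subr_ge0 sin_ge_cubic.
Qed.

(** The quartic Taylor bound makes cos (8/5) negative, so pi/2 < 8/5. Hence pi^2 < 256/25, the
    constant of the numerical lemmas below. *)
Lemma pi_lt_16_5 : (pi : R) < 16 / 5.
Proof.
have c : cos (8 / 5 : R) < 0 by apply: le_lt_trans (cos_le_quartic _) _; lra.
rewrite ltNge; apply/negP => h.
have : 0 <= cos (8 / 5 : R) by apply: cos_ge0_pihalf; apply/andP; split; have := @pi_gt0 R; lra.
by rewrite leNgt c.
Qed.

End pi_bound.

Section decay_polynomials.
Context {R : realType}.
Implicit Types b m p q x y Y v : R.

(** From tanh y <= y one gets e^(2y) <= (1 + y) / (1 - y); this is used at y = 91/800 and raised to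
    the fourth power. *)
Lemma expR_91_lt : expR (91 / 100 : R) < 5 / 2.
Proof.
pose y : R := 91 / 800.
have h : expR (2 * y) <= (1 + y) / (1 - y).
  have := @tanh_le_id R y; rewrite /tanh /sinh /cosh => /(_ ltac:(rewrite /y; lra)).
  have := expR_gt0 y; have := expRxMexpNx_1 y; rewrite (_ : expR (2 * y) = expR y ^+ 2); last first.
    by rewrite -expRM_natl.
  move: (expR y) (expR (- y)) => a c ac a0.
  have c0 : 0 < c by nra.
  rewrite -mulf_div divff ?pnatr_eq0// mulr1 ler_pdivrMr; last by lra.
  move=> h0; have h : a * (a - c) <= a * (y * (a + c)) by rewrite ler_wpM2l// ltW.
  rewrite ler_pdivlMr; last by rewrite /y; lra.
  have yac : y * (a * c) = y by rewrite ac mulr1.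
  by clear c0; clearbody y; lra.
have -> : 91 / 100 = 4%:R * (2 * y) by rewrite /y; lra.
rewrite expRM_natl; apply: (@le_lt_trans _ _ (((1 + y) / (1 - y)) ^+ 4)).
  by rewrite ler_pXn2r// nnegrE ?expR_ge0// (le_trans _ h)// expR_ge0.
have -> : (1 + y) / (1 - y) = 891 / 709 by rewrite /y; field.
by lra.
Qed.

(** In z = Y - 133/100 the difference of the two sides is a nonnegative combination of powers of z,
    which [lra] finds with these powers as atoms. *)
Lemma decay_polynomial Y : 133 / 100 <= Y ->
  128 / 25 * ((5 / 2 * Y - 1) ^+ 6 * (3 * Y ^+ 2 + 1) * Y) <=
  97 * ((Y ^+ 4 - 1) * (25 / 4 * Y ^+ 6 - 1)).
Proof.
move=> hY; pose z := Y - 133 / 100; have z0 : 0 <= z by rewrite subr_ge0.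
have zi i : 0 <= z ^+ i by rewrite exprn_ge0.
have -> : Y = 133 / 100 + z by rewrite /z; ring.
have := zi 1%N; have := zi 2%N; have := zi 3%N; have := zi 4%N; have := zi 5%N.
have := zi 6%N; have := zi 7%N; have := zi 8%N; have := zi 9%N; have := zi 10%N.
clear zi hY; move: z z0 => z z0; lra.
Qed.

(** [x] is half the oscillation and [b] half the mean of l. The left side of the hypothesis is at
    least linear in [b], the right side of order b^6; as [b] is of order [x], this forces q <= 2 x /
    5, while tanh x is close to x on this range. *)
Lemma small_osc_numerics q x b : 0 <= q -> 0 < x -> x <= 3 / 10 -> 0 < b ->
  b <= 21 / 16 * x -> q * cosh x * sinh (2 * b + 2 * x) <= 256 / 25 * sinh b ^+ 6 ->
  q * (1 + tanh x / 2) <= 97 / 100 * tanh x.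
Proof.
move=> q0 x0 x3 b0 bx h.
have b4 : b <= 2 / 5 by lra.
have b2 : b ^+ 2 <= 4 / 25 by rewrite (_ : 4 / 25 = (2 / 5) ^+ 2); [rewrite ler_sqr ?nnegrE; lra|field].
have S2 : sinh b ^+ 2 <= 6 / 5 * b ^+ 2.
  have := tanh_le_id (ltW b0); rewrite /tanh ler_pdivrMr ?cosh_gt0// => Sb.
  have : sinh b ^+ 2 <= (b * cosh b) ^+ 2.
    by rewrite ler_sqr ?nnegrE//; [exact/sinh_ge0/ltW|exact/ltW/mulr_gt0/cosh_gt0].
  have -> : (b * cosh b) ^+ 2 = b ^+ 2 * (1 + sinh b ^+ 2).
    by rewrite exprMn -(cosh2Bsinh2 b) subrK.
  have : 0 <= sinh b ^+ 2 * (4 / 25 - b ^+ 2) by rewrite mulr_ge0 ?sqr_ge0// subr_ge0.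
  by have := sqr_ge0 b; lra.
have S6 : sinh b ^+ 6 <= 216 / 125 * b ^+ 6.
  rewrite (_ : sinh b ^+ 6 = (sinh b ^+ 2) ^+ 3); last by rewrite -exprM.
  apply: (@le_trans _ _ ((6 / 5 * b ^+ 2) ^+ 3)); last by rewrite le_eqVlt; apply/orP; left; apply/eqP; field.
  by rewrite ler_pXn2r// nnegrE ?sqr_ge0// mulr_ge0 ?sqr_ge0.
have hq : q * (2 * b + 32 / 21 * b) <= 256 / 25 * (216 / 125 * b ^+ 6).
  apply: (@le_trans _ _ (q * cosh x * sinh (2 * b + 2 * x))).
    rewrite -(mulrA q) ler_wpM2l//; apply: (@le_trans _ _ (sinh (2 * b + 2 * x))).
      by apply: (@le_trans _ _ (2 * b + 2 * x)); [lra|apply: ge_id_sinh; lra].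
    by rewrite ler_peMl ?cosh_ge1// sinh_ge0//; lra.
  by apply: (le_trans h); apply: ler_wpM2l S6; lra.
have hq' : q <= x * (2 / 5).
  have b4' : b ^+ 4 <= 16 / 625.
    rewrite (_ : b ^+ 4 = (b ^+ 2) ^+ 2); last by rewrite -exprM.
    by rewrite (_ : 16 / 625 = (4 / 25) ^+ 2); [rewrite ler_sqr ?nnegrE ?sqr_ge0//; lra|field].
  have b6 : b ^+ 6 <= 16 / 625 * b * b.
    rewrite (_ : b ^+ 6 = b ^+ 4 * b * b); last by ring.
    by rewrite !ler_pM2r.
  have : q * (74 / 21) * b <= 256 / 25 * (216 / 125) * (16 / 625 * b) * b by lra.
  by rewrite ler_pM2r// => ?; lra.
have := tanh_ge_rational (ltW x0) => T1; have := tanh_lt1 x => T2.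
have T0 := tanh_gt0 x0.
have x2 : x ^+ 2 <= 9 / 100.
  have : 0 <= (3 / 10 - x) * (3 / 10 + x) by apply: mulr_ge0; lra.
  lra.
have : 3 * x <= 309 / 100 * tanh x by apply: (le_trans T1); rewrite ler_pM2r//; lra.
have : q * (1 + tanh x / 2) <= q * (3 / 2) by rewrite ler_wpM2l//; lra.
lra.
Qed.

(** Here Y = e^x and v = e^(2b). The hypothesis at [v] implies the one at the extreme value V = 5 Y
    / 2: with r = (v - 1) / (V - 1) <= 1, the left side at [v] is at least r^4 times that at V, and
    the right side is exactly r^6 times that at V. At V only [decay_polynomial] remains. *)
Lemma exp_decay_numerics q Y v : 0 <= q -> 133 / 100 <= Y -> 1 < v -> v <= 5 / 2 * Y ->
  q * ((Y ^+ 2 + 1) / (2 * Y)) * ((v ^+ 2 * Y ^+ 4 - 1) / (2 * v * Y ^+ 2)) <=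
    256 / 25 * ((v - 1) ^+ 6 / (64 * v ^+ 3)) ->
  q * (3 * Y ^+ 2 + 1) / 2 <= 97 / 100 * (Y ^+ 2 - 1).
Proof.
move=> q0 Y133 v1 vV h.
have Y0 : 0 < Y by lra.
have v0 : 0 < v by lra.
pose V := 5 / 2 * Y; pose r := (v - 1) / (V - 1).
have V1 : 0 < V - 1 by rewrite /V; lra.
have r0 : 0 < r by rewrite divr_gt0// subr_gt0.
have r1 : r <= 1 by rewrite ler_pdivrMr// mul1r lerD2r.
have rV : r * (V - 1) = v - 1 by rewrite divfK// gt_eqF.
have rv : r * V <= v by nra.
have h1 : q * ((Y ^+ 2 + 1) * (v ^+ 2 * Y ^+ 4 - 1) * v ^+ 2) * 16 <=
    256 / 25 * ((v - 1) ^+ 6 * Y ^+ 3).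
  have e : 0 < 64 * v ^+ 3 * Y ^+ 3 by rewrite !mulr_gt0 ?exprn_gt0.
  move: h; rewrite -(ler_pM2r e).
  congr (_ <= _); by field; rewrite ?gt_eqF.
have s1 : 1 <= Y ^+ 2 by rewrite exprn_ege1//; lra.
have g1 : r * (V * Y ^+ 2 - 1) <= v * Y ^+ 2 - 1 by nra.
have g2 : r * (V * Y ^+ 2 + 1) <= v * Y ^+ 2 + 1 by nra.
have VY : 0 < V * Y ^+ 2 - 1 by nra.
have g : r ^+ 2 * (V ^+ 2 * Y ^+ 4 - 1) <= v ^+ 2 * Y ^+ 4 - 1.
  have -> : r ^+ 2 * (V ^+ 2 * Y ^+ 4 - 1) = (r * (V * Y ^+ 2 - 1)) * (r * (V * Y ^+ 2 + 1)) by ring.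
  have -> : v ^+ 2 * Y ^+ 4 - 1 = (v * Y ^+ 2 - 1) * (v * Y ^+ 2 + 1) by ring.
  by apply: ler_pM => //; rewrite mulr_ge0 ?(ltW r0)//; lra.
have gv : r ^+ 2 * V ^+ 2 <= v ^+ 2.
  by rewrite -exprMn ler_sqr ?nnegrE ?(ltW v0)// mulr_ge0 ?(ltW r0)//; lra.
have VY4 : 0 < V ^+ 2 * Y ^+ 4 - 1.
  have -> : V ^+ 2 * Y ^+ 4 - 1 = (V * Y ^+ 2 - 1) * (V * Y ^+ 2 + 1) by ring.
  by rewrite mulr_gt0//; lra.
have h2 : q * ((Y ^+ 2 + 1) * (V ^+ 2 * Y ^+ 4 - 1) * V ^+ 2) * 16 <=
    256 / 25 * ((V - 1) ^+ 6 * Y ^+ 3).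
  have r4 : 0 < r ^+ 4 by rewrite exprn_gt0.
  rewrite -(ler_pM2l r4).
  apply: (@le_trans _ _ (q * ((Y ^+ 2 + 1) * (v ^+ 2 * Y ^+ 4 - 1) * v ^+ 2) * 16)).
    rewrite [leLHS]mulrA ler_pM2r// [leLHS]mulrCA ler_wpM2l//.
    have -> : r ^+ 4 * ((Y ^+ 2 + 1) * (V ^+ 2 * Y ^+ 4 - 1) * V ^+ 2) =
      (Y ^+ 2 + 1) * ((r ^+ 2 * (V ^+ 2 * Y ^+ 4 - 1)) * (r ^+ 2 * V ^+ 2)) by ring.
    rewrite -[leRHS]mulrA ler_pM2l; last by lra.
    by apply: ler_pM => //; rewrite mulr_ge0 ?sqr_ge0// ltW.
  apply: (le_trans h1); rewrite -rV exprMn.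
  have -> : 256 / 25 * (r ^+ 6 * (V - 1) ^+ 6 * Y ^+ 3) =
    r ^+ 4 * (r ^+ 2 * (256 / 25 * ((V - 1) ^+ 6 * Y ^+ 3))) by ring.
  rewrite (ler_pM2l r4); apply: ler_piMl; last by rewrite exprn_ile1// ltW.
  by apply: mulr_ge0; [lra|rewrite mulr_ge0// exprn_ge0// ltW].
have Y3 : 0 < Y ^+ 3 by rewrite exprn_gt0.
have poly := decay_polynomial Y133.
pose D := (Y ^+ 2 + 1) * (V ^+ 2 * Y ^+ 4 - 1) * V ^+ 2 * 16.
have D0 : 0 < D by rewrite /D !mulr_gt0 ?exprn_gt0//; lra.
rewrite -(ler_pM2r D0).
apply: (@le_trans _ _ ((3 * Y ^+ 2 + 1) / 2 * (256 / 25 * ((V - 1) ^+ 6 * Y ^+ 3)))).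
  have -> : q * (3 * Y ^+ 2 + 1) / 2 * D = (3 * Y ^+ 2 + 1) / 2 *
    (q * ((Y ^+ 2 + 1) * (V ^+ 2 * Y ^+ 4 - 1) * V ^+ 2) * 16) by rewrite /D; ring.
  by rewrite ler_wpM2l//; lra.
rewrite (_ : (3 * Y ^+ 2 + 1) / 2 * (256 / 25 * ((V - 1) ^+ 6 * Y ^+ 3)) =
  Y ^+ 2 * (128 / 25 * ((5 / 2 * Y - 1) ^+ 6 * (3 * Y ^+ 2 + 1) * Y))); last by rewrite /V; field.
rewrite (_ : 97 / 100 * (Y ^+ 2 - 1) * D =
  Y ^+ 2 * (97 * ((Y ^+ 4 - 1) * (25 / 4 * Y ^+ 6 - 1)))); last by rewrite /D /V; field.
by rewrite ler_wpM2l// sqr_ge0.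
Qed.

End decay_polynomials.

Section decay_numerics.
Context {R : realType}.
Implicit Types m p q x y : R.

Lemma expR_ge_quadratic x : 0 <= x -> 1 + x + x ^+ 2 / 2 <= expR x.
Proof.
have df (y : R) : is_derive y 1 (fun z => expR z - (1 + z)) (expR y - 1).
  by apply: is_derive_eq; rewrite /GRing.scale/=; field.
have df2 (y : R) : is_derive y 1 (fun z => expR z - (1 + z + z ^+ 2 / 2)) (expR y - (1 + y)).
  by apply: is_derive_eq; rewrite /GRing.scale/=; field.
move=> /(is_derive_ge0_le df2); rewrite expR0 expr0n/= mul0r !addr0 subrr subr_ge0.
apply => y y0; have := is_derive_ge0_le df _ y0.
by rewrite expR0 addr0 subrr; apply => z z0; rewrite subr_ge0 -expR0 ler_expR.
Qed.

(* Here x is half the oscillation of l, m its minimum and m + 2 p x its mean. *)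
Lemma decay_numerics q x m p : 0 <= q -> 0 < x -> 0 < m -> 0 <= p <= 1 ->
  tanh m < 5 / 8 * tanh x -> tanh m < 1 / 2 ->
  q * cosh x * sinh (m + 2 * p * x + 2 * x) <= pi ^+ 2 * sinh (m / 2 + p * x) ^+ 6 ->
  q * (1 + tanh x / 2 - 3 / 2 * p * tanh x) <= Num.max q (97 / 100) * tanh x.
Proof.
move=> q0 x0 m0 /andP[p0 p1] mx m2 h.
have T0 := tanh_gt0 x0; have T1 := tanh_lt1 x.
have m58 : m < 5 / 8 * x.
  rewrite ltNge; apply/negP => /le_tanh; apply/negP; rewrite -ltNge.
  by apply: (lt_le_trans mx); apply: tanh_concave; [lra|exact: ltW].
(* The rational lower bound gives tanh (14/25) >= 1/2. *)
have m56 : m < 14 / 25.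
  rewrite ltNge; apply/negP => /le_tanh; apply/negP; rewrite -ltNge.
  by apply: (lt_le_trans m2); have := @tanh_ge_rational R (14 / 25) ltac:(lra); lra.
pose b := m / 2 + p * x; have b0 : 0 < b by rewrite /b ltr_pwDl ?divr_gt0// mulr_ge0// ltW.
have px : p * x <= x by rewrite ler_piMl// ltW.
have px0 : 0 <= p * x by rewrite mulr_ge0// ltW.
have bx : b <= 21 / 16 * x by rewrite /b; lra.
have hb : q * cosh x * sinh (2 * b + 2 * x) <= 256 / 25 * sinh b ^+ 6.
  rewrite (_ : 2 * b + 2 * x = m + 2 * p * x + 2 * x); last by rewrite /b; field.
  apply: (le_trans h); rewrite ler_wpM2r ?exprn_ge0 ?sinh_ge0 ?(ltW b0)//.
  rewrite (_ : 256 / 25 = (16 / 5) ^+ 2); last by field.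
  by rewrite ler_sqr ?nnegrE ?pi_ge0//; exact/ltW/pi_lt_16_5.
have pT : 0 <= p * tanh x by rewrite mulr_ge0// ltW.
have dropp : q * (1 + tanh x / 2 - 3 / 2 * p * tanh x) <= q * (1 + tanh x / 2).
  by rewrite ler_wpM2l//; lra.
have max97 : 97 / 100 * tanh x <= Num.max q (97 / 100) * tanh x.
  by rewrite ler_wpM2r ?(ltW T0)// le_max lexx orbT.
have [x3|x3] := leP x (3 / 10).
  apply: (le_trans dropp); apply: le_trans max97.
  exact: (small_osc_numerics q0 x0 x3 b0 bx hb).
(* Above this line the term in [p] gives the bound; below it 2 b < x + 91/100, hence e^(2b) <= (5/2)
   e^x by [expR_91_lt]. The offset 91/200 is the one for which b <= 21 x / 16 forces x >= 14/25
   above the line. *)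
have [line|line] := leP (x / 2 + 91 / 200) b.
  have x56 : 14 / 25 <= x by lra.
  apply: (@le_trans _ _ (q * tanh x)); last by rewrite ler_wpM2r ?(ltW T0)// le_max lexx.
  rewrite ler_wpM2l//.
  (* With T = tanh x, the goal 1 + T/2 - 3 p T/2 <= T multiplied by [x], since [line] controls the
     product p x. *)
  suff : x <= tanh x * (x / 2 + 3 / 2 * (p * x)).
    move=> hx; rewrite -(ler_pM2r x0); nra.
  (* Up to 3/2 the minimum is bounded by m < 5 x / 8 and tanh by [tanh_ge_rational]; beyond, they
     are bounded by m < 14/25 and [sqr_tanh_ge]. *)
  have [x15|x15] := leP x (3 / 2).
    have := tanh_ge_rational (ltW x0) => hT.
    have k : 25 / 32 * x + 273 / 400 <= x / 2 + 3 / 2 * (p * x) by rewrite /b in line; lra.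
    apply: (@le_trans _ _ (tanh x * (25 / 32 * x + 273 / 400))); last by rewrite ler_pM2l.
    have d : 0 < 3 + x ^+ 2 by rewrite ltr_pwDl// sqr_ge0.
    rewrite -(ler_pM2l d) mulrA; apply: (@le_trans _ _ (3 * x * (25 / 32 * x + 273 / 400))).
      have : 3 + x ^+ 2 <= 3 * (25 / 32 * x + 273 / 400).
        have : 0 <= (x - 14 / 25) * (3 / 2 - x) by rewrite mulr_ge0 ?subr_ge0.
        lra.
      by move=> e; rewrite [leRHS]mulrAC ler_pM2r.
    by rewrite ler_pM2r; [exact: hT|lra].
  have k : 5 / 4 * x + 21 / 80 <= x / 2 + 3 / 2 * (p * x) by rewrite /b in line; lra.
  apply: (@le_trans _ _ (tanh x * (5 / 4 * x + 21 / 80))); last by rewrite ler_pM2l.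
  have k0 : 0 < 5 / 4 * x + 21 / 80 by lra.
  have d : 0 < 1 + x ^+ 2 by rewrite ltr_pwDl// sqr_ge0.
  have Tk := mulr_ge0 (ltW T0) (ltW k0).
  rewrite -ler_sqr ?nnegrE ?(ltW x0)//.
  rewrite -(ler_pM2l d) exprMn [leRHS]mulrA.
  apply: (@le_trans _ _ (x ^+ 2 * (5 / 4 * x + 21 / 80) ^+ 2)).
    by rewrite [leRHS]mulrC ler_wpM2r ?sqr_ge0//; have := sqr_ge0 x; lra.
  by rewrite ler_wpM2r ?sqr_ge0// sqr_tanh_ge// ltW.
apply: (le_trans dropp); apply: le_trans max97.
pose Y := expR x; pose v := expR (2 * b).
have Y133 : 133 / 100 <= Y.
  apply: le_trans (expR_ge_quadratic (ltW x0)).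
  have : 0 <= (x - 3 / 10) * x by rewrite mulr_ge0 ?subr_ge0// ltW.
  lra.
have v1 : 1 < v by rewrite expR_gt1 mulr_gt0.
have vY : v <= 5 / 2 * Y.
  have := @expR_91_lt R => e; apply: (@le_trans _ _ (expR (91 / 100 + x))).
    by rewrite ler_expR; lra.
  by rewrite expRD ler_pM2r ?expR_gt0// ltW.
have Y0 := expR_gt0 x; have vp : 0 < v by lra.
have coshE : cosh x = (Y ^+ 2 + 1) / (2 * Y) by rewrite /cosh expRN -/Y; field; rewrite gt_eqF.
have sinhE : sinh (2 * b + 2 * x) = (v ^+ 2 * Y ^+ 4 - 1) / (2 * v * Y ^+ 2).
  rewrite /sinh expRN expRD -/v (_ : expR (2 * x) = Y ^+ 2); last by rewrite -expRM_natl.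
  by field; rewrite !gt_eqF.
have sinh6 : sinh b ^+ 6 = (v - 1) ^+ 6 / (64 * v ^+ 3).
  rewrite (_ : v = expR b ^+ 2); last by rewrite -expRM_natl.
  by rewrite /sinh expRN; field; rewrite !gt_eqF// expR_gt0.
rewrite coshE sinhE sinh6 in hb.
have := exp_decay_numerics q0 Y133 v1 vY hb.
have -> : tanh x = (Y ^+ 2 - 1) / (Y ^+ 2 + 1).
  by rewrite /tanh coshE /sinh expRN -/Y; field; rewrite ?gt_eqF// ltr_wpDl// sqr_ge0.
have Y21 : 0 < Y ^+ 2 + 1 by rewrite ltr_wpDl// sqr_ge0.
move=> e; rewrite -(ler_pM2r Y21).
rewrite (_ : 97 / 100 * _ * _ = 97 / 100 * (Y ^+ 2 - 1)); last by field; rewrite gt_eqF.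
rewrite (_ : q * _ * _ = q * (3 * Y ^+ 2 + 1) / 2)//.
by field; rewrite gt_eqF.
Qed.

End decay_numerics.

(** * Primitives and convolutions of the kernels *)

Section kernels.
Context {R : realType}.
Notation mu := (@lebesgue_measure R).
Implicit Types b c x y z : R.

Definition conj_poisson y z : R := sin z / (cosh y - cos z).

Lemma cosh_gt1 y : y != 0 -> 1 < cosh y.
Proof.
move=> y0; rewrite lt_neqAle cosh_ge1 andbT eq_sym; apply: contra_neq y0 => c1.
have : sinh y ^+ 2 = 0 by have := cosh2Bsinh2 y; rewrite c1; lra.
move=> /eqP; rewrite sqrf_eq0 => /eqP s0; apply/eqP; move: s0.
have [y0|y0|->//] := ltgtP y 0.
- by have := @sinh_gt0 R (- y); rewrite sinhN oppr_gt0 => /(_ y0); lra.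
- by have := sinh_gt0 y0; lra.
Qed.

Lemma coshBcos_gt0 y z : y != 0 -> 0 < cosh y - cos z.
Proof. by move=> /cosh_gt1 y1; rewrite subr_gt0 (le_lt_trans (cos_le1 z)). Qed.

(** This is b - 2 arg (1 - q e^(ib)) with q = e^(-y). For y > 0 one has 1 - q cos b > 0, so it is
    smooth on the whole line, unlike 2 atan (coth (y/2) tan (b/2)), and it grows by 2 pi over a
    period. *)
Definition poisson_prim y b : R :=
  b + 2 * atan (expR (- y) * sin b / (1 - expR (- y) * cos b)).

Lemma is_derive_poisson_prim y b : 0 < y -> is_derive b 1 (poisson_prim y) (poisson y b).
Proof.
move=> y0; set q := expR (- y); have q1 : q < 1 by rewrite expR_lt1 oppr_lt0.
have q0 : 0 < q := expR_gt0 _.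
have c1 := cos_le1 b; have cN1 := cos_geN1 b.
have D0 : 0 < 1 - q * cos b by rewrite subr_gt0; nra.
have Dn : 1 - q * cos b != 0 by rewrite gt_eqF.
have dD : is_derive b 1 (fun z => 1 - q * cos z) (q * sin b).
  by apply: is_derive_eq; rewrite /GRing.scale/=; ring.
have dV := is_deriveV (f := fun z => 1 - q * cos z) Dn dD.
have dN : is_derive b 1 (fun z => q * sin z / (1 - q * cos z))
    (q * (cos b - q) / (1 - q * cos b) ^+ 2).
  apply: is_derive_eq; rewrite /GRing.scale/=.
  have := cos2Dsin2 b => cs.
  have -> : q * (cos b - q) = q * (cos b - q * (cos b ^+ 2 + sin b ^+ 2)) by rewrite cs mulr1.
  by field.
have dA := @is_derive_compf R atan (fun z => q * sin z / (1 - q * cos z)) b _ _ (is_derive1_atan _) dN.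
rewrite /poisson_prim -/q; apply: is_derive_eq; rewrite /GRing.scale/=.
have cs := cos2Dsin2 b.
have s2 : sin b ^+ 2 = 1 - cos b ^+ 2 by rewrite -cs addrAC subrr add0r.
have E : 0 < 1 + q ^+ 2 - 2 * q * cos b by nra.
have -> : 1 + (q * sin b / (1 - q * cos b)) ^+ 2 =
    (1 + q ^+ 2 - 2 * q * cos b) / (1 - q * cos b) ^+ 2.
  rewrite expr_div_n exprMn s2.
  by field.
have qy : expR y = q^-1 by rewrite /q expRN invrK.
rewrite /poisson /sinh /cosh -/q qy.
have -> : (q^-1 - q) / 2 / ((q^-1 + q) / 2 - cos b) = (1 - q ^+ 2) / (1 + q ^+ 2 - 2 * q * cos b).
  field; rewrite !gt_eqF//=; nra.
by field; rewrite !gt_eqF.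
Qed.

Definition conj_poisson_prim y b : R := ln (cosh y - cos b).

Lemma is_derive_conj_poisson_prim y b : y != 0 ->
  is_derive b 1 (conj_poisson_prim y) (conj_poisson y b).
Proof.
move=> y0; have d0 := coshBcos_gt0 b y0.
have dD : is_derive b 1 (fun z => cosh y - cos z) (sin b).
  by apply: is_derive_eq; rewrite /GRing.scale/=; ring.
have := @is_derive_compf R (@ln R) (fun z => cosh y - cos z) b _ _ (is_derive1_ln d0) dD.
by rewrite mulrC.
Qed.

Lemma continuous_conj_poisson y : y != 0 -> continuous (conj_poisson y).
Proof.
move=> y0 z; apply: cvgM; first exact: continuous_sin.
apply: cvgV; first by rewrite gt_eqF// coshBcos_gt0.
by apply: cvgB; [exact: cvg_cst|exact: continuous_cos].
Qed.

Lemma continuous_poisson y : y != 0 -> continuous (poisson y).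
Proof.
move=> y0 z; apply: cvgM; first exact: cvg_cst.
apply: cvgV; first by rewrite gt_eqF// coshBcos_gt0.
by apply: cvgB; [exact: cvg_cst|exact: continuous_cos].
Qed.

Lemma Rintegral_poisson y : 0 < y -> \int[mu]_(b in `[- pi, pi]) poisson y b = 2 * pi.
Proof.
move=> y0; have pi0 := @pi_ge0 R.
have cp : continuous (poisson y) by apply: continuous_poisson; rewrite gt_eqF.
rewrite (is_derive_FTC2 _ (fun b => is_derive_poisson_prim b y0) cp); last lra.
by rewrite /poisson_prim sinN sinpi oppr0 !mulr0 !mul0r atan0; ring.
Qed.

(* Real part of the addition formula for coth. *)
Lemma conj_poissonM y1 y2 b1 b2 : y1 != 0 -> y2 != 0 ->
  cosh (y1 + y2) - cos (b1 + b2) != 0 ->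
  poisson y1 b1 * poisson y2 b2 - conj_poisson y1 b1 * conj_poisson y2 b2 =
  poisson (y1 + y2) (b1 + b2) * (poisson y1 b1 + poisson y2 b2) -
  conj_poisson (y1 + y2) (b1 + b2) * (conj_poisson y1 b1 + conj_poisson y2 b2) - 1.
Proof.
move=> y10 y20 d3.
have d1 : cosh y1 - cos b1 != 0 by rewrite gt_eqF// coshBcos_gt0.
have d2 : cosh y2 - cos b2 != 0 by rewrite gt_eqF// coshBcos_gt0.
have S1 : sinh y1 ^+ 2 = cosh y1 ^+ 2 - 1 by have := cosh2Bsinh2 y1; lra.
have S2 : sinh y2 ^+ 2 = cosh y2 ^+ 2 - 1 by have := cosh2Bsinh2 y2; lra.
have T1 : sin b1 ^+ 2 = 1 - cos b1 ^+ 2 by have := cos2Dsin2 b1; lra.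
have T2 : sin b2 ^+ 2 = 1 - cos b2 ^+ 2 by have := cos2Dsin2 b2; lra.
rewrite /poisson /conj_poisson sinhD coshD sinD cosD in d3 *.
field: S1 S2 T1 T2.
by rewrite d1 d2 d3.
Qed.

Lemma poissonN y z : poisson (- y) z = - poisson y z.
Proof. by rewrite /poisson sinhN coshN mulNr. Qed.

Lemma conj_poissonN y z : conj_poisson (- y) z = conj_poisson y z.
Proof. by rewrite /conj_poisson coshN. Qed.

(** Writing P and Q for the two kernels, P - i Q = coth ((y + i b) / 2), and coth' = 1 - coth^2. *)
Lemma is_derive_conj_poisson y b : y != 0 ->
  is_derive b 1 (conj_poisson y)
    ((poisson y b ^+ 2 - conj_poisson y b ^+ 2 - 1) / 2).
Proof.
move=> y0; have d0 : cosh y - cos b != 0 by rewrite gt_eqF// coshBcos_gt0.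
have dD : is_derive b 1 (fun z => cosh y - cos z) (sin b).
  by apply: is_derive_eq; rewrite /GRing.scale/=; ring.
have dV := is_deriveV (f := fun z => cosh y - cos z) d0 dD.
rewrite /conj_poisson; apply: is_derive_eq; rewrite /GRing.scale/= /poisson.
have S1 : sinh y ^+ 2 = cosh y ^+ 2 - 1 by have := cosh2Bsinh2 y; lra.
have T1 : sin b ^+ 2 = 1 - cos b ^+ 2 by have := cos2Dsin2 b; lra.
by field: S1 T1.
Qed.

Lemma sin_pi_shift z : sin (z - pi) = sin (z + pi) :> R.
Proof. by rewrite sinB sinD sinpi cospi; ring. Qed.

Lemma cos_pi_shift z : cos (z - pi) = cos (z + pi) :> R.
Proof. by rewrite cosB cosD sinpi cospi; ring. Qed.

Lemma poisson_prim_period y z : poisson_prim y (z + pi) - poisson_prim y (z - pi) = 2 * pi.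
Proof. by rewrite /poisson_prim sin_pi_shift cos_pi_shift; ring. Qed.

Lemma conj_poisson_prim_period y z : conj_poisson_prim y (z + pi) = conj_poisson_prim y (z - pi).
Proof. by rewrite /conj_poisson_prim cos_pi_shift. Qed.

(* Expand the product by the addition formulas for (y1 + y2, x - c) and (y1 - y2, x - c);
   the second one degenerates only when y1 = y2 and cos (x - c) = 1. *)
Lemma Rintegral_conj_poissonM y1 y2 x c : 0 < y1 -> 0 < y2 ->
  \int[mu]_(b in `[x - pi, x + pi]) (conj_poisson y1 (x - b) * conj_poisson y2 (b - c)) =
  - 2 * pi * (poisson (y1 + y2) (x - c) - 1).
Proof.
move=> y10 y20; have pi0 := @pi_ge0 R.
have n1 : y1 != 0 by rewrite gt_eqF.
have n2 : y2 != 0 by rewrite gt_eqF.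
have n12 : y1 + y2 != 0 by rewrite gt_eqF// addr_gt0.
have xx : x - pi <= x + pi by lra.
have cQ : continuous (fun b => conj_poisson y1 (x - b) * conj_poisson y2 (b - c)).
  move=> b; apply: cvgM.
    apply: (@continuous_comp _ _ _ (fun y => x - y)); last exact: continuous_conj_poisson.
    by apply: cvgB; [exact: cvg_cst|exact: cvg_id].
  apply: (@continuous_comp _ _ _ (fun y => y - c)); last exact: continuous_conj_poisson.
  by apply: cvgB; [exact: cvg_id|exact: cvg_cst].
have dP1 (b : R) := is_derive_reflect (is_derive_poisson_prim (x - b) y10).
have dL1 (b : R) := is_derive_reflect (is_derive_conj_poisson_prim (x - b) n1).
have dP2 (b : R) := is_derive_shiftf (is_derive_poisson_prim (b - c) y20).
have dL2 (b : R) := is_derive_shiftf (is_derive_conj_poisson_prim (b - c) n2).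
have [d12|] := boolP (cosh (y1 - y2) - cos (x - c) != 0).
  pose P := poisson (y1 + y2) (x - c); pose Q := conj_poisson (y1 + y2) (x - c).
  pose P' := poisson (y1 - y2) (x - c); pose Q' := conj_poisson (y1 - y2) (x - c).
  (* The sum of the two formulas cancels the product of Poisson kernels and leaves minus twice the
     integrand. Over a period only the primitives of Poisson kernels and 2 b grow, and the
     contributions of P' cancel. *)
  pose G b := - ((P + P') * (- poisson_prim y1 (x - b)) + (P - P') * poisson_prim y2 (b - c) -
    (Q + Q') * (- conj_poisson_prim y1 (x - b) + conj_poisson_prim y2 (b - c)) - 2 * b) / 2.
  have dG (b : R) : is_derive b 1 G (conj_poisson y1 (x - b) * conj_poisson y2 (b - c)).
    have ? := dP1 b; have ? := dL1 b; have ? := dP2 b; have ? := dL2 b.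
    have e1 := @conj_poissonM y1 y2 (x - b) (b - c) n1 n2.
    have e2 := @conj_poissonM y1 (- y2) (x - b) (b - c) n1.
    rewrite addrA subrK -/P -/Q in e1; rewrite addrA subrK oppr_eq0 -/P' -/Q' poissonN conj_poissonN in e2.
    have {}e1 := e1 ltac:(by rewrite gt_eqF// coshBcos_gt0).
    have {}e2 := e2 n2 d12.
    rewrite /G; apply: is_derive_eq; rewrite /GRing.scale/=; lra.
  rewrite (is_derive_FTC2 xx dG cQ) /G.
  have -> : x - (x + pi) = 0 - pi by ring.
  have -> : x - (x - pi) = 0 + pi by ring.
  have -> : x + pi - c = x - c + pi by ring.
  have -> : x - pi - c = x - c - pi by ring.
  have := poisson_prim_period y1 0; have := poisson_prim_period y2 (x - c).
  have := conj_poisson_prim_period y1 0; have := conj_poisson_prim_period y2 (x - c).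
  rewrite -/P; move: (poisson_prim y1 _) (poisson_prim y1 _) (poisson_prim y2 _) (poisson_prim y2 _).
  move: (conj_poisson_prim y1 _) (conj_poisson_prim y1 _) (conj_poisson_prim y2 _) (conj_poisson_prim y2 _).
  move=> l1 l2 l3 l4 p1 p2 p3 p4 -> -> h1 h2.
  have -> : p4 = p3 + 2 * pi by lra.
  have -> : p2 = p1 + 2 * pi by lra.
  by field.
rewrite negbK => /eqP d12.
have c1 : cosh (y1 - y2) = 1.
  by apply/eqP; rewrite eq_le cosh_ge1 andbT; have := cos_le1 (x - c); lra.
have y12 : y1 = y2.
  by apply/eqP; rewrite -subr_eq0; apply: contraT => /cosh_gt1; rewrite c1 ltxx.
have cz : cos (x - c) = 1 by lra.
have sz : sin (x - c) = 0.
  by apply/eqP; rewrite -sqrf_eq0; have := cos2Dsin2 (x - c); rewrite cz; lra.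
rewrite -{y2 y20 n2 n12 cQ dP2 dL2 d12 c1}y12 in n12 cQ dP2 dL2 *.
have S0 : sinh y1 != 0 by rewrite gt_eqF// sinh_gt0.
(* Now the integrand is -Q^2 at b - c. From P^2 + Q^2 = 2 k P - 1 and Q' = (P^2 - Q^2 - 1) / 2 it
   equals Q' + 1 - k P, and k is the value of the kernel for y1 + y1 at cos = 1. *)
pose k := cosh y1 / sinh y1.
pose G b := conj_poisson y1 (b - c) + b - k * poisson_prim y1 (b - c).
have dG (b : R) : is_derive b 1 G (conj_poisson y1 (x - b) * conj_poisson y1 (b - c)).
  have ? := dP2 b; have ? := is_derive_shiftf (is_derive_conj_poisson (b - c) n1).
  have -> : conj_poisson y1 (x - b) = - conj_poisson y1 (b - c).
    have -> : x - b = (x - c) - (b - c) by ring.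
    have sE : sin (x - c - (b - c)) = - sin (b - c) by rewrite [LHS]sinB sz cz; ring.
    have cE : cos (x - c - (b - c)) = cos (b - c) by rewrite [LHS]cosB sz cz; ring.
    by rewrite /conj_poisson sE cE mulNr.
  rewrite /G; apply: is_derive_eq; rewrite /GRing.scale/=.
  rewrite /k /poisson /conj_poisson.
  have d1 : cosh y1 - cos (b - c) != 0 by rewrite gt_eqF// coshBcos_gt0.
  have S1 : sinh y1 ^+ 2 = cosh y1 ^+ 2 - 1 by have := cosh2Bsinh2 y1; lra.
  have T1 : sin (b - c) ^+ 2 = 1 - cos (b - c) ^+ 2 by have := cos2Dsin2 (b - c); lra.
  by field: S1 T1; rewrite d1 S0.
rewrite (is_derive_FTC2 xx dG cQ) /G.
have -> : x + pi - c = x - c + pi by ring.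
have -> : x - pi - c = x - c - pi by ring.
rewrite (_ : conj_poisson y1 (x - c - pi) = conj_poisson y1 (x - c + pi)); last first.
  by rewrite /conj_poisson sin_pi_shift cos_pi_shift.
have -> : poisson (y1 + y1) (x - c) = k.
  rewrite /poisson sinhD coshD cz /k.
  have S1 : cosh y1 * cosh y1 = 1 + sinh y1 ^+ 2 by rewrite -(cosh2Bsinh2 y1); ring.
  rewrite S1; field.
  have -> : 1 + sinh y1 ^+ 2 + sinh y1 * sinh y1 - 1 = 2 * sinh y1 ^+ 2 by ring.
  by rewrite S0 mulf_neq0// expf_neq0.
have := poisson_prim_period y1 (x - c).
move: (poisson_prim y1 _) (poisson_prim y1 _) => p1 p2 h.
have -> : p2 = p1 + 2 * pi by lra.
by ring.
Qed.

End kernels.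

(** * Fourier inversion and Sobolev regularity *)

Section fourier_coefficients.
Context {R : realType}.
Implicit Types (u : R -> R) (s n m N : nat).

Definition cos_coef u n : R := mean (fun x => u x * cos (n%:R * x)).
Definition sin_coef u n : R := mean (fun x => u x * sin (n%:R * x)).

(** All terms of the sum over the integers are nonnegative, so keeping the finitely many frequencies
    0 <= n < N is harmless. This is the only access to [sobolev_norm] that the embeddings use. *)
Lemma fine_sobolev_norm_sum s u N : (sobolev_norm s u < +oo)%E ->
  \sum_(n < N) (1 + n%:R ^+ 2) ^+ s * (cos_coef u n ^+ 2 + sin_coef u n ^+ 2) <=
    fine (sobolev_norm s u) ^+ 2.
Proof.
rewrite /sobolev_norm => fin.
set a := (fun k : int => _) in fin *.
have a0 k : (0 <= a k)%E.
  by rewrite lee_fin mulr_ge0 ?exprn_ge0 ?addr_ge0 ?sqr_ge0.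
have E0 : (0 <= \esum_(k in [set: int]) a k)%E by exact: esum_ge0.
have Efin : (\esum_(k in [set: int]) a k < +oo)%E by apply: lty_poweRy fin; rewrite invr_eq0.
rewrite fine_poweR; set F := fine _.
have F0 : 0 <= F by exact: fine_ge0.
have -> : (F `^ 2^-1) ^+ 2 = F.
  by rewrite -powR_mulrn ?powR_ge0// -powRrM mulVf// powRr1.
rewrite -lee_fin /F fineK; last by rewrite ge0_fin_numE.
apply: esum_ge; exists [set` [seq n%:Z | n <- iota 0 N]].
  by split => //; exact: finite_seq.
rewrite -fsbig_seq; last by rewrite map_inj_uniq ?iota_uniq// => i j [].
have -> : iota 0 N = index_iota 0 N by rewrite /index_iota subn0.
rewrite big_map big_mkord sumEFin lee_fin.
by rewrite le_eqVlt; apply/orP; left; apply/eqP; apply: eq_bigr => n _.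
Qed.

End fourier_coefficients.

Section torus_functions.
Context {R : realType}.
Notation mu := (@lebesgue_measure R).
Implicit Types (u f g : R -> R) (x y b : R).

Lemma periodic_intmul u (T : R) : (forall x, u (x + T) = u x) ->
  forall (k : int) x, u (x + k%:~R * T) = u x.
Proof.
move=> uT; have nat_ n x : u (x + n%:R * T) = u x.
  elim: n x => [|n IH] x; first by rewrite mul0r addr0.
  by rewrite -natr1 mulrDl mul1r addrA uT IH.
case=> n x; first exact: nat_.
by rewrite NegzE mulrNz mulNr -[LHS](nat_ n.+1) addrNK.
Qed.

Lemma torus_representative x : exists k : int, - pi <= x + k%:~R * (pi *+ 2) <= pi.
Proof.
have pi0 := @pi_gt0 R; exists (- Num.floor ((x + pi) / (pi *+ 2))).
set t := (x + pi) / _; have /andP[f1 f2] := floor_itv t.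
have tE : x + pi = t * (pi *+ 2) by rewrite divfK// mulrn_eq0/= gt_eqF.
move: f1 f2 tE; rewrite mulrNz intrD -mulr_natr; set k := (Num.floor t)%:~R.
by move=> f1 f2 tE; apply/andP; split; nra.
Qed.

Lemma periodic_continuous_bounded u : continuous u -> (forall x, u (x + pi *+ 2) = u x) ->
  exists2 B, 0 <= B & forall x, `|u x| <= B.
Proof.
move=> cu pu; have pi0 := @pi_gt0 R.
have pp : (- pi : R) <= pi by lra.
have cn : {within `[- pi, pi], continuous (fun x => `|u x|)}.
  by apply: continuous_subspaceT => x; apply: cvg_norm; exact: cu.
have [c _ hc] := EVT_max pp cn; exists `|u c| => // x.
have [k hk] := torus_representative x.
by rewrite -(periodic_intmul pu k x); apply: hc; rewrite in_itv.
Qed.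

Lemma meanD f g : continuous f -> continuous g ->
  mean (fun x => f x + g x) = mean f + mean g.
Proof.
move=> cf cg; rewrite /mean /torus_int -mulrDr RintegralD//; first exact: measurable_itv.
- exact: integrable_continuous.
- exact: integrable_continuous.
Qed.

Lemma meanZ c f : continuous f -> mean (fun x => c * f x) = c * mean f.
Proof.
move=> cf; rewrite /mean /torus_int RintegralZl; first by rewrite mulrCA.
- exact: measurable_itv.
- exact: integrable_continuous.
Qed.

Lemma mean_cst c : mean (fun=> c) = c :> R.
Proof.
have pi0 := @pi_gt0 R; rewrite /mean /torus_int /torus.
have cc : continuous (fun _ : R => c) by move=> x; exact: cvg_cst.
have dc (x : R) : is_derive x 1 (fun x => c * x) c.
  by apply: is_derive_eq; rewrite /GRing.scale/= mulr1.
have pp : (- pi : R) <= pi by lra.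
rewrite (is_derive_FTC2 pp dc cc); move: (pi : R) pi0 => p p0.
by field; rewrite gt_eqF.
Qed.

Lemma le_mean f g : continuous f -> continuous g ->
  (forall x, - pi <= x <= pi -> f x <= g x) -> mean f <= mean g.
Proof.
move=> cf cg fg; have pi0 := @pi_gt0 R; rewrite /mean /torus_int /torus ler_pM2l; last first.
  by rewrite invr_gt0 mulr_gt0.
apply: le_Rintegral; [exact: measurable_itv|exact: integrable_continuous..|].
by move=> x /=; rewrite in_itv/= => /fg.
Qed.

Lemma ler_norm_mean f g : continuous f -> continuous g ->
  (forall x, - pi <= x <= pi -> `|f x| <= g x) -> `|mean f| <= mean g.
Proof.
move=> cf cg fg; rewrite ler_norml; apply/andP; split.
  rewrite -mulN1r -meanZ//; apply: le_mean => //.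
    by move=> x; apply: cvgM; [exact: cvg_cst|exact: cg].
  by move=> x /fg; rewrite ler_norml mulN1r => /andP[].
by apply: le_mean => // x /fg; rewrite ler_norml => /andP[].
Qed.

Lemma mean_reflect f x : continuous f -> (forall y, f (y + pi *+ 2) = f y) ->
  mean (fun y => f (x - y)) = mean f.
Proof.
move=> cf pf; have pi0 := @pi_gt0 R; congr (_ * _); rewrite /torus_int /torus.
rewrite Rintegral_reflect//; last by lra.
have e1 : x - - pi = x - pi + pi *+ 2 by rewrite -mulr_natr; ring.
have e2 : (pi : R) = - pi + pi *+ 2 by rewrite -mulr_natr; ring.
have T0 : (0 : R) <= pi *+ 2 by rewrite mulrn_wge0// ltW.
by have := @Rintegral_periodic R f (pi *+ 2) (x - pi) (- pi) T0 cf pf; rewrite -e1 -e2.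
Qed.

(** The quartic bound gives b^2 (1/2 - b^2 / 24), and b^2 <= (16/5)^2 leaves slightly more than
    7/100. This constant recurs in all estimates of the singular integrands. *)
Lemma oneBcos_ge b : - pi <= b <= pi -> 7 / 100 * b ^+ 2 <= 1 - cos b.
Proof.
wlog b0 : b / 0 <= b.
  move=> h /andP[b1 b2]; have [b0|b0] := leP 0 b; first by apply: h => //; rewrite b1.
  by rewrite -sqrrN -cosN; apply: h; [rewrite oppr_ge0 ltW|apply/andP; split; lra].
move=> /andP[_ b2]; have := cos_le_quartic b0; have := @pi_lt_16_5 R => p.
have h : b ^+ 2 <= (16 / 5) ^+ 2 by rewrite ler_sqr ?nnegrE; lra.
have -> : b ^+ 4 = b ^+ 2 * b ^+ 2 by ring.
by have := sqr_ge0 b; nra.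
Qed.

End torus_functions.

(** * Abel sums of Fourier series and the Poisson kernel *)

Section poisson_sums.
Context {R : realType}.
Notation mu := (@lebesgue_measure R).
Implicit Types (u : R -> R) (x y z q : R) (n N : nat).

(** Partial sum with Abel weights q^n; [q = 1] gives the ordinary partial sum. *)
Definition fourier_sum q u N x : R := cos_coef u 0 +
  \sum_(n < N) 2 * q ^+ n.+1 *
    (cos_coef u n.+1 * cos (n.+1%:R * x) + sin_coef u n.+1 * sin (n.+1%:R * x)).

Definition poisson_sum q N z : R := 1 + \sum_(n < N) 2 * q ^+ n.+1 * cos (n.+1%:R * z).

(** The factor is |1 - q e^(iz)|^2; multiplying by it makes the cosine sum telescope. *)
Lemma poisson_sumE q N z : (1 + q ^+ 2 - 2 * q * cos z) * poisson_sum q N z =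
  1 - q ^+ 2 - 2 * q ^+ N.+1 * cos (N.+1%:R * z) + 2 * q ^+ N.+2 * cos (N%:R * z).
Proof.
rewrite /poisson_sum; elim: N => [|N IH].
  by rewrite big_ord0 mul0r cos0 mul1r; ring.
rewrite big_ord_recr/= addrA mulrDr IH.
have e1 : cos (N.+2%:R * z) = cos (N.+1%:R * z) * cos z - sin (N.+1%:R * z) * sin z.
  by rewrite -natr1 mulrDl mul1r cosD.
have e2 : cos (N%:R * z) = cos (N.+1%:R * z) * cos z + sin (N.+1%:R * z) * sin z.
  have -> : N%:R * z = N.+1%:R * z - z by rewrite -natr1 mulrDl mul1r addrK.
  by rewrite cosB.
by rewrite e1 e2 !exprS; ring.
Qed.

Lemma poisson_expRN y z q : 0 < y -> q = expR (- y) ->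
  poisson y z = (1 - q ^+ 2) / (1 + q ^+ 2 - 2 * q * cos z).
Proof.
move=> y0 qE; have q0 : 0 < q by rewrite qE expR_gt0.
have q1 : q < 1 by rewrite qE expR_lt1 oppr_lt0.
have := cos_le1 z; have := cos_geN1 z; set c := cos z => c1 c2.
have E : 0 < 1 + q ^+ 2 - 2 * q * c by nra.
rewrite /poisson /sinh /cosh -qE -/c.
have -> : expR y = q^-1 by rewrite qE expRN invrK.
field; rewrite !gt_eqF//=; nra.
Qed.

Lemma poisson_sum_approx y N z q : 0 < y -> q = expR (- y) ->
  `|poisson y z - poisson_sum q N z| <= 4 * q ^+ N.+1 / (1 - q) ^+ 2.
Proof.
move=> y0 qE; have q0 : 0 < q by rewrite qE expR_gt0.
have q1 : q < 1 by rewrite qE expR_lt1 oppr_lt0.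
have D0 : 0 < (1 - q) ^+ 2 by rewrite exprn_gt0// subr_gt0.
have DE : (1 - q) ^+ 2 <= 1 + q ^+ 2 - 2 * q * cos z by have := cos_le1 z; nra.
have E0 := lt_le_trans D0 DE.
rewrite (poisson_expRN z y0 qE).
have -> : poisson_sum q N z = (1 + q ^+ 2 - 2 * q * cos z) * poisson_sum q N z /
    (1 + q ^+ 2 - 2 * q * cos z) by rewrite mulrAC divff ?mul1r// gt_eqF.
rewrite poisson_sumE -mulrBl normrM normfV (gtr0_norm E0).
rewrite ler_pM ?invr_ge0 ?(ltW E0)//; last by rewrite lef_pV2.
rewrite (_ : _ - _ = 2 * q ^+ N.+1 * (cos (N.+1%:R * z) - q * cos (N%:R * z))); last first.
  by rewrite !exprS; ring.
rewrite normrM normrM ger0_norm// [`|q ^+ _|]ger0_norm ?exprn_ge0 ?(ltW q0)//.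
rewrite [leRHS](_ : _ = 2 * q ^+ N.+1 * 2); last by ring.
rewrite ler_wpM2l ?mulr_ge0 ?exprn_ge0 ?(ltW q0)//.
apply: (le_trans (ler_normB _ _)); rewrite normrM (gtr0_norm q0).
have := cos_max (N.+1%:R * z); have := cos_max (N%:R * z).
by have := normr_ge0 (cos (N%:R * z)); nra.
Qed.

Lemma continuous_cosM (a : R) : continuous (fun x => cos (a * x)).
Proof.
move=> x; apply: (@continuous_comp _ _ _ (fun x => a * x)); last exact: continuous_cos.
by apply: cvgM; [exact: cvg_cst|exact: cvg_id].
Qed.

Lemma continuous_sinM (a : R) : continuous (fun x => sin (a * x)).
Proof.
move=> x; apply: (@continuous_comp _ _ _ (fun x => a * x)); last exact: continuous_sin.
by apply: cvgM; [exact: cvg_cst|exact: cvg_id].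
Qed.

Lemma continuous_reflect (f : R -> R) x : continuous f -> continuous (fun y => f (x - y)).
Proof.
move=> cf y; apply: (@continuous_comp _ _ _ (fun y => x - y)); last exact: cf.
by apply: cvgB; [exact: cvg_cst|exact: cvg_id].
Qed.

Lemma continuous_bigsum (F : nat -> R -> R) N : (forall n, continuous (F n)) ->
  continuous (fun x => \sum_(n < N) F n x).
Proof.
move=> cF; elim: N => [|N IH].
  have -> : (fun x => \sum_(n < 0) F n x) = cst 0 by apply/funext => x; rewrite big_ord0.
  by move=> x; exact: cvg_cst.
have -> : (fun x => \sum_(n < N.+1) F n x) = (fun x => \sum_(n < N) F n x + F N x).
  by apply/funext => x; rewrite big_ord_recr.
by move=> x; apply: cvgD; [exact: IH|exact: cF].
Qed.

Lemma mean_poisson_sum u q N x : continuous u ->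
  mean (fun c => u c * poisson_sum q N (x - c)) = fourier_sum q u N x.
Proof.
move=> cu; have cps M : continuous (fun c => u c * poisson_sum q M (x - c)).
  move=> c; apply: cvgM; first exact: cu.
  apply: (@continuous_reflect (poisson_sum q M) x) => z; apply: cvgD; first exact: cvg_cst.
  apply: (@continuous_bigsum (fun n z => 2 * q ^+ n.+1 * cos (n.+1%:R * z))) => n {}z.
  by apply: cvgM; [exact: cvg_cst|exact: continuous_cosM].
rewrite /fourier_sum; elim: N => [|N IH].
  rewrite big_ord0 addr0 /cos_coef; congr mean; apply/funext => c.
  by rewrite /poisson_sum big_ord0 addr0 mul0r cos0.
rewrite big_ord_recr/= addrA -IH.
have cc : continuous (fun c => u c * cos (N.+1%:R * c)).
  by move=> c; apply: cvgM; [exact: cu|exact: continuous_cosM].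
have cs : continuous (fun c => u c * sin (N.+1%:R * c)).
  by move=> c; apply: cvgM; [exact: cu|exact: continuous_sinM].
have cZ (f : R -> R) (k : R) : continuous f -> continuous (fun c => k * f c).
  by move=> cf c; apply: cvgM; [exact: cvg_cst|exact: cf].
have hc := cZ _ (cos (N.+1%:R * x)) cc; have hs := cZ _ (sin (N.+1%:R * x)) cs.
have cD : continuous (fun c => cos (N.+1%:R * x) * (u c * cos (N.+1%:R * c)) +
    sin (N.+1%:R * x) * (u c * sin (N.+1%:R * c))).
  by move=> c; apply: cvgD; [exact: hc|exact: hs].
have hD := cZ _ (2 * q ^+ N.+1) cD.
rewrite [cos_coef _ _ * _]mulrC [sin_coef _ _ * _]mulrC.
rewrite -(meanZ _ cc) -(meanZ _ cs) -(meanD hc hs) -(meanZ _ cD) -(meanD (cps N) hD).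
congr mean; apply/funext => c.
by rewrite /poisson_sum big_ord_recr/= mulrBr cosB; ring.
Qed.

End poisson_sums.

Section fourier_inversion.
Context {R : realType}.
Notation mu := (@lebesgue_measure R).
Implicit Types (u : R -> R) (x y z q eps : R) (n N : nat).

Lemma mean_poisson y : 0 < y -> mean (poisson y) = 1.
Proof.
move=> y0; have pi0 := @pi_gt0 R; rewrite /mean /torus_int /torus Rintegral_poisson//.
by rewrite mulVf// mulf_neq0// gt_eqF.
Qed.

Lemma poisson_approx_identity u x eps : continuous u -> (forall z, u (z + pi *+ 2) = u z) ->
  0 < eps -> \forall y \near 0^'+, `|mean (fun c => u c * poisson y (x - c)) - u x| <= eps.
Proof.
move=> cu pu eps0; have [B B0 hB] := periodic_continuous_bounded cu pu.
have e2 : 0 < eps / 2 by rewrite divr_gt0.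
have /cvgrPdist_le /(_ _ e2) [d /= d0 hd] := cu x.
(* For |b| >= d the kernel is at most sinh y / (7/100 d^2) and [u] varies by at most 2 B; for |b| <
   d the kernel has total mean 1 and [u] varies by at most eps/2. *)
pose K := 2 * B / (7 / 100 * d ^+ 2).
have K0 : 0 <= K.
  by apply: divr_ge0; apply: mulr_ge0; rewrite ?sqr_ge0//; lra.
have key y : 0 < y -> `|mean (fun c => u c * poisson y (x - c)) - u x| <= eps / 2 + K * sinh y.
  move=> y0; have yn : y != 0 by rewrite gt_eqF.
  have cp := continuous_poisson yn.
  have cux := continuous_reflect (x := x) cu.
  have cf : continuous (fun b => u (x - b) * poisson y b).
    by move=> b; apply: cvgM; [exact: cux|exact: cp].
  have pf b : u (x - (b + pi *+ 2)) * poisson y (b + pi *+ 2) = u (x - b) * poisson y b.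
    have -> : u (x - (b + pi *+ 2)) = u (x - b) by rewrite -[LHS]pu; congr u; ring.
    by rewrite /poisson cosD2pi.
  have := mean_reflect x cf pf.
  under eq_fun do rewrite opprB addrC subrK.
  move=> ->.
  have cup : continuous (fun b => u x * poisson y b).
    by move=> b; apply: cvgM; [exact: cvg_cst|exact: cp].
  have -> : u x = mean (fun b => u x * poisson y b) by rewrite meanZ// mean_poisson// mulr1.
  have cN : continuous (fun b => -1 * (u x * poisson y b)).
    by move=> b; apply: cvgM; [exact: cvg_cst|exact: cup].
  rewrite -mulN1r -(meanZ _ cup) -(meanD cf cN).
  have cE : continuous (fun b => eps / 2 * poisson y b).
    by move=> b; apply: cvgM; [exact: cvg_cst|exact: cp].
  have cK : continuous (fun b : R => K * sinh y) by move=> b; exact: cvg_cst.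
  have -> : eps / 2 + K * sinh y = mean (fun b => eps / 2 * poisson y b + K * sinh y).
    by rewrite (meanD cE cK) (meanZ _ cp) mean_poisson// mulr1 mean_cst.
  apply: ler_norm_mean.
  - by move=> b; apply: cvgD; [exact: cf|exact: cN].
  - by move=> b; apply: cvgD; [exact: cE|exact: cK].
  move=> b hb; rewrite mulN1r -mulrBl normrM.
  have P0 := poisson_ge0 b (ltW y0); rewrite (ger0_norm P0).
  have S0 := sinh_gt0 y0.
  have [bd|db] := ltP `|b| d.
    rewrite -[leLHS]addr0; apply: lerD; last by rewrite mulr_ge0// ltW.
    rewrite ler_wpM2r// distrC.
    by apply: hd; rewrite /= opprB addrC subrK.
  rewrite -[leLHS]add0r; apply: lerD; first by rewrite mulr_ge0// ltW.
  have D0 : 0 < 7 / 100 * d ^+ 2 by rewrite mulr_gt0 ?exprn_gt0.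
  have hD : 7 / 100 * d ^+ 2 <= cosh y - cos b.
    apply: (@le_trans _ _ (1 - cos b)); last by rewrite lerB// cosh_ge1.
    apply: le_trans (oneBcos_ge hb); rewrite ler_wpM2l// -(real_normK (num_real b)).
    by rewrite ler_sqr ?nnegrE ?(ltW d0).
  rewrite /K mulrAC -mulrA; apply: ler_pM => //.
    by apply: (le_trans (ler_normB _ _)); rewrite mulr_natl mulr2n lerD.
  rewrite /poisson ler_pM2l// lef_pV2// posrE; exact: lt_le_trans hD.
have K1 : 0 < eps / 2 / (K + 1) by rewrite divr_gt0// ltr_wpDl.
have /cvgrPdist_le /(_ _ K1) [d' /= d'0 hd'] := @continuous_sinh R 0.
exists d' => //= y; rewrite /= sub0r normrN => yd' y0.
apply: (le_trans (key y y0)).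
have := hd' y; rewrite /= sub0r normrN sinh0 sub0r normrN => /(_ yd').
rewrite ger0_norm ?sinh_ge0 ?(ltW y0)// ler_pdivlMr; last by rewrite ltr_wpDl.
have := sinh_gt0 y0; lra.
Qed.

Lemma continuous_poisson_sum q N : continuous (poisson_sum q N).
Proof.
move=> z; apply: cvgD; first exact: cvg_cst.
apply: (@continuous_bigsum R (fun n z => 2 * q ^+ n.+1 * cos (n.+1%:R * z))) => n {}z.
by apply: cvgM; [exact: cvg_cst|exact: continuous_cosM].
Qed.

Lemma norm_fourier_term (a b t : R) : `|a * cos t + b * sin t| <= `|a| + `|b|.
Proof.
apply: (le_trans (ler_normD _ _)); rewrite !normrM.
by apply: lerD; rewrite ler_piMr ?cos_max ?sin_max.
Qed.

(** Three errors of eps/3. First y is chosen: it controls the Poisson mean against u(x), and the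
    removal of the Abel weights, which costs at most 2 K y uniformly in N because 1 - e^(-n y) <= n
    y. Then N is taken large, to replace the kernel by its partial sum. *)
Lemma fourier_inversion u x K : continuous u -> (forall z, u (z + pi *+ 2) = u z) ->
  (forall N, \sum_(n < N) n.+1%:R * (`|cos_coef u n.+1| + `|sin_coef u n.+1|) <= K) ->
  fourier_sum 1 u N x @[N --> \oo] --> u x.
Proof.
move=> cu pu hK; have [B B0 hB] := periodic_continuous_bounded cu pu.
have K0 : 0 <= K by have := hK 0%N; rewrite big_ord0.
apply/cvgrPdist_le => eps eps0; have e3 : 0 < eps / 3 by rewrite divr_gt0.
have [y [y0 hy1 hy2]] : exists y, [/\ 0 < y,
    `|mean (fun c => u c * poisson y (x - c)) - u x| <= eps / 3 & 2 * K * y <= eps / 3].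
  have near1 := poisson_approx_identity x cu pu e3.
  have K21 : 0 < eps / 3 / (2 * K + 1) by rewrite divr_gt0// ltr_wpDl// mulr_ge0.
  have near2 : \forall y \near 0^'+, 2 * K * y <= eps / 3.
    near=> y.
    have : y <= eps / 3 / (2 * K + 1) by near: y; exact: nbhs_right_le.
    rewrite ler_pdivlMr; last by rewrite ltr_wpDl// mulr_ge0.
    have : 0 < y by near: y; exact: nbhs_right_gt.
    by lra.
  have [y [[h1 h2] h3]] : exists y, (`|mean (fun c => u c * poisson y (x - c)) - u x| <= eps / 3 /\
     2 * K * y <= eps / 3) /\ 0 < y.
    near (0 : R)^'+ => y; exists y; split; first split.
    - by near: y.
    - by near: y.
    - by near: y; exact: nbhs_right_gt.
  by exists y.
pose q := expR (- y); have q0 : 0 < q := expR_gt0 _.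
have q1 : q < 1 by rewrite expR_lt1 oppr_lt0.
have yn : y != 0 by rewrite gt_eqF.
have D0 : 0 < (1 - q) ^+ 2 by rewrite exprn_gt0// subr_gt0.
have qN : \forall N \near \oo, B * (4 * q ^+ N.+1 / (1 - q) ^+ 2) <= eps / 3.
  have c4 : 0 < eps / 3 * (1 - q) ^+ 2 / (4 * B + 1).
    by apply: divr_gt0; [exact: mulr_gt0|rewrite ltr_wpDl// mulr_ge0].
  have : q ^+ N @[N --> \oo] --> 0 by apply: cvg_expr; rewrite gtr0_norm.
  move=> /cvgrPdist_le /(_ _ c4); apply: filterS => N.
  rewrite sub0r normrN ger0_norm ?exprn_ge0 ?(ltW q0)// ler_pdivlMr; last by rewrite ltr_wpDl// mulr_ge0.
  move=> h; rewrite mulrA ler_pdivrMr//; apply: le_trans h.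
  rewrite exprS; have qN0 : 0 <= q ^+ N by rewrite exprn_ge0// ltW.
  have : B * (q * q ^+ N) <= B * q ^+ N by rewrite ler_wpM2l// ler_piMl// ltW.
  by lra.
near=> N.
have hN : B * (4 * q ^+ N.+1 / (1 - q) ^+ 2) <= eps / 3 by near: N.
have cp := continuous_reflect (x := x) (continuous_poisson yn).
have h1 : `|mean (fun c => u c * poisson y (x - c)) - fourier_sum q u N x| <= eps / 3.
  apply: le_trans hN; rewrite -mean_poisson_sum//.
  have cps := continuous_reflect (x := x) (@continuous_poisson_sum q N).
  have c1 : continuous (fun c => u c * poisson y (x - c)).
    by move=> c; apply: cvgM; [exact: cu|exact: cp].
  have c2 : continuous (fun c => u c * poisson_sum q N (x - c)).
    by move=> c; apply: cvgM; [exact: cu|exact: cps].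
  have c3 : continuous (fun c => -1 * (u c * poisson_sum q N (x - c))).
    by move=> c; apply: cvgM; [exact: cvg_cst|exact: c2].
  rewrite -mulN1r -(meanZ _ c2) -(meanD c1 c3) -[leRHS]mean_cst.
  apply: ler_norm_mean.
  - by move=> c; apply: cvgD; [exact: c1|exact: c3].
  - by move=> c; exact: cvg_cst.
  move=> c _; rewrite mulN1r -mulrBr normrM; apply: ler_pM => //.
  exact: poisson_sum_approx.
have h2 : `|fourier_sum q u N x - fourier_sum 1 u N x| <= eps / 3.
  apply: le_trans hy2; rewrite /fourier_sum opprD addrACA subrr add0r -sumrB.
  apply: (le_trans (ler_norm_sum _ _ _)).
  apply: (@le_trans _ _ (2 * (\sum_(n < N) n.+1%:R * (`|cos_coef u n.+1| + `|sin_coef u n.+1|)) * y)).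
    rewrite mulr_sumr mulr_suml; apply: ler_sum => n _.
    rewrite -mulrBl expr1n mulr1 -[X in _ - X]mulr1 -mulrBr normrM.
    rewrite [leRHS](_ : _ = 2 * (n.+1%:R * y) * (`|cos_coef u n.+1| + `|sin_coef u n.+1|)); last by ring.
    apply: ler_pM => //; last exact: norm_fourier_term.
    rewrite normrM ger0_norm// ler_wpM2l// distrC ger0_norm; last first.
      by rewrite subr_ge0 exprn_ile1// ltW.
    by rewrite /q -expRM_natl lerBlDl -lerBlDr mulrN; exact: expR_ge1Dx.
  by rewrite ler_wpM2r ?(ltW y0)// ler_wpM2l.
rewrite (_ : u x - _ = - (mean (fun c => u c * poisson y (x - c)) - u x) +
  (mean (fun c => u c * poisson y (x - c)) - fourier_sum q u N x) +
  (fourier_sum q u N x - fourier_sum 1 u N x)); last by ring.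
rewrite (_ : eps = eps / 3 + eps / 3 + eps / 3); last by field.
apply: (le_trans (ler_normD _ _)); rewrite lerD//.
by apply: (le_trans (ler_normD _ _)); rewrite lerD// normrN.
Unshelve. all: by end_near. Qed.

End fourier_inversion.

(** * Regularity and uniform bounds from the decay of the coefficients *)

Section sobolev_embedding.
Context {R : realType}.
Implicit Types (u : R -> R) (x y d h a K : R) (n N M : nat).

Lemma sin_quadratic_ge d : 0 <= d -> d - d ^+ 2 / 2 <= sin d.
Proof.
have df (y : R) : is_derive y 1 (fun z => sin z - (z - z ^+ 2 / 2)) (cos y - (1 - y)).
  by apply: is_derive_eq; rewrite /GRing.scale/=; field.
have d2f (y : R) : is_derive y 1 (fun z => cos z - (1 - z)) (1 - sin y).
  by apply: is_derive_eq; rewrite /GRing.scale/=; ring.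
move=> /(is_derive_ge0_le df); rewrite sin0 expr0n/= mul0r !subr0 subr_ge0; apply => y y0.
have := is_derive_ge0_le d2f _ y0; rewrite cos0 subr0 subrr; apply => z _.
by rewrite subr_ge0 sin_le1.
Qed.

Lemma sin_taylor1 d : `|sin d - d| <= d ^+ 2 / 2.
Proof.
wlog d0 : d / 0 <= d.
  move=> hd; have [d0|d0] := leP 0 d; first exact: hd.
  by rewrite -normrN opprD -sinN -sqrrN hd// oppr_ge0 ltW.
have := sin_quadratic_ge d0; have := sin_le_id d0 => h1 h2.
by rewrite distrC ger0_norm; lra.
Qed.

Lemma cos_taylor1 d : `|cos d - 1| <= d ^+ 2 / 2.
Proof.
wlog d0 : d / 0 <= d.
  move=> hd; have [d0|d0] := leP 0 d; first exact: hd.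
  by rewrite -cosN -sqrrN hd// oppr_ge0 ltW.
have := cos_ge_quadratic d0; have := cos_le1 d => h1 h2.
by rewrite distrC ger0_norm; lra.
Qed.

Lemma cos_taylor a d : `|cos (a + d) - cos a + d * sin a| <= d ^+ 2.
Proof.
rewrite cosD [X in `|X|](_ : _ = cos a * (cos d - 1) - sin a * (sin d - d)); last by ring.
apply: (le_trans (ler_normB _ _)); rewrite !normrM [leRHS](_ : _ = 1 * (d ^+ 2 / 2) + 1 * (d ^+ 2 / 2)); last by field.
by apply: lerD; apply: ler_pM; rewrite ?cos_max ?sin_max ?cos_taylor1 ?sin_taylor1.
Qed.

Lemma sin_taylor a d : `|sin (a + d) - sin a - d * cos a| <= d ^+ 2.
Proof.
rewrite sinD [X in `|X|](_ : _ = sin a * (cos d - 1) + cos a * (sin d - d)); last by ring.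
apply: (le_trans (ler_normD _ _)); rewrite !normrM [leRHS](_ : _ = 1 * (d ^+ 2 / 2) + 1 * (d ^+ 2 / 2)); last by field.
by apply: lerD; apply: ler_pM; rewrite ?cos_max ?sin_max ?cos_taylor1 ?sin_taylor1.
Qed.

Lemma sum_inv_sqr_le N : \sum_(n < N) (n.+1%:R ^+ 2)^-1 <= 2 :> R.
Proof.
case: N => [|N]; first by rewrite big_ord0.
suff h : \sum_(n < N.+1) (n.+1%:R ^+ 2)^-1 <= 2 - N.+1%:R^-1 :> R.
  by apply: (le_trans h); rewrite gerBl invr_ge0.
elim: N => [|N IH]; first by rewrite big_ord1 expr1n invr1; lra.
rewrite big_ord_recr/=; apply: (le_trans (lerD IH (lexx _))).
have p1 : (0 : R) < N.+1%:R by rewrite ltr0n.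
have p2 : (0 : R) < N.+2%:R by rewrite ltr0n.
have e : N.+2%:R = N.+1%:R + 1 :> R by rewrite natr1.
have : (N.+2%:R ^+ 2)^-1 <= N.+1%:R^-1 - N.+2%:R^-1 :> R.
  have -> : N.+1%:R^-1 - N.+2%:R^-1 = (N.+1%:R * N.+2%:R)^-1 :> R.
    by rewrite e; field; rewrite -?e !gt_eqF.
  by rewrite lef_pV2 ?posrE ?mulr_gt0 ?exprn_gt0// expr2 ler_wpM2r ?(ltW p2)// e lerDl.
move=> hinv; apply: (le_trans (lerD (lexx _) hinv)).
by rewrite addrA subrK.
Qed.

(** Each mode has a Taylor remainder of at most (n h)^2, so summability with weight n^2 passes to
    the limit. The quadratic remainder serves as the definition of class C^{1,1} from here on;
    second derivatives are never formed. *)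
Lemma fourier_C11 u K : continuous u -> (forall z, u (z + pi *+ 2) = u z) ->
  (forall N, \sum_(n < N) n.+1%:R ^+ 2 * (`|cos_coef u n.+1| + `|sin_coef u n.+1|) <= K) ->
  exists du : R -> R, forall x h, `|u (x + h) - u x - du x * h| <= 2 * K * h ^+ 2.
Proof.
move=> cu pu hK.
have hK1 N : \sum_(n < N) n.+1%:R * (`|cos_coef u n.+1| + `|sin_coef u n.+1|) <= K.
  apply: le_trans (hK N); apply: ler_sum => n _.
  by rewrite ler_wpM2r ?addr_ge0// expr2 ler_peMl// ler1n.
have inv x := fourier_inversion (x := x) cu pu hK1.
pose t x n : R := 2 * n.+1%:R *
  (sin_coef u n.+1 * cos (n.+1%:R * x) - cos_coef u n.+1 * sin (n.+1%:R * x)).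
have cvgt x : cvgn (series (t x)).
  apply: normed_cvg; apply: nondecreasing_is_cvgn.
    by apply/nondecreasing_seqP => n; rewrite /series/= [leRHS]big_nat_recr//= lerDl.
  exists (2 * K) => _ [N _ <-]; rewrite /normed_series_of /series/= big_mkord.
  apply: (@le_trans _ _ (2 * \sum_(n < N) n.+1%:R * (`|cos_coef u n.+1| + `|sin_coef u n.+1|))); last by rewrite ler_wpM2l.
  rewrite mulr_sumr; apply: ler_sum => n _.
  rewrite /t normrM ger0_norm// -mulrA ler_wpM2l// ler_wpM2l//.
  apply: (le_trans (ler_normB _ _)); rewrite !normrM addrC.
  by apply: lerD; rewrite ler_piMr ?cos_max ?sin_max.
exists (fun x => limn (series (t x))) => x h.
have lim1 : `|fourier_sum 1 u N (x + h) - fourier_sum 1 u N x - series (t x) N * h| @[N --> \oo] -->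
    `|u (x + h) - u x - limn (series (t x)) * h|.
  apply: cvg_norm; apply: cvgB; first by apply: cvgB; exact: inv.
  by apply: cvgM; [exact: cvgt|exact: cvg_cst].
apply: (ler_cvg_to lim1 (cvg_cst _)); apply: nearW => N.
rewrite /fourier_sum /series/= big_mkord opprD addrACA subrr add0r -sumrB mulr_suml -sumrB.
apply: (le_trans (ler_norm_sum _ _ _)).
apply: (@le_trans _ _ (2 * (\sum_(n < N) n.+1%:R ^+ 2 * (`|cos_coef u n.+1| + `|sin_coef u n.+1|)) * h ^+ 2)).
  rewrite mulr_sumr mulr_suml; apply: ler_sum => n _.
  rewrite expr1n mulr1 /t.
  set a := cos_coef _ _; set b := sin_coef _ _; set m : R := n.+1%:R; rewrite (mulrDr m x h).
  rewrite [X in `|X|](_ : _ = 2 * (a * (cos (m * x + m * h) - cos (m * x) + (m * h) * sin (m * x)) +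
    b * (sin (m * x + m * h) - sin (m * x) - (m * h) * cos (m * x)))); last by ring.
  rewrite normrM ger0_norm// [leRHS](_ : _ = 2 * (`|a| * (m * h) ^+ 2 + `|b| * (m * h) ^+ 2)); last by ring.
  rewrite ler_wpM2l//; apply: (le_trans (ler_normD _ _)); rewrite !normrM.
  by apply: lerD; apply: ler_wpM2l => //; [exact: cos_taylor|exact: sin_taylor].
by rewrite ler_wpM2r ?sqr_ge0// ler_wpM2l.
Qed.

Lemma sobolev_coef_le s u n : (sobolev_norm s u < +oo)%E ->
  (1 + n%:R ^+ 2) ^+ s * (cos_coef u n ^+ 2 + sin_coef u n ^+ 2) <=
    fine (sobolev_norm s u) ^+ 2.
Proof.
move=> /fine_sobolev_norm_sum h; apply: le_trans (h n.+1); rewrite big_ord_recr/=.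
by rewrite lerDr sumr_ge0// => i _; rewrite mulr_ge0 ?exprn_ge0 ?addr_ge0 ?sqr_ge0.
Qed.

(** Writing n^2 |c| = (n^3 |c|) (1/n), the inequality of the means bounds it by half of n^6 c^2 +
    n^(-2). The first part is summed by the Sobolev norm, the second by 2. *)
Lemma sobolev3_C11 u : continuous u -> (forall z, u (z + pi *+ 2) = u z) ->
  (sobolev_norm 3 u < +oo)%E ->
  exists (du : R -> R) (K : R), forall x h, `|u (x + h) - u x - du x * h| <= K * h ^+ 2.
Proof.
move=> cu pu fin; pose S := fine (sobolev_norm 3 u).
have hK N : \sum_(n < N) n.+1%:R ^+ 2 * (`|cos_coef u n.+1| + `|sin_coef u n.+1|) <=
    S ^+ 2 + 2.
  apply: (@le_trans _ _ (\sum_(n < N) ((1 + n.+1%:R ^+ 2) ^+ 3 *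
     (cos_coef u n.+1 ^+ 2 + sin_coef u n.+1 ^+ 2) + (n.+1%:R ^+ 2)^-1))).
    apply: ler_sum => n _; set a := cos_coef _ _; set b := sin_coef _ _.
    set m : R := n.+1%:R; have m0 : 0 < m by rewrite ltr0n.
    have mV : m * m^-1 = 1 by rewrite divff// gt_eqF.
    have amgm (c : R) : m ^+ 2 * `|c| <= 1 / 2 * (m ^+ 6 * c ^+ 2 + (m ^+ 2)^-1).
      have [B [mB B2]] : exists B, m * B = 1 /\ B ^+ 2 = (m ^+ 2)^-1.
        by exists m^-1; rewrite exprVn.
      have AB : m ^+ 3 * `|c| * B = m ^+ 2 * `|c|.
        by transitivity (m ^+ 2 * `|c| * (m * B)); [ring|rewrite mB mulr1].
      have A2 : (m ^+ 3 * `|c|) ^+ 2 = m ^+ 6 * c ^+ 2.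
        by rewrite exprMn real_normK ?num_real// -exprM.
      have := sqr_ge0 (m ^+ 3 * `|c| - B); rewrite sqrrB A2 B2 AB => hs.
      by rewrite mulr2n in hs; move: (m ^+ 2 * `|c|) (m ^+ 6 * c ^+ 2) (m ^+ 2)^-1 hs => ? ? ? ?; lra.
    have h6 (c : R) : m ^+ 6 * c ^+ 2 <= (1 + m ^+ 2) ^+ 3 * c ^+ 2.
      rewrite ler_wpM2r ?sqr_ge0// (_ : m ^+ 6 = (m ^+ 2) ^+ 3); last by rewrite -exprM.
      by rewrite ler_pXn2r ?nnegrE ?addr_ge0 ?sqr_ge0// lerDr.
    have := amgm a; have := amgm b; have := h6 a; have := h6 b.
    have := mulr_ge0 (exprn_ge0 6 (ltW m0)) (sqr_ge0 a).
    have := mulr_ge0 (exprn_ge0 6 (ltW m0)) (sqr_ge0 b).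
    rewrite !mulrDr; move: (m ^+ 6) (m ^+ 2)^-1 ((1 + m ^+ 2) ^+ 3) => p q r.
    lra.
  rewrite big_split/=; apply: lerD; last exact: sum_inv_sqr_le.
  apply: le_trans (fine_sobolev_norm_sum N.+1 fin); rewrite big_ord_recl/= lerDr.
  by rewrite mulr_ge0 ?exprn_ge0 ?addr_ge0 ?sqr_ge0.
have [du hdu] := fourier_C11 cu pu hK.
by exists du, (2 * (S ^+ 2 + 2)).
Qed.

(** Every coefficient is at most S / n^3, so the sum of |a_n| + |b_n|, even with weight n, is at
    most 4 S; with the mean and the factor 2 of the Fourier sum this gives 9 = 1 + 2 * 4. Applied to
    differences f(t) - f(t0), it yields continuity in time uniformly in x. *)
Lemma sobolev3_sup u x : continuous u -> (forall z, u (z + pi *+ 2) = u z) ->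
  (sobolev_norm 3 u < +oo)%E -> `|u x| <= 9 * fine (sobolev_norm 3 u).
Proof.
move=> cu pu fin; set S := fine _.
have S0 : 0 <= S by rewrite fine_ge0// poweR_ge0.
have coef n : (1 + n%:R ^+ 2) ^+ 3 * (cos_coef u n ^+ 2 + sin_coef u n ^+ 2) <= S ^+ 2.
  exact: sobolev_coef_le.
have le_of_sqr (c d : R) : 0 <= c -> c ^+ 2 * d ^+ 2 <= S ^+ 2 -> c * `|d| <= S.
  move=> c0; rewrite -exprMn -(real_normK (num_real (c * d))) ler_sqr ?nnegrE//.
  by rewrite normrM ger0_norm.
have hab n : n.+1%:R ^+ 3 * `|cos_coef u n.+1| <= S /\ n.+1%:R ^+ 3 * `|sin_coef u n.+1| <= S.
  have := coef n.+1; set a := cos_coef _ _; set b := sin_coef _ _; set m : R := n.+1%:R => h.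
  have m0 : 0 <= m by rewrite ler0n.
  have h6 : m ^+ 6 * (a ^+ 2 + b ^+ 2) <= S ^+ 2.
    apply: le_trans h; rewrite ler_wpM2r ?addr_ge0 ?sqr_ge0//.
    rewrite (_ : m ^+ 6 = (m ^+ 2) ^+ 3); last by rewrite -exprM.
    by rewrite ler_pXn2r ?nnegrE ?addr_ge0 ?sqr_ge0// lerDr.
  have m60 : 0 <= m ^+ 6 by rewrite exprn_ge0.
  have := mulr_ge0 m60 (sqr_ge0 a); have := mulr_ge0 m60 (sqr_ge0 b) => h1 h2.
  by split; apply: le_of_sqr; rewrite ?exprn_ge0// -exprM; lra.
have m3 n : 1 <= n.+1%:R :> R by rewrite ler1n.
have a0 : `|cos_coef u 0| <= S.
  have := coef 0%N; rewrite expr0n/= addr0 expr1n mul1r => h.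
  rewrite -[leLHS]mul1r; apply: le_of_sqr => //; rewrite expr1n mul1r.
  by apply: le_trans h; rewrite lerDl sqr_ge0.
have hsum N : \sum_(n < N) (`|cos_coef u n.+1| + `|sin_coef u n.+1|) * n.+1%:R <= 4 * S.
  rewrite (_ : 4 * S = 2 * S * 2); last by ring.
  apply: (@le_trans _ _ (2 * S * \sum_(n < N) (n.+1%:R ^+ 2)^-1)).
    rewrite mulr_sumr; apply: ler_sum => n _; have [h1 h2] := hab n.
    rewrite ler_pdivlMr ?exprn_gt0 ?ltr0n// -mulrA -exprS mulrDl.
    by rewrite mulrC [X in _ + X]mulrC; lra.
  by rewrite ler_wpM2l ?mulr_ge0// sum_inv_sqr_le.
have inv : fourier_sum 1 u N x @[N --> \oo] --> u x.
  apply: (@fourier_inversion _ _ _ (4 * S)) => // N.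
  by apply: le_trans (hsum N); apply: ler_sum => n _; rewrite mulrC.
apply: (ler_cvg_to (cvg_norm inv) (cvg_cst _)); apply: nearW => N.
rewrite /fourier_sum; apply: (le_trans (ler_normD _ _)).
rewrite (_ : 9 * S = S + 2 * (4 * S)); last by ring.
apply: lerD => //; apply: (le_trans (ler_norm_sum _ _ _)).
apply: (@le_trans _ _ (2 * \sum_(n < N) (`|cos_coef u n.+1| + `|sin_coef u n.+1|) * n.+1%:R)); last by rewrite ler_wpM2l.
rewrite mulr_sumr; apply: ler_sum => n _; rewrite expr1n mulr1 normrM ger0_norm// ler_wpM2l//.
by apply: (le_trans (norm_fourier_term _ _ _)); rewrite ler_peMr ?addr_ge0.
Qed.

End sobolev_embedding.

(** * The Muskat operator at a critical point *)

Section quadratic_remainder.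
Context {R : realType}.
Implicit Types (u du : R -> R) (x y h K : R).

Lemma quadratic_remainder_is_derive u du K :
  (forall x h, `|u (x + h) - u x - du x * h| <= K * h ^+ 2) ->
  forall x, is_derive x 1 u (du x).
Proof.
move=> hu x; apply/is_derive1_caratheodory.
exists (fun z => if z == x then du x else (u z - u x) / (z - x)); split.
- move=> z; case: eqVneq => [->|zx]; first by rewrite !subrr mulr0.
  by rewrite divfK// subr_eq0.
- apply/cvgrPdist_le => /= eps eps0.
  have K0 : 0 <= K.
    by have := le_trans (normr_ge0 _) (hu 0 1); rewrite expr1n mulr1.
  exists (eps / (K + 1)); first by rewrite /= divr_gt0// ltr_wpDl.
  move=> z /= zxe; rewrite eqxx; case: eqVneq => [_|zx]; first by rewrite subrr normr0 ltW.
  have zx0 : z - x != 0 by rewrite subr_eq0.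
  have := hu x (z - x); rewrite [x + _]addrC subrK => h.
  rewrite -normrN opprB -[X in _ - X](mulfK zx0) -mulrBl normrM normfV.
  have nz : 0 < `|z - x| by rewrite normr_gt0.
  rewrite ler_pdivrMr//; apply: (le_trans h).
  rewrite -(real_normK (num_real (z - x))) expr2 mulrA ler_wpM2r//.
  move: zxe; rewrite distrC ltr_pdivlMr; last by rewrite ltr_wpDl.
  by nra.
- by rewrite eqxx.
Qed.

(** Adding the expansion from [x] to [y] and the one from [y] to [x] cancels the values of [u] and
    leaves (du x - du y) (y - x). *)
Lemma quadratic_remainder_lipschitz u du K :
  (forall x h, `|u (x + h) - u x - du x * h| <= K * h ^+ 2) ->
  forall x y, `|du x - du y| <= 2 * K * `|x - y|.
Proof.
move=> hu x y; have [->|xy] := eqVneq x y; first by rewrite !subrr normr0 mulr0.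
have nz : 0 < `|y - x| by rewrite normr_gt0 subr_eq0 eq_sym.
have h1 := hu x (y - x); have h2 := hu y (x - y).
rewrite [x + _]addrC subrK in h1; rewrite [y + _]addrC subrK in h2.
rewrite (distrC x) -(ler_pM2r nz) -normrM.
rewrite [leRHS](_ : _ = 2 * K * `|y - x| ^+ 2); last by ring.
rewrite real_normK ?num_real//.
rewrite [X in `|X|](_ : _ = - ((u y - u x - du x * (y - x)) + (u x - u y - du y * (x - y)))); last by ring.
rewrite normrN; apply: (le_trans (ler_normD _ _)).
rewrite (_ : 2 * K * (y - x) ^+ 2 = K * (y - x) ^+ 2 + K * (x - y) ^+ 2); last by ring.
exact: lerD.
Qed.

Lemma lipschitz_continuous du K : (forall x y, `|du x - du y| <= K * `|x - y|) -> continuous du.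
Proof.
move=> hd x; apply/cvgrPdist_le => /= eps eps0.
have K0 : 0 <= K by have := le_trans (normr_ge0 _) (hd 1 0); rewrite subr0 normr1 mulr1.
exists (eps / (K + 1)); first by rewrite /= divr_gt0// ltr_wpDl.
move=> z /=; rewrite ltr_pdivlMr; last by rewrite ltr_wpDl.
by move=> h; apply: (le_trans (hd _ _)); have := normr_ge0 (x - z); nra.
Qed.

End quadratic_remainder.

Section arctan_primitive.
Context {R : realType}.
Notation mu := (@lebesgue_measure R).
Implicit Types (b x : R).

(* Integration by parts of the main term at an extremum:
   d/db 2 atan (tanh (th / 2) cot (b / 2)) = (th' sin b - sinh th) / (cosh th - cos b). *)
Lemma is_derive_atan_tanh_cot (th : R -> R) (dth b : R) : sin (b / 2) != 0 ->
  is_derive b 1 th dth ->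
  is_derive b 1 (fun z => 2 * atan (tanh (th z / 2) * (cos (z / 2) / sin (z / 2))))
    ((sin b * dth - sinh (th b)) / (cosh (th b) - cos b)).
Proof.
move=> sb dth_; have db : is_derive b 1 (fun z : R => z / 2) (1 / 2).
  by apply: is_derive_eq; rewrite /GRing.scale/=; field.
have dth2 : is_derive b 1 (fun z => th z / 2) (dth / 2).
  by apply: is_derive_eq; rewrite /GRing.scale/=; field.
have dT := @is_derive_compf R tanh (fun z => th z / 2) b _ _ (is_derive_tanh _) dth2.
have dc := @is_derive_compf R cos (fun z => z / 2) b _ _ (is_derive_cos _) db.
have ds := @is_derive_compf R sin (fun z => z / 2) b _ _ (is_derive_sin _) db.
have dsV := is_deriveV (f := fun z => sin (z / 2)) sb ds.
set w := fun z => tanh (th z / 2) * (cos (z / 2) / sin (z / 2)).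
pose C := cosh (th b / 2); pose S := sinh (th b / 2).
pose al := cos (b / 2); pose be := sin (b / 2).
have C0 : 0 < C := cosh_gt0 _.
have C2 : C ^+ 2 = 1 + S ^+ 2 by have := cosh2Bsinh2 (th b / 2); rewrite -/C -/S; lra.
have al2 : al ^+ 2 = 1 - be ^+ 2 by have := cos2Dsin2 (b / 2); rewrite -/al -/be; lra.
have be2 : 0 < be ^+ 2 by rewrite exprn_even_gt0.
have dw : is_derive b 1 w (dth * al / (2 * C ^+ 2 * be) - S / (2 * C * be ^+ 2)).
  rewrite /w; apply: is_derive_eq; rewrite /GRing.scale/= -/C -/al -/be /tanh -/C -/S.
  have -> : S / (2 * C * be ^+ 2) = S * (al ^+ 2 + be ^+ 2) / (2 * C * be ^+ 2).
    by rewrite al2 subrK mulr1.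
  by field; rewrite sb gt_eqF.
have := @is_derive_compf R atan w b _ _ (is_derive1_atan _) dw => dA.
apply: is_derive_eq; rewrite /GRing.scale/=.
have thE : th b = th b / 2 + th b / 2 by field.
have bE : b = b / 2 + b / 2 by field.
have shE : sinh (th b) = 2 * S * C by rewrite thE sinhD -/C -/S; ring.
have chE : cosh (th b) = C ^+ 2 + S ^+ 2 by rewrite thE coshD -/C -/S; ring.
have sE : sin b = 2 * al * be by rewrite {1}bE sinD -/al -/be; ring.
have cE : cos b = al ^+ 2 - be ^+ 2 by rewrite {1}bE cosD -/al -/be; ring.
rewrite shE chE sE cE /w -/al -/be /tanh -/C -/S.
have D0 : 0 < C ^+ 2 * be ^+ 2 + S ^+ 2 * al ^+ 2.
  by apply: ltr_pwDl; [rewrite mulr_gt0// exprn_gt0|rewrite mulr_ge0 ?sqr_ge0].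
have -> : C ^+ 2 + S ^+ 2 - (al ^+ 2 - be ^+ 2) = 2 * (C ^+ 2 * be ^+ 2 + S ^+ 2 * al ^+ 2).
  by rewrite C2 al2; ring.
have -> : 1 + (S / C * (al / be)) ^+ 2 = (C ^+ 2 * be ^+ 2 + S ^+ 2 * al ^+ 2) / (C ^+ 2 * be ^+ 2).
  by field; rewrite sb gt_eqF.
field; apply/and3P; split; [|exact: sb|by rewrite gt_eqF].
have -> : (C * be) ^+ 2 + (S * al) ^+ 2 = C ^+ 2 * be ^+ 2 + S ^+ 2 * al ^+ 2 by ring.
by rewrite gt_eqF.
Qed.

End arctan_primitive.

Section Rintegral_itv.
Context {R : realType}.
Notation mu := (@lebesgue_measure R).
Implicit Types (a b k : R) (g h : R -> R).

Lemma Rintegral_itvD a b g h : mu.-integrable `[a, b] (EFin \o g) ->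
  mu.-integrable `[a, b] (EFin \o h) ->
  \int[mu]_(x in `[a, b]) (g x + h x) =
  \int[mu]_(x in `[a, b]) g x + \int[mu]_(x in `[a, b]) h x.
Proof. by move=> ig ih; rewrite RintegralD//; exact: measurable_itv. Qed.

Lemma Rintegral_itvZ a b k g : mu.-integrable `[a, b] (EFin \o g) ->
  \int[mu]_(x in `[a, b]) (k * g x) = k * \int[mu]_(x in `[a, b]) g x.
Proof. by move=> ig; rewrite RintegralZl//; exact: measurable_itv. Qed.

End Rintegral_itv.

(** * The first term of the equation *)

Section singular_integral.
Context {R : realType}.
Notation mu := (@lebesgue_measure R).
Implicit Types (b c x y : R).
Variables (u du : R -> R) (K : R).
Hypothesis hu : forall x h, `|u (x + h) - u x - du x * h| <= K * h ^+ 2.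
Hypothesis pu : forall x, u (x + pi *+ 2) = u x.

Let udu x : is_derive x 1 u (du x). Proof. exact: quadratic_remainder_is_derive. Qed.
Let cu : continuous u. Proof. exact: is_derive_continuous udu. Qed.
Let lip x y : `|du x - du y| <= 2 * K * `|x - y|.
Proof. exact: (quadratic_remainder_lipschitz hu). Qed.
Let cdu : continuous du. Proof. exact: lipschitz_continuous lip. Qed.

Lemma quadratic_remainder_ge0 : 0 <= K.
Proof. by have := le_trans (normr_ge0 _) (hu 0 1); rewrite expr1n mulr1. Qed.
Let K0 := quadratic_remainder_ge0.

Lemma oneBcos_le_cosh y b : - pi <= b <= pi -> 7 / 100 * b ^+ 2 <= cosh y - cos b.
Proof. by move=> /oneBcos_ge /le_trans -> //; rewrite lerB// cosh_ge1. Qed.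

Lemma norm_sin_le b : `|sin b| <= `|b|.
Proof.
wlog b0 : b / 0 <= b.
  move=> hb; have [b0|b0] := leP 0 b; first exact: hb.
  by rewrite -normrN -sinN -(normrN b) hb// oppr_ge0 ltW.
rewrite (ger0_norm b0) ler_norml sin_le_id// andbT.
have [b1|b1] := leP b 1; last by have := sin_geN1 b; lra.
by have := sin_quadratic_ge b0; have := sqr_ge0 b; nra.
Qed.

(** The numerator is at most |b| * 2 K |b| and the denominator at least 7/100 b^2, whatever [y] is,
    because cosh y >= 1. At b = 0 the quotient is 0 since sin 0 = 0. *)
Lemma muskat_integrand_bounded x b y : - pi <= b <= pi ->
  `|sin b * (du x - du (x - b)) / (cosh y - cos b)| <= 2 * K / (7 / 100).
Proof.
move=> hb; have [->|b0] := eqVneq b 0.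
  by rewrite sin0 !mul0r normr0 divr_ge0// mulr_ge0.
have b2 : 0 < b ^+ 2 by rewrite exprn_even_gt0.
have D := oneBcos_le_cosh y hb; have D0 : 0 < cosh y - cos b by lra.
rewrite !normrM normfV (gtr0_norm D0) ler_pdivrMr//.
apply: (@le_trans _ _ (`|b| * (2 * K * `|b|))).
  apply: ler_pM => //; first exact: norm_sin_le.
  by apply: (le_trans (lip _ _)); rewrite opprB addrC subrK.
rewrite mulrCA -expr2 real_normK ?num_real// -[leRHS]mulrA ler_wpM2l ?mulr_ge0//.
by rewrite ler_pdivlMl.
Qed.

Lemma norm_atan_le x : `|atan x| <= `|x|.
Proof.
wlog x0 : x / 0 <= x.
  move=> h; have [x0|x0] := leP 0 x; first exact: h.
  by rewrite -normrN -atanN -(normrN x) h// oppr_ge0 ltW.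
have df (y : R) : is_derive y 1 (fun z => z - atan z) (1 - (1 + y ^+ 2)^-1).
  by apply: is_derive_eq.
have a0 : 0 <= atan x by rewrite -(@atan0 R); exact: le_atan.
rewrite !ger0_norm//; have := is_derive_ge0_le df _ x0.
rewrite atan0 subr0 subr_ge0; apply => y y0.
by rewrite subr_ge0 invf_le1 ?lerDl ?sqr_ge0// ltr_pwDl// sqr_ge0.
Qed.

Lemma measurable_quotient (f g : R -> R) : continuous f -> continuous g ->
  measurable_fun [set: R] (fun b => f b / g b).
Proof. by move=> cf cg; apply: measurable_funM_inv; exact: continuous_measurable_fun. Qed.

Lemma continuous_theta x : continuous (fun b => u x - u (x - b)).
Proof. by move=> b; apply: cvgB; [exact: cvg_cst|exact: (continuous_reflect cu)]. Qed.

Lemma continuous_cosh_theta x : continuous (fun b => cosh (u x - u (x - b)) - cos b).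
Proof.
move=> b; apply: cvgB; last exact: continuous_cos.
by apply: (@continuous_comp _ _ _ (fun b => u x - u (x - b)) cosh); [exact: continuous_theta|exact: continuous_cosh].
Qed.

Lemma continuous_sinh_theta x : continuous (fun b => sinh (u x - u (x - b))).
Proof.
by move=> b; apply: (@continuous_comp _ _ _ (fun b => u x - u (x - b)) sinh); [exact: continuous_theta|exact: continuous_sinh].
Qed.

Lemma pv_muskat x :
  pv_int 0 (fun b => sin b * (du x - du (x - b)) / (cosh (u x - u (x - b)) - cos b)) =
  \int[mu]_(b in `[- pi, pi]) (sin b * (du x - du (x - b)) / (cosh (u x - u (x - b)) - cos b)).
Proof.
rewrite (@pv_intE _ _ _ (2 * K / (7 / 100))) ?sub0r ?add0r//.
- apply: measurable_quotient; last exact: continuous_cosh_theta.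
  move=> b; apply: cvgM; first exact: continuous_sin.
  by apply: cvgB; [exact: cvg_cst|exact: (continuous_reflect cdu)].
- by move=> b hb; exact: muskat_integrand_bounded.
Qed.

Section extremum.
Variable x : R.
Hypothesis dux : du x = 0.

Let th b := u x - u (x - b).

Let th_le b : `|th b| <= K * b ^+ 2.
Proof. by have := hu x (- b); rewrite dux mul0r subr0 sqrrN distrC. Qed.

Let dth b : is_derive b 1 th (du (x - b)).
Proof.
have ? := is_derive_reflect (udu (x - b)).
by rewrite /th; apply: is_derive_eq; rewrite add0r mul1r opprK.
Qed.

(** At a critical point the difference [th b] is of order b^2 instead of b, so the numerator sinh
    (th b) compensates the denominator. *)
Lemma poisson_theta_bounded : exists C, forall b, - pi <= b <= pi -> `|poisson (th b) b| <= C.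
Proof.
have [B B0 hB] := periodic_continuous_bounded cu pu.
exists (K * cosh (2 * B) / (7 / 100)) => b hb; have [->|b0] := eqVneq b 0.
  rewrite /th subr0 subrr /poisson sinh0 mul0r normr0 divr_ge0// mulr_ge0//.
  exact/ltW/cosh_gt0.
have b2 : 0 < b ^+ 2 by rewrite exprn_even_gt0.
have D := oneBcos_le_cosh (th b) hb; have D0 : 0 < cosh (th b) - cos b by lra.
rewrite /poisson normrM normfV (gtr0_norm D0) ler_pdivrMr//.
have hs (y : R) : `|sinh y| <= `|y| * cosh y.
  wlog y0 : y / 0 <= y.
    move=> h; have [y0|y0] := leP 0 y; first exact: h.
    by rewrite -normrN -sinhN -(normrN y) -coshN h// oppr_ge0 ltW.
  rewrite !ger0_norm ?sinh_ge0// -ler_pdivrMr ?cosh_gt0//.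
  exact: tanh_le_id.
have hc : cosh (th b) <= cosh (2 * B).
  have -> : cosh (th b) = cosh `|th b| by case: (ger0P (th b)); rewrite ?coshN.
  rewrite le_cosh//; apply: (le_trans (ler_normB _ _)).
  by rewrite mulr_natl mulr2n lerD.
apply: (le_trans (hs _)); apply: (@le_trans _ _ (K * b ^+ 2 * cosh (2 * B))).
  by apply: ler_pM => //; exact/ltW/cosh_gt0.
rewrite [leLHS]mulrAC -[leRHS]mulrA ler_wpM2l//; last by rewrite ler_pdivlMl.
by rewrite mulr_ge0//; exact/ltW/cosh_gt0.
Qed.

Let Phi b := 2 * atan (tanh (th b / 2) * (cos (b / 2) / sin (b / 2))).

Let Phi_pi : Phi pi = 0.
Proof. by rewrite /Phi cos_pihalf mul0r mulr0 atan0 mulr0. Qed.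

Let Phi_Npi : Phi (- pi) = 0.
Proof. by rewrite /Phi mulNr cosN cos_pihalf mul0r mulr0 atan0 mulr0. Qed.

Let Phi0 : Phi 0 = 0.
Proof. by rewrite /Phi mul0r sin0 invr0 !mulr0 atan0 mulr0. Qed.

Let sin_half_neq0 b : - pi <= b <= pi -> b != 0 -> sin (b / 2) != 0.
Proof.
move=> /andP[b1 b2]; rewrite neq_lt => /orP[b0|b0].
  rewrite -oppr_eq0 -sinN gt_eqF// sin_gt0_pi//; have := @pi_gt0 R; lra.
rewrite gt_eqF// sin_gt0_pi//; have := @pi_gt0 R; lra.
Qed.

Let g b := (sin b * du (x - b) - sinh (th b)) / (cosh (th b) - cos b).

Let dPhi b : - pi <= b <= pi -> b != 0 -> is_derive b 1 Phi (g b).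
Proof. by move=> hb b0; apply: is_derive_atan_tanh_cot => //; exact: sin_half_neq0. Qed.

(** The factor cot (z/2) is of order 1/z and tanh (th z / 2) of order z^2, again because du x = 0.
    So the value [Phi 0 = 0], obtained from the convention 0^-1 = 0, is the right one. *)
Let Phi_cvg0 : {for 0, continuous Phi}.
Proof.
apply/cvgrPdist_le => /= eps eps0.
exists (Num.min 1 (eps / (4 * K + 1))) => /=.
  by rewrite lt_min ltr01/= divr_gt0// ltr_wpDl// mulr_ge0.
move=> z /=; rewrite sub0r normrN lt_min => /andP[z1 ze].
have [->|z0] := eqVneq z 0; first by rewrite subrr normr0 ltW.
have zp : 0 < `|z| by rewrite normr_gt0.
have -> : Phi 0 - Phi z = - Phi z by rewrite Phi0 sub0r.
rewrite normrN /Phi normrM ger0_norm//.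
have hs : `|z| / 4 <= `|sin (z / 2)|.
  have -> : `|sin (z / 2)| = `|sin (`|z| / 2)|.
    by case: (ger0P z) => // _; rewrite mulNr sinN normrN.
  rewrite (le_trans _ (ler_norm _))//.
  by have := @sin_quadratic_ge R (`|z| / 2) ltac:(lra); nra.
have ht : `|tanh (th z / 2)| <= K * z ^+ 2 / 2.
  apply: (@le_trans _ _ (`|th z| / 2)); last by rewrite ler_pM2r.
  have [t0|t0] := leP 0 (th z).
    by rewrite !ger0_norm ?tanh_ge0 ?divr_ge0// tanh_le_id// divr_ge0.
  rewrite (ltr0_norm t0) -normrN -tanhN -mulNr.
  have t1 : 0 <= - th z / 2 by rewrite divr_ge0// oppr_ge0 ltW.
  by rewrite ger0_norm ?tanh_ge0// tanh_le_id.
have hw : `|tanh (th z / 2) * (cos (z / 2) / sin (z / 2))| <= 2 * K * `|z|.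
  have sp : 0 < `|sin (z / 2)| by apply: lt_le_trans hs; rewrite divr_gt0.
  rewrite (normrM (tanh _)) (normrM (cos _)) normfV [leLHS]mulrA ler_pdivrMr//.
  apply: (@le_trans _ _ (K * z ^+ 2 / 2 * 1)).
    by apply: ler_pM => //; exact: cos_max.
  apply: (@le_trans _ _ (2 * K * `|z| * (`|z| / 4))).
    by rewrite -(real_normK (num_real z)) le_eqVlt; apply/orP; left; apply/eqP; field.
  by rewrite ler_wpM2l ?mulr_ge0.
apply: (@le_trans _ _ (2 * (2 * K * `|z|))).
  rewrite ler_wpM2l//; apply: le_trans hw; exact: norm_atan_le.
move: ze; rewrite ltr_pdivlMr; last by rewrite ltr_wpDl// mulr_ge0.
by nra.
Qed.

(** The sum of the two integrands is -g with g = Phi' off 0, and Phi vanishes at -pi, 0 and pi. The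
    integral is split at 0, where Phi is merely known to be continuous; hence the use of
    [bounded_is_derive_FTC2]. *)
Lemma muskat_extremum :
  \int[mu]_(b in `[- pi, pi]) (sin b * (du x - du (x - b)) / (cosh (u x - u (x - b)) - cos b)) =
  - \int[mu]_(b in `[- pi, pi]) poisson (u x - u (x - b)) b.
Proof.
have pi0 := @pi_gt0 R; have [C hC] := poisson_theta_bounded.
have mP : measurable_fun [set: R] (fun b => poisson (th b) b).
  by apply: measurable_quotient; [exact: (@continuous_sinh_theta x)|exact: (@continuous_cosh_theta x)].
have mM : measurable_fun [set: R] (fun b => sin b * (du x - du (x - b)) / (cosh (th b) - cos b)).
  apply: measurable_quotient; last exact: (@continuous_cosh_theta x).
  move=> b; apply: cvgM; first exact: continuous_sin.
  by apply: cvgB; [exact: cvg_cst|exact: (continuous_reflect cdu)].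
have bM b : - pi <= b <= pi -> `|sin b * (du x - du (x - b)) / (cosh (th b) - cos b)| <= 2 * K / (7 / 100).
  exact: muskat_integrand_bounded.
have iP := integrable_bounded mP hC.
have iM := integrable_bounded mM bM.
apply/eqP; rewrite -subr_eq0 opprK; apply/eqP.
rewrite -(Rintegral_itvD iM iP).
have cN : continuous (fun b => sin b * du (x - b) - sinh (th b)).
  move=> b; apply: cvgB; last exact: (@continuous_sinh_theta x).
  by apply: cvgM; [exact: continuous_sin|exact: (continuous_reflect cdu)].
have cg b : - pi <= b <= pi -> b != 0 -> {for b, continuous g}.
  move=> hb b0; apply: cvgM; first exact: cN.
  apply: cvgV; last exact: (@continuous_cosh_theta x).
  have b2 : 0 < b ^+ 2 by rewrite exprn_even_gt0.
  apply: lt0r_neq0; apply: lt_le_trans (oneBcos_le_cosh (th b) hb).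
  by rewrite mulr_gt0.
have mg : measurable_fun [set: R] g.
  by apply: measurable_quotient; [exact: cN|exact: (@continuous_cosh_theta x)].
have gE b : g b = - (sin b * (du x - du (x - b)) / (cosh (th b) - cos b) + poisson (th b) b).
  by rewrite /g /poisson dux; move: (_^-1) => V; ring.
have gC b : - pi <= b <= pi -> `|g b| <= C + 2 * K / (7 / 100).
  move=> hb; rewrite gE normrN addrC; apply: (le_trans (ler_normD _ _)).
  by apply: lerD; [exact: hC|exact: bM].
have -> : (fun b => sin b * (du x - du (x - b)) / (cosh (th b) - cos b) + poisson (th b) b) =
    (fun b => (-1) * g b).
  by apply/funext => b; rewrite gE mulN1r opprK.
rewrite (Rintegral_itvZ (-1) (integrable_bounded mg gC)).
have cPhi b : - pi <= b <= pi -> {for b, continuous Phi}.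
  move=> hb; have [->|b0] := eqVneq b 0; first exact: Phi_cvg0.
  by apply/differentiable_continuous/derivable1_diffP; have [] := dPhi hb b0.
have h1 : \int[mu]_(b in `[- pi, 0]) g b = 0.
  transitivity (Phi 0 - Phi (- pi)); last by rewrite Phi0 Phi_Npi subrr.
  apply: (@bounded_is_derive_FTC2 _ (- pi) 0 Phi g (C + 2 * K / (7 / 100))).
  - by rewrite oppr_lt0.
  - apply: continuous_in_subspaceT => b; rewrite inE/= in_itv/= => /andP[b1 b2].
    by apply: cPhi; lra.
  - by move=> b; rewrite in_itv/= => /andP[b1 b2]; apply: dPhi; [lra|rewrite lt_eqF].
  - by move=> b; rewrite in_itv/= => /andP[b1 b2]; apply: cg; [lra|rewrite lt_eqF].
  - exact: mg.
  - by move=> b /andP[b1 b2]; apply: gC; lra.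
have h2 : \int[mu]_(b in `[0, pi]) g b = 0.
  transitivity (Phi pi - Phi 0); last by rewrite Phi0 Phi_pi subrr.
  apply: (@bounded_is_derive_FTC2 _ 0 pi Phi g (C + 2 * K / (7 / 100))).
  - exact: pi0.
  - apply: continuous_in_subspaceT => b; rewrite inE/= in_itv/= => /andP[b1 b2].
    by apply: cPhi; lra.
  - by move=> b; rewrite in_itv/= => /andP[b1 b2]; apply: dPhi; [lra|rewrite gt_eqF].
  - by move=> b; rewrite in_itv/= => /andP[b1 b2]; apply: cg; [lra|rewrite gt_eqF].
  - exact: mg.
  - by move=> b /andP[b1 b2]; apply: gC; lra.
rewrite (@Rintegral_itv_cat _ (- pi) 0 pi) ?oppr_le0 ?(ltW pi0)//; last exact: integrable_bounded mg gC.
by rewrite h1 h2 addr0 mulr0.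
Qed.

End extremum.
End singular_integral.

Section measurable_two_variables.
Context {R : realType}.
Notation mu := (@lebesgue_measure R).
Implicit Types (g : R -> R) (a x : R).

Lemma measurable_fun_comp_fst g : continuous g -> measurable_fun [set: R * R] (fun z => g z.1).
Proof.
by move=> cg; exact: (measurableT_comp (continuous_measurable_fun cg) measurable_fst).
Qed.

Lemma measurable_fun_comp_snd g : continuous g -> measurable_fun [set: R * R] (fun z => g z.2).
Proof.
by move=> cg; exact: (measurableT_comp (continuous_measurable_fun cg) measurable_snd).
Qed.

Lemma measurable_fun_comp_sub g : continuous g ->
  measurable_fun [set: R * R] (fun z => g (z.1 - z.2)).
Proof.
move=> cg; apply: (measurableT_comp (g := fun z : R * R => z.1 - z.2) (continuous_measurable_fun cg)).
by apply: measurable_funB; [exact: measurable_fst|exact: measurable_snd].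
Qed.

Lemma shift_fundamental_domain g a : continuous g -> (forall x, g (x + pi *+ 2) = g x) ->
  \int[mu]_(x in `[a - pi, a + pi]) g x = \int[mu]_(x in `[- pi, pi]) g x.
Proof.
move=> cg pg; have pi0 := @pi_gt0 R; have pp : 0 <= pi *+ 2 :> R by rewrite mulrn_wge0// ltW.
have := Rintegral_periodic (a - pi) (- pi) pp cg pg.
by rewrite (_ : a - pi + _ = a + pi) 1?(_ : - pi + _ = pi) //; rewrite mulr2n; ring.
Qed.

End measurable_two_variables.

(** * The second term: vorticity on the line of the permeability jump *)

Section permeability_jump.
Context {R : realType}.
Notation mu := (@lebesgue_measure R).
Implicit Types (b c x y : R).
Variables (u du : R -> R) (K h2 : R).
Hypothesis hu : forall x h, `|u (x + h) - u x - du x * h| <= K * h ^+ 2.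
Hypothesis pu : forall x, u (x + pi *+ 2) = u x.
Hypothesis h2_gt0 : 0 < h2.
Hypothesis u_ge0 : forall x, 0 <= u x.

Let udu x : is_derive x 1 u (du x). Proof. exact: quadratic_remainder_is_derive. Qed.
Let cu : continuous u. Proof. exact: is_derive_continuous udu. Qed.
Let cdu : continuous du.
Proof. exact: lipschitz_continuous (quadratic_remainder_lipschitz hu). Qed.

Lemma periodic_is_derive : forall x, du (x + pi *+ 2) = du x.
Proof.
move=> x; have h1 := udu x; have h2' := is_derive_shiftf (udu (x + pi *+ 2)).
have E : (fun y => u (y + pi *+ 2)) = u by apply/funext => y; exact: pu.
by rewrite E in h2'; have [_ <-] := h2'; have [_ ->] := h1.
Qed.

Let l x := u x + h2.

Let l_ge x : h2 <= l x. Proof. by rewrite /l lerDr. Qed.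
Let l_gt0 x : 0 < l x. Proof. exact: lt_le_trans (l_ge x). Qed.
Let l_neq0 x : l x != 0. Proof. by rewrite gt_eqF. Qed.
Let cl : continuous l. Proof. by move=> x; apply: cvgD; [exact: cu|exact: cvg_cst]. Qed.
Let dl x : is_derive x 1 l (du x).
Proof. by have ? := udu x; apply: is_derive_eq; rewrite addr0. Qed.

(** Common lower bound of all denominators in this part: the graph stays at height at least h2 above
    the jump, so these kernels are not singular. *)
Let E0 := cosh h2 - 1.
Let E0_gt0 : 0 < E0. Proof. by rewrite subr_gt0 cosh_gt1// gt_eqF. Qed.
Let E0_le x z : E0 <= cosh (l x) - cos z.
Proof. by rewrite lerB ?cos_le1// le_cosh// ltW. Qed.

Lemma norm_conj_poisson_le x z : `|conj_poisson (l x) z| <= E0^-1.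
Proof.
have D0 := coshBcos_gt0 z (l_neq0 x).
rewrite /conj_poisson normrM normfV (gtr0_norm D0) -[leRHS]mul1r.
by apply: ler_pM => //; [rewrite invr_ge0 ltW|exact: sin_max|rewrite lef_pV2].
Qed.

Let ccosh_l : continuous (fun x => cosh (l x)).
Proof. by move=> x; apply: (@continuous_comp _ _ _ l cosh); [exact: cl|exact: continuous_cosh]. Qed.

Let csinh_l : continuous (fun x => sinh (l x)).
Proof. by move=> x; apply: (@continuous_comp _ _ _ l sinh); [exact: cl|exact: continuous_sinh]. Qed.

Lemma continuous_conj_poisson_graph b : continuous (fun c => conj_poisson (l c) (b - c)).
Proof.
move=> c; apply: cvgM; first by apply: (continuous_reflect (f := sin)) => ?; exact: continuous_sin.
apply: cvgV; first by rewrite gt_eqF// coshBcos_gt0.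
by apply: cvgB; [exact: ccosh_l|apply: (continuous_reflect (f := cos)) => ?; exact: continuous_cos].
Qed.

(** The chain rule along the graph has two parts: the integrand of [varpi2], which contains [du],
    and minus the conjugate kernel. *)
Lemma is_derive_ln_graph b c :
  is_derive c 1 (fun c => ln (cosh (l c) - cos (b - c)))
    (sinh (l c) * du c / (cosh (l c) - cos (b - c)) - conj_poisson (l c) (b - c)).
Proof.
have D0 := coshBcos_gt0 (b - c) (l_neq0 c).
have dch := @is_derive_compf R cosh l c _ _ (is_derive_cosh _) (dl c).
have dc : is_derive c 1 (fun c => cos (b - c)) (sin (b - c)).
  have := is_derive_reflect (g := cos) (is_derive_cos (b - c)).
  by rewrite opprK.
have dD : is_derive c 1 (fun c => cosh (l c) - cos (b - c)) (sinh (l c) * du c - sin (b - c)).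
  by apply: is_derive_eq.
have dL := @is_derive_compf R (@ln R) (fun c => cosh (l c) - cos (b - c)) c _ _ (is_derive1_ln D0) dD.
apply: is_derive_eq; rewrite /conj_poisson; move: (_^-1) => V; ring.
Qed.

Let V b := \int[mu]_(c in `[- pi, pi]) conj_poisson (l c) (b - c).

Let cos2pi x : cos (x + pi *+ 2) = cos x :> R. Proof. exact: cosD2pi. Qed.
Let cosB2pi b c : cos (b - (c + pi *+ 2)) = cos (b - c) :> R.
Proof. by rewrite -[RHS]cosN -cos2pi -[LHS]cosN; congr cos; ring. Qed.
Let sinB2pi b c : sin (b - (c + pi *+ 2)) = sin (b - c) :> R.
Proof. by rewrite -[RHS]opprK -sinN -[LHS]opprK -sinN -[in RHS]sinD2pi; congr (- sin _); ring. Qed.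
Let lp x : l (x + pi *+ 2) = l x. Proof. by rewrite /l pu. Qed.

(** The exact derivative of [is_derive_ln_graph] integrates to zero over a period, which trades the
    integrand containing [du] for the conjugate kernel. *)
Lemma varpi2E kp km rp rm b :
  varpi2 kp km rp rm h2 u b = amplitude kp km rp rm * V b.
Proof.
rewrite /varpi2; congr (_ * _).
have -> : derive1 u = du by apply/funext => x; rewrite derive1E; have [_ ->] := udu x.
have -> : (fun c => sinh (h2 + u c) * du c / (cosh (h2 + u c) - cos (b - c))) =
  (fun c => sinh (l c) * du c / (cosh (l c) - cos (b - c))).
  by apply/funext => c; rewrite /l addrC.
pose G c := sinh (l c) * du c / (cosh (l c) - cos (b - c)); rewrite -/G.
have cG : continuous G.
  move=> c; apply: cvgM; first by apply: cvgM; [exact: csinh_l|exact: cdu].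
  apply: cvgV; first by rewrite gt_eqF// coshBcos_gt0.
  by apply: cvgB; [exact: ccosh_l|apply: (continuous_reflect (f := cos)) => ?; exact: continuous_cos].
have pG c : G (c + pi *+ 2) = G c by rewrite /G lp periodic_is_derive cosB2pi.
have [B B0 hB] := periodic_continuous_bounded cG pG.
rewrite (@pv_intE _ _ _ B); last 2 first.
- exact: continuous_measurable_fun.
- by move=> c _; exact: hB.
have cQ := @continuous_conj_poisson_graph b.
rewrite -[RHS](@shift_fundamental_domain _ _ b); last 2 first.
- exact: cQ.
- by move=> c; rewrite /conj_poisson lp cosB2pi sinB2pi.
have pi0 := @pi_gt0 R; have bb : b - pi <= b + pi by lra.
have cGQ : continuous (fun c => G c - conj_poisson (l c) (b - c)).
  by move=> c; apply: cvgB; [exact: cG|exact: cQ].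
have I0 := is_derive_FTC2 bb (is_derive_ln_graph b) cGQ.
have : \int[mu]_(c in `[b - pi, b + pi]) (G c - conj_poisson (l c) (b - c)) = 0.
  rewrite I0 (_ : b + pi = b - pi + pi *+ 2); last by rewrite mulr2n; ring.
  by rewrite lp cosB2pi subrr.
have -> : (fun c => G c - conj_poisson (l c) (b - c)) =
  (fun c => G c + (-1) * conj_poisson (l c) (b - c)).
  by apply/funext => c; rewrite mulN1r.
rewrite Rintegral_itvD ?Rintegral_itvZ; last 3 first.
- exact: integrable_continuous.
- exact: integrable_continuous.
- by apply: integrable_continuous => c; apply: cvgM; [exact: cvg_cst|exact: cQ].
by rewrite mulN1r => /eqP; rewrite subr_eq0 => /eqP.
Qed.

Let cQ_arg y : y != 0 -> continuous (conj_poisson y).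
Proof. exact: continuous_conj_poisson. Qed.

Let cV : continuous V.
Proof.
move=> b; have pi0 := @pi_gt0 R.
have H := @continuity_under_integral R _ _ mu (fun b c => conj_poisson (l c) (b - c))
  `[- pi, pi] (measurable_itv _) (b - 1) (b + 1) _ _ (fun=> E0^-1) _ _.
apply: H => //.
- by move=> x _; apply: integrable_continuous; exact: continuous_conj_poisson_graph.
- apply/aeW => c _ x _.
  apply: (@continuous_comp _ _ _ (fun x => x - c) (conj_poisson (l c))).
    by apply: cvgB; [exact: cvg_id|exact: cvg_cst].
  exact: cQ_arg.
- by apply: (@integrable_continuous R _ _ (fun=> E0^-1)) => c; exact: cvg_cst.
- by move=> x _; apply/aeW => c _; exact: norm_conj_poisson_le.
- by rewrite inE/= in_itv/=; apply/andP; split; lra.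
Qed.

Let pV b : V (b + pi *+ 2) = V b.
Proof.
apply: eq_Rintegral => c _; rewrite /conj_poisson.
by rewrite (_ : b + pi *+ 2 - c = b - c + pi *+ 2) ?sinD2pi ?cosD2pi//; ring.
Qed.

Let L x b := (du x * sinh (l x) + sin (x - b)) / (cosh (l x) - cos (x - b)).

Let cL x : continuous (L x).
Proof.
move=> b; apply: cvgM.
  apply: cvgD; first exact: cvg_cst.
  by apply: (continuous_reflect (f := sin)) => ?; exact: continuous_sin.
apply: cvgV; first by rewrite gt_eqF// coshBcos_gt0.
apply: cvgB; first exact: cvg_cst.
by apply: (continuous_reflect (f := cos)) => ?; exact: continuous_cos.
Qed.

Let pv_varpi2E kp km rp rm x :
  pv_int x (fun b => (du x * sinh (u x + h2) + sin (x - b)) * varpi2 kp km rp rm h2 u b /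
    (cosh (u x + h2) - cos (x - b))) =
  amplitude kp km rp rm * \int[mu]_(b in `[x - pi, x + pi]) (L x b * V b).
Proof.
have -> : (fun b => (du x * sinh (u x + h2) + sin (x - b)) * varpi2 kp km rp rm h2 u b /
    (cosh (u x + h2) - cos (x - b))) = (fun b => amplitude kp km rp rm * (L x b * V b)).
  by apply/funext => b; rewrite varpi2E /L; move: (_^-1) => W; ring.
have cLV : continuous (fun b => L x b * V b) by move=> b; apply: cvgM; [exact: cL|exact: cV].
have pLV b : L x (b + pi *+ 2) * V (b + pi *+ 2) = L x b * V b.
  by rewrite pV /L cosB2pi sinB2pi.
have [B B0 hB] := periodic_continuous_bounded cLV pLV.
rewrite (@pv_intE _ _ _ (`|amplitude kp km rp rm| * B)); last 2 first.
- by apply: continuous_measurable_fun => b; apply: cvgM; [exact: cvg_cst|exact: cLV].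
- by move=> b _; rewrite normrM ler_wpM2l.
by rewrite Rintegral_itvZ//; exact: integrable_continuous.
Qed.

Lemma pv_varpi2_shift kp km rp rm x :
  pv_int x (fun b => (du x * sinh (u x + h2) + sin (x - b)) * varpi2 kp km rp rm h2 u b /
    (cosh (u x + h2) - cos (x - b))) =
  amplitude kp km rp rm * \int[mu]_(b in `[- pi, pi]) (L x b * V b).
Proof.
rewrite pv_varpi2E; congr (_ * _); apply: (@shift_fundamental_domain _ (fun b => L x b * V b)).
- by move=> b; apply: cvgM; [exact: cL|exact: cV].
- by move=> b; rewrite pV /L cosB2pi sinB2pi.
Qed.

Let measurable_conj_poisson_product x :
  measurable_fun [set: R * R] (fun z => conj_poisson (l x) (x - z.1) * conj_poisson (l z.2) (z.1 - z.2)).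
Proof.
apply: measurable_funM.
  apply: (@measurable_fun_comp_fst _ (fun b => conj_poisson (l x) (x - b))).
  by apply: continuous_reflect; exact: cQ_arg.
apply: measurable_funM_inv.
  by apply: (@measurable_fun_comp_sub _ sin) => ?; exact: continuous_sin.
apply: measurable_funB.
  exact: (@measurable_fun_comp_snd _ (fun c => cosh (l c))).
by apply: (@measurable_fun_comp_sub _ cos) => ?; exact: continuous_cos.
Qed.

(** At a critical point the outer kernel is also a conjugate kernel, with parameter l x. After
    exchanging the integrals, [Rintegral_conj_poissonM] evaluates the one in b for each c, and c = x
    - b recentres the result. *)
Lemma pv_varpi2_extremum kp km rp rm x : du x = 0 ->
  pv_int x (fun b => (du x * sinh (u x + h2) + sin (x - b)) * varpi2 kp km rp rm h2 u b /
    (cosh (u x + h2) - cos (x - b))) =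
  - 2 * pi * amplitude kp km rp rm *
  \int[mu]_(b in `[- pi, pi]) (poisson (l x + l (x - b)) b - 1).
Proof.
move=> dux; rewrite pv_varpi2E; have pi0 := @pi_gt0 R.
rewrite [- 2 * pi * _]mulrC -[RHS]mulrA; congr (_ * _).
transitivity (\int[mu]_(b in `[x - pi, x + pi]) (\int[mu]_(c in `[- pi, pi])
    (conj_poisson (l x) (x - b) * conj_poisson (l c) (b - c)))).
  apply: eq_Rintegral => b _; rewrite Rintegral_itvZ; last first.
    by apply: integrable_continuous; exact: continuous_conj_poisson_graph.
  by congr (_ * _); rewrite /L dux mul0r add0r.
rewrite (@Rintegral_Fubini_bounded _ (fun z => conj_poisson (l x) (x - z.1) * conj_poisson (l z.2) (z.1 - z.2))
   _ _ _ _ (E0^-1 * E0^-1) (@measurable_conj_poisson_product x)); last first.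
  by move=> b c _ _; rewrite normrM; apply: ler_pM => //; exact: norm_conj_poisson_le.
have cPg : continuous (fun c => poisson (l x + l c) (x - c) - 1).
  have llx c : l x + l c != 0 by rewrite gt_eqF// addr_gt0.
  have cll : continuous (fun c => l x + l c).
    by move=> c; apply: cvgD; [exact: cvg_cst|exact: cl].
  move=> c; apply: cvgB; last exact: cvg_cst.
  apply: cvgM.
    by apply: (@continuous_comp _ _ _ (fun c => l x + l c) sinh); [exact: cll|exact: continuous_sinh].
  apply: cvgV; first by rewrite gt_eqF// coshBcos_gt0.
  apply: cvgB.
    by apply: (@continuous_comp _ _ _ (fun c => l x + l c) cosh); [exact: cll|exact: continuous_cosh].
  by apply: (continuous_reflect (f := cos)) => ?; exact: continuous_cos.
transitivity (\int[mu]_(c in `[- pi, pi]) ((- 2 * pi) * (poisson (l x + l c) (x - c) - 1))).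
  apply: eq_Rintegral => c _ /=; exact: (@Rintegral_conj_poissonM R (l x) (l c) x c (l_gt0 x) (l_gt0 c)).
rewrite Rintegral_itvZ; last exact: integrable_continuous.
congr (_ * _); rewrite -(@shift_fundamental_domain _ _ x cPg); last first.
  by move=> c; rewrite lp /poisson cosB2pi.
have pp : - pi <= pi :> R by lra.
have := @Rintegral_reflect R (- pi) pi x _ pp cPg; rewrite opprK => <-.
by apply: eq_Rintegral => c _; rewrite subKr.
Qed.

Let dL x b : is_derive x 1 (fun x => ln (cosh (l x) - cos (b - x))) (L x b).
Proof.
apply: is_derive_eq (is_derive_ln_graph b x) _.
by rewrite /L /conj_poisson -(opprB x b) cosN sinN; move: (_^-1) => W; ring.
Qed.

(** For fixed b the kernel [L] is the x-derivative of a periodic logarithm, so integrating in x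
    first gives zero. Integrability is part of the conclusion because [Rintegral_muskat_rhs] splits
    the integral of a sum. *)
Lemma Rintegral_pv_varpi2 kp km rp rm (S := fun x => pv_int x (fun b =>
    (du x * sinh (u x + h2) + sin (x - b)) * varpi2 kp km rp rm h2 u b /
    (cosh (u x + h2) - cos (x - b)))) :
  mu.-integrable `[- pi, pi] (EFin \o S) /\ \int[mu]_(x in `[- pi, pi]) S x = 0.
Proof.
have pi0 := @pi_gt0 R; have pp : - pi <= pi :> R by lra.
have -> : S = (fun x => amplitude kp km rp rm * \int[mu]_(b in `[- pi, pi]) (L x b * V b)).
  by apply/funext => x; exact: pv_varpi2_shift.
have cdS : continuous (fun x => du x * sinh (l x)).
  by move=> x; apply: cvgM; [exact: cdu|exact: csinh_l].
have [B B0 hB] := periodic_continuous_bounded cdS (fun x =>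
  ltac:(rewrite lp periodic_is_derive; reflexivity) : du (x + pi *+ 2) * sinh (l (x + pi *+ 2)) = du x * sinh (l x)).
have [B' B'0 hB'] := periodic_continuous_bounded cV pV.
have mL : measurable_fun [set: R * R] (fun z => L z.1 z.2 * V z.2).
  apply: measurable_funM; last exact: measurable_fun_comp_snd.
  apply: measurable_funM_inv.
    apply: measurable_funD.
      exact: (@measurable_fun_comp_fst _ (fun x => du x * sinh (l x))).
    by apply: (@measurable_fun_comp_sub _ sin) => ?; exact: continuous_sin.
  apply: measurable_funB.
    exact: (@measurable_fun_comp_fst _ (fun c => cosh (l c))).
  by apply: (@measurable_fun_comp_sub _ cos) => ?; exact: continuous_cos.
have bL x b : `|L x b * V b| <= (B + 1) * E0^-1 * B'.
  rewrite normrM; apply: ler_pM => //.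
  have D0 := coshBcos_gt0 (x - b) (l_neq0 x).
  rewrite /L normrM normfV (gtr0_norm D0); apply: ler_pM => //; first by rewrite invr_ge0 ltW.
    by apply: (le_trans (ler_normD _ _)); apply: lerD => //; exact: sin_max.
  by rewrite lef_pV2.
have cLx b : continuous (L^~ b).
  move=> x; apply: cvgM.
    apply: cvgD; first exact: cdS.
    apply: (@continuous_comp _ _ _ (fun x => x - b) sin); last exact: continuous_sin.
    by apply: cvgB; [exact: cvg_id|exact: cvg_cst].
  apply: cvgV; first by rewrite gt_eqF// coshBcos_gt0.
  apply: cvgB; first exact: ccosh_l.
  apply: (@continuous_comp _ _ _ (fun x => x - b) cos); last exact: continuous_cos.
  by apply: cvgB; [exact: cvg_id|exact: cvg_cst].
have mLx : measurable_fun [set: R] (fun x => \int[mu]_(b in `[- pi, pi]) (L x b * V b)).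
  exact: (measurable_fun_Rintegral (G := fun z => L z.1 z.2 * V z.2)).
have cLV x : continuous (fun b => L x b * V b) by move=> b; apply: cvgM; [exact: cL|exact: cV].
have iL : mu.-integrable `[- pi, pi] (EFin \o (fun x => \int[mu]_(b in `[- pi, pi]) (L x b * V b))).
  apply: (@integrable_bounded R (- pi) pi _ ((B + 1) * E0^-1 * B' * (pi - - pi)) mLx) => x _.
  apply: le_normr_Rintegral_bounded => //; exact: continuous_measurable_fun.
split.
  have := @integrableZl _ _ R mu _ (measurable_itv _) (amplitude kp km rp rm) _ iL.
  by apply: eq_integrable => // x _; rewrite /= EFinM.
rewrite (Rintegral_itvZ _ iL).
rewrite (@Rintegral_Fubini_bounded _ (fun z => L z.1 z.2 * V z.2) _ _ _ _ _ mL (fun x b _ _ => bL x b))/=.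
rewrite (_ : \int[mu]_(y in _) _ = 0) ?mulr0//.
(* The product form lets [Rintegral_itvZ] pull out the factor zero. *)
transitivity (\int[mu]_(b in `[- pi, pi]) (0 * 0 : R)).
  apply: eq_Rintegral => b _; under eq_Rintegral do rewrite mulrC.
  rewrite Rintegral_itvZ; last exact: integrable_continuous.
  rewrite (is_derive_FTC2 pp (fun x => dL x b) (cLx b)) mul0r.
  suff -> : cosh (l pi) - cos (b - pi) = cosh (l (- pi)) - cos (b - - pi) by rewrite subrr mulr0.
  have pE : pi = - pi + pi *+ 2 :> R by rewrite mulr2n; ring.
  by rewrite {1 2}pE lp cosB2pi.
by rewrite Rintegral_itvZ ?mul0r//; apply: (@integrable_continuous R _ _ (fun=> 0)) => c; exact: cvg_cst.
Qed.

End permeability_jump.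

(** The expression of [is_derive_atan_tanh_cot], now with b frozen and differentiated in x: the main
    integrand is an x-derivative for each b with sin (b/2) != 0. *)
Lemma is_derive_atan_tanh (R : realType) (th : R -> R) (dth b x : R) : sin (b / 2) != 0 ->
  is_derive x 1 th dth ->
  is_derive x 1 (fun z => 2 * atan (tanh (th z / 2) * (cos (b / 2) / sin (b / 2))))
    (sin b * dth / (cosh (th x) - cos b)).
Proof.
move=> sb dth_.
have dth2 : is_derive x 1 (fun z => th z / 2) (dth / 2).
  by apply: is_derive_eq; rewrite /GRing.scale/=; field.
have dT := @is_derive_compf R tanh (fun z => th z / 2) x _ _ (is_derive_tanh _) dth2.
set w := fun z => tanh (th z / 2) * (cos (b / 2) / sin (b / 2)).
pose C := cosh (th x / 2); pose S := sinh (th x / 2).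
pose al := cos (b / 2); pose be := sin (b / 2).
have C0 : 0 < C := cosh_gt0 _.
have C2 : C ^+ 2 = 1 + S ^+ 2 by have := cosh2Bsinh2 (th x / 2); rewrite -/C -/S; lra.
have al2 : al ^+ 2 = 1 - be ^+ 2 by have := cos2Dsin2 (b / 2); rewrite -/al -/be; lra.
have be2 : 0 < be ^+ 2 by rewrite exprn_even_gt0.
have dw : is_derive x 1 w (dth * al / (2 * C ^+ 2 * be)).
  rewrite /w; apply: is_derive_eq; rewrite /GRing.scale/= -/C -/al -/be /tanh -/C -/S.
  by field; rewrite sb gt_eqF.
have := @is_derive_compf R atan w x _ _ (is_derive1_atan _) dw => dA.
apply: is_derive_eq; rewrite /GRing.scale/=.
have thE : th x = th x / 2 + th x / 2 by field.
have bE : b = b / 2 + b / 2 by field.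
have chE : cosh (th x) = C ^+ 2 + S ^+ 2 by rewrite thE coshD -/C -/S; ring.
have sE : sin b = 2 * al * be by rewrite {1}bE sinD -/al -/be; ring.
have cE : cos b = al ^+ 2 - be ^+ 2 by rewrite {1}bE cosD -/al -/be; ring.
rewrite chE sE cE /w -/al -/be /tanh -/C -/S.
have D0 : 0 < C ^+ 2 * be ^+ 2 + S ^+ 2 * al ^+ 2.
  by apply: ltr_pwDl; [rewrite mulr_gt0// exprn_gt0|rewrite mulr_ge0 ?sqr_ge0].
have -> : C ^+ 2 + S ^+ 2 - (al ^+ 2 - be ^+ 2) = 2 * (C ^+ 2 * be ^+ 2 + S ^+ 2 * al ^+ 2).
  by rewrite C2 al2; ring.
have -> : 1 + (S / C * (al / be)) ^+ 2 = (C ^+ 2 * be ^+ 2 + S ^+ 2 * al ^+ 2) / (C ^+ 2 * be ^+ 2).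
  by field; rewrite sb gt_eqF.
field; apply/and3P; split; [|exact: sb|by rewrite gt_eqF].
have -> : (C * be) ^+ 2 + (S * al) ^+ 2 = C ^+ 2 * be ^+ 2 + S ^+ 2 * al ^+ 2 by ring.
by rewrite gt_eqF.
Qed.

(** * The complete right-hand side: values at critical points and zero mean *)

Section muskat_rhs_graph.
Context {R : realType}.
Notation mu := (@lebesgue_measure R).
Implicit Types (b c x y : R).
Variables (u du : R -> R) (K : R).
Hypothesis hu : forall x h, `|u (x + h) - u x - du x * h| <= K * h ^+ 2.
Hypothesis pu : forall x, u (x + pi *+ 2) = u x.

Let udu x : is_derive x 1 u (du x). Proof. exact: quadratic_remainder_is_derive. Qed.
Let cu : continuous u. Proof. exact: is_derive_continuous udu. Qed.
Let cdu : continuous du.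
Proof. exact: lipschitz_continuous (quadratic_remainder_lipschitz hu). Qed.
Let derive1_du : derive1 u = du.
Proof. by apply/funext => x; rewrite derive1E; have [_ ->] := udu x. Qed.

Let N (z : R * R) := sin z.2 * (du z.1 - du (z.1 - z.2)) / (cosh (u z.1 - u (z.1 - z.2)) - cos z.2).

Let measurable_N : measurable_fun [set: R * R] N.
Proof.
apply: measurable_funM_inv.
  apply: measurable_funM.
    by apply: (@measurable_fun_comp_snd _ sin) => ?; exact: continuous_sin.
  apply: measurable_funB; first exact: measurable_fun_comp_fst.
  exact: measurable_fun_comp_sub.
apply: measurable_funB; last first.
  by apply: (@measurable_fun_comp_snd _ cos) => ?; exact: continuous_cos.
apply: (measurableT_comp (g := fun z : R * R => u z.1 - u (z.1 - z.2))
  (continuous_measurable_fun (@continuous_cosh R))).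
by apply: measurable_funB; [exact: measurable_fun_comp_fst|exact: measurable_fun_comp_sub].
Qed.

Let N_bounded x b : - pi <= b <= pi -> `|N (x, b)| <= 2 * K / (7 / 100).
Proof. by move=> hb; exact: (muskat_integrand_bounded hu). Qed.

Lemma Rintegral_pv_muskat (S := fun x => pv_int 0 (fun b =>
    sin b * (du x - du (x - b)) / (cosh (u x - u (x - b)) - cos b))) :
  mu.-integrable `[- pi, pi] (EFin \o S) /\ \int[mu]_(x in `[- pi, pi]) S x = 0.
Proof.
have pi0 := @pi_gt0 R; have pp : - pi <= pi :> R by lra.
have -> : S = (fun x => \int[mu]_(b in `[- pi, pi]) N (x, b)).
  by apply/funext => x; exact: pv_muskat.
have mx x : measurable_fun [set: R] (fun b => N (x, b)).
  by apply: (measurableT_comp (g := fun b => (x, b)) measurable_N); exact: measurable_fun_pair.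
split.
  apply: (@integrable_bounded R _ _ _ (2 * K / (7 / 100) * (pi - - pi))).
    exact: (measurable_fun_Rintegral _ measurable_N).
  by move=> x _; apply: le_normr_Rintegral_bounded => // b; exact: N_bounded.
rewrite (@Rintegral_Fubini_bounded _ N _ _ _ _ _ measurable_N (fun x b _ hb => N_bounded x hb)).
transitivity (\int[mu]_(b in `[- pi, pi]) (0 * 0 : R)); last first.
  by rewrite Rintegral_itvZ ?mul0r//; apply: (@integrable_continuous R _ _ (fun=> 0)) => c; exact: cvg_cst.
apply: eq_Rintegral => b; rewrite inE/= in_itv/= => /andP[b1 b2]; rewrite mul0r.
have [b0|b0] := eqVneq b 0.
  transitivity (\int[mu]_(x in `[- pi, pi]) (0 * 0 : R)); last first.
    by rewrite Rintegral_itvZ ?mul0r//; apply: (@integrable_continuous R _ _ (fun=> 0)) => c; exact: cvg_cst.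
  by apply: eq_Rintegral => x _; rewrite /N/= b0 sin0 !mul0r.
have sb : sin (b / 2) != 0.
  move: b0; rewrite neq_lt => /orP[b0|b0].
    rewrite -oppr_eq0 -sinN gt_eqF// sin_gt0_pi//; lra.
  by rewrite gt_eqF// sin_gt0_pi//; lra.
have D0 y : 0 < cosh y - cos b.
  apply: lt_le_trans (oneBcos_le_cosh y _); last by rewrite b1.
  by rewrite mulr_gt0// exprn_even_gt0.
have dth x : is_derive x 1 (fun x => u x - u (x - b)) (du x - du (x - b)).
  by have ? := udu x; have ? := is_derive_shiftf (udu (x - b)); apply: is_derive_eq.
have dF x := is_derive_atan_tanh sb (dth x).
have cshift (g : R -> R) : continuous g -> continuous (fun x => g (x - b)).
  move=> cg x; apply: (@continuous_comp _ _ _ (fun x => x - b) g); last exact: cg.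
  by apply: cvgB; [exact: cvg_id|exact: cvg_cst].
rewrite (is_derive_FTC2 pp dF).
  have pE : pi = - pi + pi *+ 2 :> R by rewrite mulr2n; ring.
  have up : u pi = u (- pi) by rewrite {1}pE pu.
  have up' : u (pi - b) = u (- pi - b) by rewrite {1}pE addrAC pu.
  by rewrite up up' subrr.
move=> x; apply: cvgM.
  apply: cvgM; first exact: cvg_cst.
  by apply: cvgB; [exact: cdu|exact: cshift].
apply: cvgV; first by rewrite gt_eqF.
apply: cvgB; last exact: cvg_cst.
apply: (@continuous_comp _ _ _ (fun x => u x - u (x - b)) cosh); last exact: continuous_cosh.
by apply: cvgB; [exact: cu|exact: cshift].
Qed.

Section rhs.
Variables (kp km rp rm h2 : R).
Hypothesis h2_gt0 : 0 < h2.
Hypothesis u_ge0 : forall x, 0 <= u x.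

Lemma muskat_rhs_extremum x : du x = 0 ->
  muskat_rhs kp km rp rm h2 u x = - (kp * (rm - rp) / (4 * pi)) *
    (\int[mu]_(b in `[- pi, pi]) poisson (u x - u (x - b)) b +
     perm_ratio kp km * \int[mu]_(b in `[- pi, pi])
       (poisson (u x + h2 + (u (x - b) + h2)) b - 1)).
Proof.
move=> dux; rewrite /muskat_rhs derive1_du (pv_muskat hu) (muskat_extremum hu pu dux).
rewrite (pv_varpi2_extremum hu pu h2_gt0 u_ge0 kp km rp rm dux).
have pi0 := lt0r_neq0 (@pi_gt0 R).
move: (\int[mu]_(b in _) _) => I1; move: (\int[mu]_(b in _) _) => I2.
rewrite /amplitude; move: (pi : R) pi0 => p p0; by field.
Qed.

Lemma Rintegral_muskat_rhs : \int[mu]_(x in `[- pi, pi]) muskat_rhs kp km rp rm h2 u x = 0.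
Proof.
have [i1 I1] := Rintegral_pv_muskat.
have [i2 I2] := Rintegral_pv_varpi2 hu pu h2_gt0 u_ge0 kp km rp rm.
have iZ k (g : R -> R) : mu.-integrable `[- pi, pi] (EFin \o g) ->
    mu.-integrable `[- pi, pi] (EFin \o (fun x => k * g x)).
  move=> ig; have := @integrableZl _ _ R mu _ (measurable_itv _) k _ ig.
  by apply: eq_integrable => // x _; rewrite /= EFinM.
rewrite /muskat_rhs derive1_du (Rintegral_itvD (iZ _ _ i1) (iZ _ _ i2)).
by rewrite (Rintegral_itvZ _ i1) (Rintegral_itvZ _ i2) I1 I2 !mulr0 addr0.
Qed.

End rhs.
End muskat_rhs_graph.

(** * Dissipation at the extrema *)

Lemma norm_perm_ratio_lt1 (R : realType) (kp km : R) : 0 < kp -> 0 < km ->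
  `|perm_ratio kp km| < 1.
Proof.
move=> k1 k2; rewrite /perm_ratio normrM normfV (gtr0_norm (addr_gt0 k1 k2)).
rewrite ltr_pdivrMr ?addr_gt0// mul1r ltr_norml.
by apply/andP; split; lra.
Qed.

(* A and B stand for the integrals of P(l(x) - l(x - b), b) at the maximum and of its opposite at
   the minimum, X and Y for those of P(l(x) + l(x - b), b) there, and P for 2 pi. *)
Section dissipation_algebra.
Context {R : realType}.
Implicit Types q r A B X Y P p T v : R.

Lemma dissipation_ge0_ratio r A B X Y P : 0 <= r -> P <= X + A -> Y <= P + B ->
  (1 - r) * (A + B) <= A + B + r * (X - P) - r * (Y - P).
Proof.
move=> r0 h1 h2.
have h3 : 0 <= r * (X + A - P) by rewrite mulr_ge0// subr_ge0.
have h4 : 0 <= r * (P + B - Y) by rewrite mulr_ge0// subr_ge0.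
lra.
Qed.

Lemma dissipation_le0_ratio q A B X Y P : 0 <= q -> 0 <= A -> X <= P + 1 / 2 * A -> P <= Y + B ->
  (1 - q) * (A + B) <= A + B + - q * (X - P) - - q * (Y - P).
Proof.
move=> q0 A0 h1 h2.
have h3 : 0 <= q * (P + 1 / 2 * A - X) by rewrite mulr_ge0// subr_ge0.
have h4 : 0 <= q * (Y + B - P) by rewrite mulr_ge0// subr_ge0.
have h5 : 0 <= q * A by rewrite mulr_ge0.
lra.
Qed.

(** Here the shifted inequality at the minimum is replaced by Y >= P p T. Inserting all lower bounds
    gives P (T - q (1 + T/2 - 3 p T/2)), which is the origin of the expression in
    [decay_numerics]. *)
Lemma dissipation_coarse q A B X Y P p T v : 0 <= q <= 1 -> 0 <= P ->
  P * ((1 - p) * T) <= A -> P * (p * T) <= B -> P * (p * T) <= Y -> X <= P + 1 / 2 * A ->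
  q * (1 + T / 2 - 3 / 2 * p * T) <= v * T ->
  P * ((1 - v) * T) <= A + B + - q * (X - P) - - q * (Y - P).
Proof.
move=> /andP[q0 q1] P0 hA hB hY hX hv.
have h1 : 0 <= (1 - q / 2) * (A - P * ((1 - p) * T)) by rewrite mulr_ge0 ?subr_ge0//; lra.
have h2 : 0 <= q * (Y - P * (p * T)) by rewrite mulr_ge0// subr_ge0.
have h3 : 0 <= q * (P + 1 / 2 * A - X) by rewrite mulr_ge0// subr_ge0.
have h4 : 0 <= P * (v * T - q * (1 + T / 2 - 3 / 2 * p * T)) by rewrite mulr_ge0// subr_ge0.
lra.
Qed.

End dissipation_algebra.

Section extremal_dissipation.
Context {R : realType}.
Notation mu := (@lebesgue_measure R).
Implicit Types (b c x y : R).

Lemma le_Rintegral_itv a b (g h : R -> R) : mu.-integrable `[a, b] (EFin \o g) ->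
  mu.-integrable `[a, b] (EFin \o h) -> (forall x, a <= x <= b -> g x <= h x) ->
  \int[mu]_(x in `[a, b]) g x <= \int[mu]_(x in `[a, b]) h x.
Proof. by move=> ig ih gh; apply: le_Rintegral. Qed.

Variables (u du : R -> R) (K : R).
Hypothesis hu : forall x h, `|u (x + h) - u x - du x * h| <= K * h ^+ 2.
Hypothesis pu : forall x, u (x + pi *+ 2) = u x.
Variables (h2 xM xm : R).
Hypothesis h2_gt0 : 0 < h2.
Hypothesis u_ge0 : forall x, 0 <= u x.
Hypotheses (duM : du xM = 0) (dum : du xm = 0).
Hypothesis u_bounds : forall x, u xm <= u x <= u xM.
Hypothesis u_lt : u xm < u xM.

Let udu x : is_derive x 1 u (du x). Proof. exact: quadratic_remainder_is_derive. Qed.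
Let cu : continuous u. Proof. exact: is_derive_continuous udu. Qed.

Let l x := u x + h2.
Let w := u xM - u xm.
Let a := h2 + mean u.
(** Relative height of the mean between minimum and maximum. The guaranteed gain T is shared between
    the extrema in the proportions 1 - p and p, so that the sum does not depend on the profile. *)
Let p := (a - l xm) / w.
Let T := tanh (w / 2).
Let w_gt0 : 0 < w. Proof. by rewrite subr_gt0. Qed.
Let T_gt0 : 0 < T. Proof. by rewrite tanh_gt0// divr_gt0. Qed.
Let T_lt1 : T < 1. Proof. exact: tanh_lt1. Qed.
Let l_gt0 x : 0 < l x. Proof. by rewrite ltr_wpDl. Qed.
Let cl : continuous l. Proof. by move=> x; apply: cvgD; [exact: cu|exact: cvg_cst]. Qed.

Let IPl x := \int[mu]_(b in `[- pi, pi]) poisson (l x + l (x - b)) b.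

Let cPl x : continuous (fun b => poisson (l x + l (x - b)) b).
Proof.
have cll : continuous (fun b => l x + l (x - b)).
  by move=> b; apply: cvgD; [exact: cvg_cst|exact: (continuous_reflect (x := x) cl)].
move=> b; apply: cvgM.
  by apply: (@continuous_comp _ _ _ (fun b => l x + l (x - b)) sinh); [exact: cll|exact: continuous_sinh].
apply: cvgV; first by rewrite gt_eqF// coshBcos_gt0// gt_eqF// addr_gt0.
apply: cvgB; last exact: continuous_cos.
by apply: (@continuous_comp _ _ _ (fun b => l x + l (x - b)) cosh); [exact: cll|exact: continuous_cosh].
Qed.

Let iPl x : mu.-integrable `[- pi, pi] (EFin \o (fun b => poisson (l x + l (x - b)) b)).
Proof. by apply: integrable_continuous; exact: cPl. Qed.

Let iP x : du x = 0 -> mu.-integrable `[- pi, pi] (EFin \o (fun b => poisson (u x - u (x - b)) b)).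
Proof.
move=> dux; have [C hC] := poisson_theta_bounded hu pu dux.
apply: integrable_bounded hC; apply: measurable_quotient.
  exact: (continuous_sinh_theta hu).
exact: (continuous_cosh_theta hu).
Qed.

Let icst k : mu.-integrable `[- pi, pi] (EFin \o (fun=> k)).
Proof. by apply: integrable_continuous => y; exact: cvg_cst. Qed.

Let iZ k (g : R -> R) : mu.-integrable `[- pi, pi] (EFin \o g) ->
  mu.-integrable `[- pi, pi] (EFin \o (fun x => k * g x)).
Proof.
move=> ig; have := @integrableZl _ _ R mu _ (measurable_itv _) k _ ig.
by apply: eq_integrable => // x _; rewrite /= EFinM.
Qed.

Let iD (g h : R -> R) : mu.-integrable `[- pi, pi] (EFin \o g) ->
  mu.-integrable `[- pi, pi] (EFin \o h) ->
  mu.-integrable `[- pi, pi] (EFin \o (fun x => g x + h x)).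
Proof.
move=> ig ih; have := @integrableD _ _ R mu _ (measurable_itv _) _ _ ig ih.
by apply: eq_integrable => // x _; rewrite /= EFinD.
Qed.

Let pi_pos : 0 < pi :> R := @pi_gt0 R.

Let pi2_neq0 : 2 * pi != 0 :> R. Proof. by rewrite mulf_neq0// gt_eqF. Qed.

Let torus_intE (g : R -> R) : \int[mu]_(b in `[- pi, pi]) g b = 2 * pi * mean g.
Proof. by rewrite /mean /torus_int /torus mulrA divff// mul1r. Qed.

Let aE : a = mean l.
Proof.
have ch : continuous (fun _ : R => h2) by move=> x; exact: cvg_cst.
by have := meanD cu ch; rewrite (@mean_cst R h2) => H; rewrite /a addrC -H.
Qed.

Let mean_l x : \int[mu]_(b in `[- pi, pi]) l (x - b) = 2 * pi * a.
Proof.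
rewrite torus_intE aE -(@mean_reflect _ l x cl)//.
by move=> y; rewrite /l pu.
Qed.

Let Icst k : \int[mu]_(b in `[- pi, pi]) k = 2 * pi * k.
Proof. by rewrite torus_intE mean_cst. Qed.

Let p_itv : 0 <= p <= 1.
Proof.
have h : l xm <= a <= l xM.
  rewrite aE.
  have cc (k : R) : continuous (fun _ : R => k) by move=> y; exact: cvg_cst.
  rewrite -(@mean_cst _ (l xm)) -(@mean_cst _ (l xM)); apply/andP; split; apply: le_mean => // x _.
    by rewrite /l lerD2r; have /andP[] := u_bounds x.
  by rewrite /l lerD2r; have /andP[] := u_bounds x.
move/andP: h => [h1 h3].
apply/andP; split; first by rewrite divr_ge0 ?subr_ge0// ltW.
by rewrite ler_pdivrMr// mul1r /w; move: h3; rewrite /l; lra.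
Qed.

(** The chord of tanh over the range of the oscillation: being linear in [s], it integrates to an
    expression in the mean of l alone. *)
Let tanh_secant s : 0 <= s <= w -> s * (T / w) <= tanh (s / 2).
Proof.
move=> /andP[s0 sw]; have := @tanh_concave R (s / w) (w / 2).
rewrite (_ : s / w * (w / 2) = s / 2); last by field; rewrite gt_eqF.
rewrite -/T mulrAC -mulrA => -> //; last by rewrite divr_ge0// ltW.
by rewrite divr_ge0// ?(ltW w_gt0)//= ler_pdivrMr// mul1r.
Qed.

Let IM := \int[mu]_(b in `[- pi, pi]) poisson (u xM - u (xM - b)) b.
Let Im := \int[mu]_(b in `[- pi, pi]) poisson (u (xm - b) - u xm) b.

Let iPm : mu.-integrable `[- pi, pi] (EFin \o (fun b => poisson (u (xm - b) - u xm) b)).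
Proof.
have := iZ (-1) (iP dum); apply: eq_integrable => // b _ /=.
by rewrite -[u (xm - b) - _]opprB poissonN mulN1r.
Qed.

Let ImE : \int[mu]_(b in `[- pi, pi]) poisson (u xm - u (xm - b)) b = - Im.
Proof.
rewrite -[RHS]mulN1r -Rintegral_itvZ//; apply: eq_Rintegral => b _.
by rewrite -[u (xm - b) - _]opprB poissonN mulN1r opprK.
Qed.

Let IM_ge : 2 * pi * ((1 - p) * T) <= IM.
Proof.
apply: (@le_trans _ _ (\int[mu]_(b in `[- pi, pi]) (l xM * (T / w) + (- (T / w)) * l (xM - b)))).
  rewrite Rintegral_itvD ?Icst; last 2 first.
  - exact: icst.
  - by apply: iZ; apply: integrable_continuous; exact: continuous_reflect.
  rewrite Rintegral_itvZ; last by apply: integrable_continuous; exact: continuous_reflect.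
  rewrite mean_l le_eqVlt; apply/orP; left; apply/eqP.
  rewrite /p; have -> : l xM = w + l xm by rewrite /l /w; ring.
  move: (l xm) w w_gt0 (pi : R) => lm ww ww0 q; field; by rewrite gt_eqF.
apply: le_Rintegral_itv.
- apply: iD; first exact: icst.
  by apply: iZ; apply: integrable_continuous; exact: continuous_reflect.
- exact: iP.
move=> b _; have /andP[h1 h3] := u_bounds (xM - b).
have s0 : 0 <= u xM - u (xM - b) by rewrite subr_ge0.
apply: (le_trans _ (poisson_ge_tanh _ s0)); apply: (le_trans _ (tanh_secant _)); last first.
  by rewrite s0/= lerB.
by rewrite mulNr [T / w * _]mulrC -mulrBl /l opprD addrACA subrr addr0.
Qed.

(** Kept general in [g], as it serves for the kernel of the difference ([Im_ge]) and for that of the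
    sum ([coarse_m]). *)
Let tanh_m_integral (g : R -> R) : mu.-integrable `[- pi, pi] (EFin \o g) ->
  (forall b, tanh ((u (xm - b) - u xm) / 2) <= g b) ->
  2 * pi * (p * T) <= \int[mu]_(b in `[- pi, pi]) g b.
Proof.
move=> ig hg.
apply: (@le_trans _ _ (\int[mu]_(b in `[- pi, pi]) (- l xm * (T / w) + T / w * l (xm - b)))).
  rewrite Rintegral_itvD ?Icst; last 2 first.
  - exact: icst.
  - by apply: iZ; apply: integrable_continuous; exact: continuous_reflect.
  rewrite Rintegral_itvZ; last by apply: integrable_continuous; exact: continuous_reflect.
  rewrite mean_l le_eqVlt; apply/orP; left; apply/eqP.
  rewrite /p; move: (l xm) w w_gt0 (pi : R) => lm ww ww0 q; field; by rewrite gt_eqF.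
apply: le_Rintegral_itv => //.
- apply: iD; first exact: icst.
  by apply: iZ; apply: integrable_continuous; exact: continuous_reflect.
move=> b _; have /andP[h1 h3] := u_bounds (xm - b).
apply: (le_trans _ (hg b)); apply: (le_trans _ (tanh_secant _)); last first.
  by rewrite subr_ge0 h1/= lerB.
by rewrite addrC [T / w * _]mulrC mulNr -mulrBl /l opprD addrACA subrr addr0.
Qed.

Let s_ge0 b : 0 <= u (xm - b) - u xm.
Proof. by have /andP[h1 _] := u_bounds (xm - b); rewrite subr_ge0. Qed.

Let sM_ge0 b : 0 <= u xM - u (xM - b).
Proof. by have /andP[_ h1] := u_bounds (xM - b); rewrite subr_ge0. Qed.

Let Im_ge : 2 * pi * (p * T) <= Im.
Proof. by apply: tanh_m_integral => // b; exact: poisson_ge_tanh. Qed.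

Let lM_split b : l xM + l (xM - b) + (u xM - u (xM - b)) = l xM + l xM.
Proof. by rewrite /l; ring. Qed.

Let lm_split b : l xm + l (xm - b) = l xm + l xm + (u (xm - b) - u xm).
Proof. by rewrite /l; ring. Qed.

Let ll_gt0 x y : 0 < l x + l y. Proof. by rewrite addr_gt0. Qed.

Let iP2 x : mu.-integrable `[- pi, pi] (EFin \o (fun b => poisson (l x + l x) b)).
Proof. by apply: integrable_continuous; apply: continuous_poisson; rewrite gt_eqF. Qed.

(** 2 pi is the integral of the kernel with the constant parameter 2 l(xM), and 2 l(xM) is the sum
    of l(xM) + l(xM - b) and u(xM) - u(xM - b). *)
Let subadditive_M : 2 * pi <= IPl xM + IM.
Proof.
rewrite -(Rintegral_poisson (ll_gt0 xM xM)) -Rintegral_itvD//; last exact: iP.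
apply: le_Rintegral_itv => //; first by apply: iD => //; exact: iP.
by move=> b _; rewrite -(lM_split b) poisson_subadditive// ltW.
Qed.

Let subadditive_m : IPl xm <= 2 * pi + Im.
Proof.
rewrite -(Rintegral_poisson (ll_gt0 xm xm)) -Rintegral_itvD//.
apply: le_Rintegral_itv => //; first exact: iD.
by move=> b _; rewrite lm_split poisson_subadditive// ltW.
Qed.

(** At the maximum the difference never exceeds the sum, so s <= t for the two tanh values and s^2
    <= t (s + t) / 2: the admissible K = 1/2 is enough. *)
Let shift_M : IPl xM <= 2 * pi + 1 / 2 * IM.
Proof.
rewrite -(Rintegral_poisson (ll_gt0 xM xM)) -Rintegral_itvZ ?iP// -Rintegral_itvD//; last first.
  by apply: iZ; exact: iP.
apply: le_Rintegral_itv => //; first by apply: iD => //; apply: iZ; exact: iP.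
move=> b _; rewrite -(lM_split b); apply: poisson_le_shift => //.
set s := tanh _; set t := tanh _.
have s0 : 0 <= s by rewrite tanh_ge0// divr_ge0.
have st : s <= t.
  rewrite le_tanh// ler_pM2r// /l; have := u_ge0 (xM - b).

  by move: h2_gt0; lra.
have t1 : t <= 1 by rewrite ltW// tanh_lt1.
by nra.
Qed.

Let W := tanh (l xm).

(** With K = 1 the requirement is s^2 (1 - W^2) <= W (s + W) for 0 <= s <= T. It follows from W >= 5
    s / 8, since 5/8 + 25/64 > 1, and from W >= 1/2, the exact threshold at s = 1, where it becomes
    (1 - s) (3 s + 1) >= 0. *)
Let shift_m : 5 / 8 * T <= W \/ 1 / 2 <= W -> 2 * pi <= IPl xm + Im.
Proof.
move=> hW; rewrite -(Rintegral_poisson (ll_gt0 xm xm)) -Rintegral_itvD//.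
apply: le_Rintegral_itv => //; first exact: iD.
move=> b _; rewrite lm_split -[poisson (_ - _) _]mul1r; apply: poisson_le_shift => //; first lra.
rewrite (_ : (l xm + l xm) / 2 = l xm) -/W; last by field.
set s := tanh _; rewrite mul1r.
have s0 : 0 <= s by rewrite tanh_ge0// divr_ge0.
have sT : s <= T.
  by rewrite le_tanh// ler_pM2r// lerB//; have /andP[] := u_bounds (xm - b).
have W1 : W <= 1 by rewrite ltW// tanh_lt1.
have s1 : s <= 1 := le_trans sT (ltW T_lt1).
have s2 := sqr_ge0 s; case: hW => hW.
  have h1 : 0 <= s * (W - 5 / 8 * s) by rewrite mulr_ge0//; lra.
  have h3 : 0 <= (W - 5 / 8 * s) * (W + 5 / 8 * s) by rewrite mulr_ge0//; lra.
  have h4 : 0 <= s ^+ 2 * W ^+ 2 by rewrite mulr_ge0// sqr_ge0.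
  lra.
have h1 : 0 <= s * (W - 1 / 2) by rewrite mulr_ge0//; lra.
have h3 : 0 <= (W - 1 / 2) * (W + 1 / 2) by rewrite mulr_ge0//; lra.
have h4 : 0 <= s ^+ 2 * ((W - 1 / 2) * (W + 1 / 2)) by rewrite mulr_ge0.
have h5 : 0 <= (1 - s) * (3 * s + 1) by rewrite mulr_ge0//; lra.
lra.
Qed.

Let coarse_m : 2 * pi * (p * T) <= IPl xm.
Proof.
apply: tanh_m_integral => // b; apply: le_trans (poisson_ge_tanh _ (ltW (ll_gt0 _ _))).
by rewrite le_tanh// ler_pM2r// lm_split lerDr addr_ge0// ltW.
Qed.

Variables (kp km rp rm : R).
Hypotheses (kp_gt0 : 0 < kp) (km_gt0 : 0 < km) (stable : 0 < rm - rp).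
Let r := perm_ratio kp km.

Hypothesis small : `|r| * cosh (w / 2) * sinh (a + w) <= pi ^+ 2 * sinh (a / 2) ^+ 6.

Let dissipation_ge : 2 * pi * ((1 - Num.max `|r| (97 / 100)) * T) <=
  IM + Im + r * (IPl xM - 2 * pi) - r * (IPl xm - 2 * pi).
Proof.
have /andP[p0 p1] := p_itv.
have q1 : `|r| <= Num.max `|r| (97 / 100) by rewrite le_max lexx.
have r1 : `|r| < 1 by exact: norm_perm_ratio_lt1.
have piT : 0 < 2 * pi * T by apply: mulr_gt0 => //; exact: mulr_gt0.
have sum_ge : 2 * pi * T <= IM + Im.
  by have := IM_ge; have := Im_ge; lra.
have sum0 : 0 <= IM + Im by lra.
(* The two favourable cases retain the fraction 1 - |r| of [IM + Im]. *)
have main1 D : (1 - `|r|) * (IM + Im) <= D -> 2 * pi * ((1 - Num.max `|r| (97 / 100)) * T) <= D.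
  apply: le_trans.
  apply: (@le_trans _ _ ((1 - `|r|) * (2 * pi * T))); last by rewrite ler_wpM2l// subr_ge0 ltW.
  rewrite [leLHS](_ : _ = (1 - Num.max `|r| (97 / 100)) * (2 * pi * T)); last by ring.
  by rewrite ler_wpM2r ?(ltW piT)// lerB.
have [r0|r0] := leP 0 r.
  apply: main1; rewrite (ger0_norm r0).
  exact: (dissipation_ge0_ratio r0 subadditive_M subadditive_m).
move: main1 r1 (small); rewrite ltr0_norm//.
rewrite (_ : _ + r * _ - r * _ = IM + Im + - - r * (IPl xM - 2 * pi) - - - r * (IPl xm - 2 * pi)); last by rewrite opprK.
move: (- r) (oppr_gt0 r) => q; rewrite r0 => q0 main1 r1 sm.
have IM0 : 0 <= IM.
  apply: le_trans IM_ge; apply: mulr_ge0; first by apply: mulr_ge0; [|exact: ltW].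
  by apply: mulr_ge0; [rewrite subr_ge0|exact: ltW].
have [hW|/norP[]] := boolP ((5 / 8 * T <= W) || (1 / 2 <= W)).
  apply: main1; apply: (dissipation_le0_ratio (ltW q0) IM0 shift_M).
  by apply: shift_m; exact/orP.
(* Remaining case: r < 0 and the minimum close to the jump compared with the oscillation. The
   smallness condition enters here, through [decay_numerics]. *)
rewrite -!ltNge => W1 W2.
have w2 : 0 < w / 2 by rewrite divr_gt0.
have := decay_numerics (ltW q0) w2 (l_gt0 xm) p_itv W1 W2.
have pw : l xm + 2 * p * (w / 2) = a by rewrite /p; field; rewrite gt_eqF.
have pw' : l xm / 2 + p * (w / 2) = a / 2 by rewrite -pw; field.
have w22 : 2 * (w / 2) = w by field.
rewrite pw pw' w22 => /(_ sm); rewrite -/T => num.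
apply: (@dissipation_coarse _ q IM Im (IPl xM) (IPl xm) (2 * pi) p T _ _ _ IM_ge Im_ge coarse_m shift_M num).
- by rewrite (ltW q0) ltW.
- by apply: mulr_ge0; [|exact: ltW].
Qed.

Lemma muskat_rhs_dissipation :
  muskat_rhs kp km rp rm h2 u xM - muskat_rhs kp km rp rm h2 u xm <=
  - (kp * (rm - rp) / 2 * (1 - Num.max `|r| (97 / 100)) * T).
Proof.
rewrite !(muskat_rhs_extremum hu pu)// -/IM ImE -/r.
have JE x : \int[mu]_(b in `[- pi, pi]) (poisson (u x + h2 + (u (x - b) + h2)) b - 1) = IPl x - 2 * pi.
  rewrite (Rintegral_itvD (iPl x) (icst (-1))) Icst mulrN1; by [].
rewrite !JE.
have k0 : 0 <= kp * (rm - rp) / (4 * pi) by rewrite divr_ge0 ?mulr_ge0// ltW.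
have := ler_wpM2l k0 dissipation_ge.
have -> : kp * (rm - rp) / (4 * pi) * (2 * pi * ((1 - Num.max `|r| (97 / 100)) * T)) =
   kp * (rm - rp) / 2 * (1 - Num.max `|r| (97 / 100)) * T.
  move: (Num.max _ _) (pi : R) (lt0r_neq0 pi_pos) => ? pp pp0; field; exact: pp0.
move: (kp * _ / (4 * pi)) IM Im (IPl xM) (IPl xm) => k A B X Y h.
rewrite -lerN2 opprK; apply: (le_trans h); rewrite le_eqVlt; apply/orP; left; apply/eqP; ring.
Qed.

End extremal_dissipation.

(** * Evolution of the mean and of the oscillation *)

Lemma within_continuous_dist (R : realType) (g : R -> R) (a b : R) :
  (forall s, a <= s <= b -> forall eps, 0 < eps -> exists2 d, 0 < d &
     forall t, a <= t <= b -> `|t - s| < d -> `|g t - g s| <= eps) ->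
  {within `[a, b], continuous g}.
Proof.
move=> h; apply/subspace_continuousP => s /=; rewrite in_itv/= => hs.
apply/cvgrPdist_le => /= eps eps0; have [d d0 hd] := h s hs eps eps0.
exists d => //= t; rewrite /ball/= => td; rewrite in_itv/= => ht.
by rewrite distrC; apply: hd => //; rewrite distrC.
Qed.

Section solution_in_time.
Context {R : realType}.
Notation mu := (@lebesgue_measure R).
Variables (kp km rp rm h2 T : R) (f : R -> R -> R).
Hypothesis h2_gt0 : 0 < h2.
Hypothesis sol : smooth_solution kp km rp rm h2 T f.
Hypothesis f_gt0 : forall t x : R, 0 <= t <= T -> 0 < f t x.

Lemma solution_periodic t : 0 <= t <= T -> forall x, f t (x + pi *+ 2) = f t x.
Proof. by case: (sol_sobolev sol) => + _ => /[apply] -[]. Qed.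

Lemma solution_C11 t : 0 <= t <= T -> exists (du : R -> R) (K : R),
  forall x h, `|f t (x + h) - f t x - du x * h| <= K * h ^+ 2.
Proof.
move=> ht; apply: sobolev3_C11; [exact: (sol_continuous sol ht)|exact: solution_periodic|].
by case: (sol_sobolev sol) => + _ => /(_ _ ht)[].
Qed.

Lemma solution_continuous_in_time t0 eps : 0 <= t0 <= T -> 0 < eps ->
  exists2 d, 0 < d & forall t, 0 <= t <= T -> `|t - t0| < d ->
    forall x, `|f t x - f t0 x| <= eps.
Proof.
move=> ht0 eps0; case: (sol_sobolev sol) => _ /(_ _ ht0) /fine_cvgP[fin].
(* 9 is the constant of [sobolev3_sup]. *)
move=> /cvgrPdist_lt /(_ (eps / 9)); rewrite divr_gt0// => /(_ isT) lim.
have [d /= d0 hd] := filterI fin lim.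
exists d => // t ht td x; have /= [] : _ /\ _ := hd t _ _.
- by rewrite /ball/= distrC.
- by rewrite in_itv.
move=> fn; rewrite sub0r normrN => small.
have cu : continuous (f t \- f t0).
  by move=> y; apply: cvgB; [exact: (sol_continuous sol ht)|exact: (sol_continuous sol ht0)].
have pu y : (f t \- f t0) (y + pi *+ 2) = (f t \- f t0) y.
  by rewrite /= !solution_periodic.
apply: (le_trans (sobolev3_sup x cu pu _)); first by rewrite ltey_eq fn.
rewrite mulrC -ler_pdivlMr//; apply: le_trans (ltW small); exact: ler_norm.
Qed.

Lemma norm_mean_le (u v : R -> R) eps : continuous u -> continuous v ->
  (forall x, `|u x - v x| <= eps) -> `|mean u - mean v| <= eps.
Proof.
move=> cu cv uv.
have cuv : continuous (fun x => u x + (-1) * v x).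
  by move=> x; apply: cvgD; [exact: cu|apply: cvgM; [exact: cvg_cst|exact: cv]].
have cNv : continuous (fun x => (-1) * v x).
  by move=> x; apply: cvgM; [exact: cvg_cst|exact: cv].
have -> : mean u - mean v = mean (fun x => u x + (-1) * v x).
  by rewrite (meanD cu cNv) (meanZ _ cv) mulN1r.
rewrite -(@mean_cst R eps); apply: ler_norm_mean => //.
  by move=> x; exact: cvg_cst.
by move=> x _; rewrite mulN1r.
Qed.

Let dt t x := derive1 (f^~ x) t.

Let dtE t x : 0 < t < T -> dt t x = muskat_rhs kp km rp rm h2 (f t) x.
Proof. by move=> ht; rewrite /dt derive1E; have [_ ->] := sol_eq sol x ht. Qed.

(** Joint continuity of the time derivative on a compact subset of the open time interval provides
    the dominating constant for differentiation under the integral. *)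
Let dt_bounded a b : 0 < a -> b < T -> exists C, forall t x, a <= t <= b -> - pi <= x <= pi ->
  `|dt t x| <= C.
Proof.
move=> a0 bT; pose g (p : R * R) := derive1 (f^~ p.2) p.1.
have cpt : compact (g @` (`[a, b]%classic `*` `[- pi, pi]%classic)).
  apply: continuous_compact; last by apply: compact_setX; exact: segment_compact.
  apply: continuous_in_subspaceT => -[t x]; rewrite inE/= !in_itv/= => -[/andP[t1 t2] _].
  apply: (sol_C1 sol); apply/andP; split; [exact: lt_le_trans t1|exact: le_lt_trans bT].
have [M [_ hM]] := compact_bounded cpt.
exists (M + 1) => t x ht hx; apply: (hM (M + 1)); first by rewrite ltrDl.
by exists (t, x) => //=; rewrite !in_itv.
Qed.

Let is_derive_mean t : 0 < t < T -> is_derive t 1 (fun s => mean (f s)) 0.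
Proof.
move=> /andP[t0 tT]; pose a := t / 2; pose b := (t + T) / 2.
have [a0 b0] : 0 < a /\ b < T by rewrite /a /b; split; lra.
have [C hC] := dt_bounded a0 b0.
have tab : `]a, b[%classic t by rewrite /= in_itv/= /a /b; apply/andP; split; lra.
have intf s : `]a, b[%classic s -> mu.-integrable `[- pi, pi] (EFin \o f s).
  rewrite /= in_itv/= => /andP[s1 s2]; apply: integrable_continuous.
  by apply: (sol_continuous sol); apply/andP; split; lra.
have der s x : `]a, b[%classic s -> `[- pi, pi]%classic x -> derivable (f^~ x) s 1.
  rewrite /= in_itv/= => /andP[s1 s2] _.
  have hs : 0 < s < T by apply/andP; split; lra.
  by have [] := sol_eq sol x hs.
have C0 : 0 <= `|C| by [].
have iC : mu.-integrable `[- pi, pi] (EFin \o (fun=> `|C|)).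
  by apply: integrable_continuous => y; exact: cvg_cst.
have ub s x : `]a, b[%classic s -> `[- pi, pi]%classic x -> `|partial1of2 f s x| <= `|C|.
  rewrite /= !in_itv/= => /andP[s1 s2] hx; apply: (le_trans _ (ler_norm C)).
  by apply: hC => //; rewrite !ltW.
have D := @derivable_under_integral R _ _ mu f _ (measurable_itv _) t a b tab intf der _ (fun=> C0) iC ub.
have E := @differentiation_under_integral R _ _ mu f _ (measurable_itv _) t a b tab intf der _ (fun=> C0) iC ub.
have Fd : is_derive t 1 (fun s => \int[mu]_(y in `[- pi, pi]) f s y) 0.
  apply: DeriveDef => //; rewrite -derive1E E.
  transitivity (\int[mu]_(y in `[- pi, pi]) muskat_rhs kp km rp rm h2 (f t) y).
    by apply: eq_Rintegral => y _; apply: dtE; rewrite t0.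
  have tT' : 0 <= t <= T by rewrite !ltW.
  have [du [K hu]] := solution_C11 tT'.
  apply: (Rintegral_muskat_rhs hu (solution_periodic tT')) => // x.
  exact/ltW/f_gt0.
rewrite /mean /torus_int; apply: is_derive_eq.
by rewrite /GRing.scale/= !mulr0 ?mul0r ?addr0.
Qed.

(** The equation holds only for 0 < t < T; the mean value theorem on [0, t] needs no more than that,
    together with continuity up to the end points. *)
Lemma mean_solution t : 0 <= t <= T -> mean (f t) = mean (f 0).
Proof.
move=> /andP[]; rewrite le_eqVlt => /predU1P[<-//|t0 tT].
have T0 : 0 <= T by apply: le_trans tT; exact: ltW.
have dm s : s \in `]0, t[ -> is_derive s 1 (fun s => mean (f s)) 0.
  by rewrite in_itv/= => /andP[s0 st]; apply: is_derive_mean; rewrite s0 (lt_le_trans st).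
have cm : {within `[0, t], continuous (fun s => mean (f s))}.
  apply: within_continuous_dist => s /andP[s0 st] eps eps0.
  have hs : 0 <= s <= T by rewrite s0 (le_trans st).
  have [d d0 hd] := solution_continuous_in_time hs eps0.
  exists d => // r /andP[r0 rt] rs; have hr : 0 <= r <= T by rewrite r0 (le_trans rt).
  by apply: norm_mean_le; [exact: (sol_continuous sol hr)|exact: (sol_continuous sol hs)|exact: hd].
have [c _] := MVT t0 dm cm.
by rewrite mul0r => /eqP; rewrite subr_eq0 => /eqP.
Qed.

End solution_in_time.

(** * Extrema of periodic functions *)

Section torus_extrema.
Context {R : realType}.
Implicit Types (u v du : R -> R) (x y K : R).

Lemma periodic_le u M : (forall x, u (x + pi *+ 2) = u x) ->
  (forall x, - pi <= x <= pi -> u x <= M) -> forall x, u x <= M.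
Proof.
move=> pu uM x; have [k hk] := torus_representative x.
by rewrite -(periodic_intmul pu k x) uM.
Qed.

(** The maximum over the fundamental domain is global by periodicity, so a maximizer is a critical
    point even when it is one of the end points -pi and pi. *)
Lemma torus_max_attained u : continuous u -> (forall x, u (x + pi *+ 2) = u x) ->
  exists2 x, torus_max u = u x & forall y, u y <= u x.
Proof.
move=> cu pu; have pi0 := @pi_gt0 R; have pp : - pi <= pi :> R by lra.
have [c cpi hc] := EVT_max pp (continuous_subspaceT cu (A := `[- pi, pi]%classic)).
exists c; last by apply: periodic_le => // x hx; apply: hc; rewrite in_itv.
apply/le_anti/andP; split.
  by apply: ge_sup; [exists (u c), c|move=> _ [x /= hx <-]; exact: hc].
by apply: ub_le_sup; [exists (u c) => _ [x /= hx <-]; exact: hc|exists c].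
Qed.

Lemma torus_min_attained u : continuous u -> (forall x, u (x + pi *+ 2) = u x) ->
  exists2 x, torus_min u = u x & forall y, u x <= u y.
Proof.
move=> cu pu; have pi0 := @pi_gt0 R; have pp : - pi <= pi :> R by lra.
have [c cpi hc] := EVT_min pp (continuous_subspaceT cu (A := `[- pi, pi]%classic)).
exists c; last first.
  move=> y; rewrite -lerN2; apply: (@periodic_le (fun x => - u x)) => [x|x hx].
    by rewrite pu.
  by rewrite lerN2; apply: hc; rewrite in_itv.
apply/le_anti/andP; split.
  by apply: ge_inf; [exists (u c) => _ [x /= hx <-]; exact: hc|exists c].
by apply: lb_le_inf; [exists (u c), c|move=> _ [x /= hx <-]; exact: hc].
Qed.

Lemma osc_dist u v eps : continuous u -> (forall x, u (x + pi *+ 2) = u x) ->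
  continuous v -> (forall x, v (x + pi *+ 2) = v x) ->
  (forall x, `|u x - v x| <= eps) -> `|osc u - osc v| <= 2 * eps.
Proof.
move=> cu pu cv pv uv.
have [a aE ha] := torus_max_attained cu pu; have [b bE hb] := torus_min_attained cu pu.
have [c cE hc] := torus_max_attained cv pv; have [d dE hd] := torus_min_attained cv pv.
rewrite /osc aE bE cE dE.
have := uv a; have := uv b; have := uv c; have := uv d; rewrite !ler_norml.
move=> /andP[d1 d2] /andP[c1 c2] /andP[b1 b2] /andP[a1 a2].
have := ha c; have := hb d; have := hc a; have := hd b => ? ? ? ?.
by apply/andP; split; lra.
Qed.

Lemma is_derive_max_eq0 u x (d : R) : (forall y, derivable u y 1) -> is_derive x 1 u d ->
  (forall y, u y <= u x) -> d = 0.
Proof.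
move=> du dx hx; have h : is_derive x 1 u 0.
  by apply: (@derive1_at_max R u (x - 1) (x + 1)) => //; [lra|rewrite in_itv/=; apply/andP; split; lra].
by have [_ <-] := dx; have [_ ->] := h.
Qed.

Lemma is_derive_min_eq0 u x (d : R) : (forall y, derivable u y 1) -> is_derive x 1 u d ->
  (forall y, u x <= u y) -> d = 0.
Proof.
move=> du dx hx; have h : is_derive x 1 u 0.
  by apply: (@derive1_at_min R u (x - 1) (x + 1)) => //; [lra|rewrite in_itv/=; apply/andP; split; lra].
by have [_ <-] := dx; have [_ ->] := h.
Qed.

End torus_extrema.

Section first_crossing.
Context {R : realType}.
Implicit Types (g : R -> R) (t a d : R).

Lemma is_derive_ge0_left g t0 d : 0 < t0 -> is_derive t0 1 g d ->
  (forall t, 0 <= t < t0 -> g t <= g t0) -> 0 <= d.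
Proof.
move=> t0_gt0 [dg <-] hg; rewrite leNgt; apply/negP => d0.
have := dg => /(@cvgrPdist_lt _ R^o) /(_ (- 'D_1 g t0)); rewrite oppr_gt0 d0 => /(_ isT).
case=> e /= e0 /(_ (- (Num.min e t0 / 2))) /=.
have m0 : 0 < Num.min e t0 by rewrite lt_min e0.
have me : Num.min e t0 <= e by rewrite ge_min lexx.
have mt : Num.min e t0 <= t0 by rewrite ge_min lexx orbT.
rewrite sub0r opprK gtr0_norm ?divr_gt0// => /(_ ltac:(lra)).
rewrite oppr_eq0 gt_eqF ?divr_gt0// => /(_ isT).
rewrite -/('D_1 g t0) ltr_norml => /andP[+ _].
rewrite /GRing.scale/= mulr1.
have : g (- (Num.min e t0 / 2) + t0) <= g t0 by apply: hg; apply/andP; split; lra.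
move=> h; rewrite opprK; rewrite ltrBrDr => hh.
have : 0 <= (- (Num.min e t0 / 2))^-1 * (g (- (Num.min e t0 / 2) + t0) - g t0).
  by rewrite mulr_le0// ?subr_le0// invr_le0 oppr_le0 ltW// divr_gt0.
by lra.
Qed.

(** The crossing time is the infimum of the times with g >= 0. Continuity is required only relative
    to [0, t1], since nothing is known of the solution at negative times. *)
Lemma first_crossing g t1 : 0 <= t1 ->
  (forall s, 0 <= s <= t1 -> forall eps, 0 < eps -> exists2 d, 0 < d &
     forall t, 0 <= t <= t1 -> `|t - s| < d -> `|g t - g s| <= eps) ->
  g 0 < 0 -> 0 <= g t1 ->
  exists t0, [/\ 0 < t0 <= t1, g t0 = 0 & forall t, 0 <= t < t0 -> g t < 0].
Proof.
move=> t10 cg g0 g1; pose S := [set t | 0 <= t <= t1 /\ 0 <= g t].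
have S1 : S t1 by split => //; rewrite t10 lexx.
have S_lb : has_lbound S by exists 0 => t [/andP[]].
have hS : has_inf S by split => //; exists t1.
pose t0 := inf S.
have t0_ge0 : 0 <= t0 by apply: lb_le_inf; [exists t1|move=> t [/andP[]]].
have t0_le : t0 <= t1 by exact: ge_inf.
have ht0 : 0 <= t0 <= t1 by rewrite t0_ge0.
have before t : 0 <= t < t0 -> g t < 0.
  move=> /andP[h1 h2]; rewrite ltNge; apply/negP => gt0.
  have : t0 <= t by apply: ge_inf => //; split => //; rewrite h1 (le_trans (ltW h2)).
  by rewrite leNgt h2.
have gt0_ge0 : 0 <= g t0.
  rewrite leNgt; apply/negP => n; have n2 : 0 < - g t0 / 2 by rewrite divr_gt0// oppr_gt0.
  have [d d0 hd] := cg t0 ht0 _ n2.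
  have [s [hs gs] sd] := inf_adherent d0 hS.
  have s0 : t0 <= s by exact: ge_inf.
  have : `|s - t0| < d by rewrite ger0_norm ?subr_ge0// ltrBlDl.
  by move=> /(hd s hs); rewrite ler_norml => /andP[_]; lra.
have t0_gt0 : 0 < t0.
  rewrite lt_neqAle t0_ge0 andbT; apply/eqP => E.
  by move: gt0_ge0; rewrite -E leNgt g0.
exists t0; split => //; first by rewrite t0_gt0.
apply/le_anti; rewrite gt0_ge0 andbT leNgt; apply/negP => p.
have p2 : 0 < g t0 / 2 by rewrite divr_gt0.
have [d d0 hd] := cg t0 ht0 _ p2.
pose t := t0 - Num.min d t0 / 2.
have m0 : 0 < Num.min d t0 by rewrite lt_min d0.
have md : Num.min d t0 <= d by rewrite ge_min lexx.
have mt : Num.min d t0 <= t0 by rewrite ge_min lexx orbT.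
have tb : 0 <= t < t0 by rewrite /t; apply/andP; split; lra.
have := before t tb; have /andP[tb0 tb1] := tb.
have : `|g t - g t0| <= g t0 / 2.
  apply: hd; first by rewrite tb0 (le_trans (ltW tb1)).
  by rewrite /t addrAC subrr sub0r normrN gtr0_norm ?divr_gt0//; lra.
by rewrite ler_norml => /andP[+ _]; lra.
Qed.

End first_crossing.

Section decay_threshold.
Context {R : realType}.
Implicit Types (q a w : R).

(** By cosh a - 1 = 2 sinh^2 (a/2) the cube in the denominator equals 8 sinh^6 (a/2), and the 8
    cancels. The inequality is strict and continuous in the oscillation, so it persists slightly
    beyond w0: this is the room in which the barrier starts. *)
Lemma decay_condition_open q a w0 : 0 < a ->
  0 < (cosh (w0 / 2))^-1 - 8 * q / (pi ^+ 2 * (cosh a - 1) ^+ 3) * sinh (a + w0) ->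
  exists2 w1, w0 < w1 & q * cosh (w1 / 2) * sinh (a + w1) <= pi ^+ 2 * sinh (a / 2) ^+ 6.
Proof.
move=> a0 h; pose phi w := q * cosh (w / 2) * sinh (a + w).
have pi0 := @pi_gt0 R; have S0 : 0 < sinh (a / 2) by rewrite sinh_gt0// divr_gt0.
have Z0 : 0 < pi ^+ 2 * sinh (a / 2) ^+ 6 by rewrite mulr_gt0// exprn_gt0.
have lt0 : phi w0 < pi ^+ 2 * sinh (a / 2) ^+ 6.
  have aE : a = a / 2 + a / 2 by field.
  have cE : cosh a - 1 = 2 * sinh (a / 2) ^+ 2.
    by rewrite {1}aE coshD; have := cosh2Bsinh2 (a / 2); lra.
  move: h; rewrite cE subr_gt0.
  have -> : 8 * q / (pi ^+ 2 * (2 * sinh (a / 2) ^+ 2) ^+ 3) * sinh (a + w0) =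
      q * sinh (a + w0) / (pi ^+ 2 * sinh (a / 2) ^+ 6).
    move: (sinh (a / 2)) (sinh (a + w0)) (pi : R) S0 pi0 => S s p S0 p0.
    by field; rewrite !gt_eqF.
  rewrite ltr_pdivrMr// ltr_pdivlMl ?cosh_gt0// /phi.
  by rewrite mulrCA mulrA.
have cphi : {for w0, continuous phi}.
  apply: cvgM; first apply: cvgM; first exact: cvg_cst.
  - apply: (@continuous_comp _ _ _ (fun w => w / 2) cosh); last exact: continuous_cosh.
    by apply: cvgM; [exact: cvg_id|exact: cvg_cst].
  - apply: (@continuous_comp _ _ _ (fun w => a + w) sinh); last exact: continuous_sinh.
    by apply: cvgD; [exact: cvg_cst|exact: cvg_id].
move/cvgrPdist_lt : cphi => /(_ (pi ^+ 2 * sinh (a / 2) ^+ 6 - phi w0)).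
rewrite subr_gt0 lt0 => /(_ isT)[e /= e0 he].
exists (w0 + e / 2); first by rewrite ltrDl divr_gt0.
have : `|w0 - (w0 + e / 2)| < e.
  by rewrite opprD addrA subrr sub0r normrN gtr0_norm ?divr_gt0//; lra.
by move=> /he; rewrite ltr_norml -/(phi _) => /andP[+ _]; lra.
Qed.

End decay_threshold.

(** * The exponential barrier for the oscillation *)

Section barrier.
Context {R : realType}.
Variables (kp km rp rm h2 T : R) (f : R -> R -> R).
Hypotheses (kp_gt0 : 0 < kp) (km_gt0 : 0 < km) (stable : 0 < rm - rp).
Hypotheses (h2_gt0 : 0 < h2) (T_gt0 : 0 < T).
Hypothesis sol : smooth_solution kp km rp rm h2 T f.
Hypothesis f_gt0 : forall t x : R, 0 <= t <= T -> 0 < f t x.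

Let a := h2 + mean (f 0).
Let r := perm_ratio kp km.

Variable w1 : R.
Hypothesis small : `|r| * cosh (w1 / 2) * sinh (a + w1) <= pi ^+ 2 * sinh (a / 2) ^+ 6.

(** The dissipation at oscillation w is a multiple of tanh (w/2); for w <= w1 concavity bounds tanh
    (w/2) below by w tanh (w1/2) / w1, which makes the rate linear. *)
Let nu := kp * (rm - rp) / 2 * (1 - Num.max `|r| (97 / 100)) * (tanh (w1 / 2) / w1).

Let a_gt0 : 0 < a.
Proof.
have T0 : 0 <= (0 : R) <= T by rewrite lexx ltW.
rewrite /a ltr_pwDl//; have {1}<- := @mean_cst R 0; apply: le_mean.
- by move=> x; exact: cvg_cst.
- exact: (sol_continuous sol T0).
- by move=> x _; exact/ltW/f_gt0.
Qed.

Let rate_gt0 : 0 < kp * (rm - rp) / 2 * (1 - Num.max `|r| (97 / 100)).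
Proof.
apply: mulr_gt0; first by rewrite divr_gt0// mulr_gt0.
by rewrite subr_gt0 gt_max norm_perm_ratio_lt1//=; lra.
Qed.

Let rhs_extrema t xM xm : 0 < t < T -> (forall x, f t x <= f t xM) ->
  (forall x, f t xm <= f t x) -> 0 < f t xM - f t xm <= w1 ->
  muskat_rhs kp km rp rm h2 (f t) xM - muskat_rhs kp km rp rm h2 (f t) xm <=
  - nu * (f t xM - f t xm).
Proof.
move=> /andP[t0 tT] hM hm /andP[]; set w := f t xM - f t xm => w0 ww.
have ht : 0 <= t <= T by rewrite !ltW.
have [du [K hu]] := solution_C11 sol ht; have pu := solution_periodic sol ht.
have udu := quadratic_remainder_is_derive hu.
have der x : derivable (f t) x 1 by have [] := udu x.
have duM := is_derive_max_eq0 der (udu xM) hM.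
have dum := is_derive_min_eq0 der (udu xm) hm.
have u0 x : 0 <= f t x by exact/ltW/f_gt0.
have ub x : f t xm <= f t x <= f t xM by rewrite hM hm.
have uw : f t xm < f t xM by rewrite -subr_gt0.
have mE : h2 + mean (f t) = a by rewrite (mean_solution h2_gt0 sol f_gt0 ht).
have sm : `|r| * cosh (w / 2) * sinh (h2 + mean (f t) + w) <=
    pi ^+ 2 * sinh ((h2 + mean (f t)) / 2) ^+ 6.
  rewrite mE; apply: le_trans small; rewrite -[leLHS]mulrA -[leRHS]mulrA ler_wpM2l//.
  apply: ler_pM; first exact/ltW/cosh_gt0.
  - by rewrite sinh_ge0// addr_ge0// ltW.
  - by rewrite le_cosh ?divr_ge0 ?(ltW w0)// ler_pM2r.
  - by rewrite le_sinh// lerD2l.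
apply: (le_trans (muskat_rhs_dissipation hu pu h2_gt0 u0 duM dum ub uw kp_gt0 km_gt0 stable sm)).
have w10 : 0 < w1 := lt_le_trans w0 ww.
rewrite mulNr lerN2 /nu -[leLHS]mulrA; apply: ler_wpM2l; first exact: ltW rate_gt0.
rewrite [leLHS](_ : _ = w / w1 * tanh (w1 / 2)); last by move: (tanh _) (w1^-1) => X Y; ring.
have := @tanh_concave R (w / w1) (w1 / 2).
rewrite (_ : w / w1 * (w1 / 2) = w / 2); last by field; rewrite gt_eqF.
apply; last by rewrite divr_ge0// ltW.
by rewrite divr_ge0 ?(ltW w0) ?(ltW w10)//= ler_pdivrMr// mul1r.
Qed.

Let osc_dist_in_time t0 eps : 0 <= t0 <= T -> 0 < eps -> exists2 d, 0 < d &
  forall t, 0 <= t <= T -> `|t - t0| < d -> `|osc (f t) - osc (f t0)| <= eps.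
Proof.
move=> ht0 eps0; have eps2 : 0 < eps / 2 by rewrite divr_gt0.
have [d d0 hd] := solution_continuous_in_time sol ht0 eps2.
exists d => // t ht td; rewrite (_ : eps = 2 * (eps / 2)); last by field.
apply: osc_dist; [exact: (sol_continuous sol ht)|exact: (solution_periodic sol ht)|
  exact: (sol_continuous sol ht0)|exact: (solution_periodic sol ht0)|exact: hd].
Qed.

Let barrier_dist mu w t0 eps : 0 <= t0 <= T -> 0 < eps -> exists2 d, 0 < d &
  forall t, 0 <= t <= T -> `|t - t0| < d ->
    `|osc (f t) - w * expR (- mu * t) - (osc (f t0) - w * expR (- mu * t0))| <= eps.
Proof.
move=> ht0 eps0; have eps2 : 0 < eps / 2 by rewrite divr_gt0.
have [d d0 hd] := osc_dist_in_time ht0 eps2.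
have ce : {for t0, continuous (fun t => w * expR (- mu * t))}.
  apply: cvgM; first exact: cvg_cst.
  apply: (@continuous_comp _ _ _ (fun t => - mu * t) (@expR R)); last exact: continuous_expR.
  by apply: cvgM; [exact: cvg_cst|exact: cvg_id].
move/cvgrPdist_le : ce => /(_ _ eps2)[e /= e0 he].
exists (Num.min d e); first by rewrite lt_min d0.
move=> t ht; rewrite lt_min => /andP[td te].
rewrite opprB addrACA addrC -[X in X + _]opprB opprK [X in `|X|](_ : _ =
  (w * expR (- mu * t0) - w * expR (- mu * t)) + (osc (f t) - osc (f t0))); last by ring.
apply: (le_trans (ler_normD _ _)); rewrite [leRHS]splitr; apply: lerD; last exact: hd.
by apply: he; rewrite /= distrC.
Qed.

Let osc_attained t : 0 <= t <= T -> exists xM xm,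
  [/\ osc (f t) = f t xM - f t xm, forall x, f t x <= f t xM & forall x, f t xm <= f t x].
Proof.
move=> ht; have [xM ME hM] := torus_max_attained (sol_continuous sol ht) (solution_periodic sol ht).
have [xm mE hm] := torus_min_attained (sol_continuous sol ht) (solution_periodic sol ht).
by exists xM, xm; rewrite /osc ME mE.
Qed.

Let osc_lt mu w t : 0 < mu < nu -> osc (f 0) < w <= w1 -> 0 <= t < T ->
  osc (f t) < w * expR (- mu * t).
Proof.
move=> /andP[mu0 mu_nu] /andP[w0w ww1] /andP[t_ge0 tT]; rewrite ltNge; apply/negP => contra.
have hsub s : 0 <= s <= t -> 0 <= s <= T.
  by move=> /andP[s0 st]; rewrite s0 (le_trans st)// ltW.
have osc0 s : 0 <= s <= T -> 0 <= osc (f s).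
  by move=> hs; have [xM [xm [-> hM _]]] := osc_attained hs; rewrite subr_ge0.
have w0 : 0 < w by apply: le_lt_trans w0w; apply: osc0; rewrite lexx ltW.
have [] := @first_crossing R (fun s => osc (f s) - w * expR (- mu * s)) t t_ge0.
- move=> s hs eps eps0; have [d d0 hd] := barrier_dist mu w (hsub s hs) eps0.
  by exists d => // s' hs'; apply: hd; exact: hsub.
- by rewrite mulr0 expR0 mulr1 subr_lt0.
- by rewrite subr_ge0.
move=> t0 [/andP[t00 t0t] g0 gneg].
have ht0 : 0 < t0 < T by rewrite t00 (le_lt_trans t0t).
have ht0' : 0 <= t0 <= T by apply: hsub; rewrite ltW.
have [xM [xm [oE hM hm]]] := osc_attained ht0'.
have oB : osc (f t0) = w * expR (- mu * t0) by apply/eqP; rewrite -subr_eq0 g0.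
have B0 : 0 < w * expR (- mu * t0) by rewrite mulr_gt0// expR_gt0.
have B1 : w * expR (- mu * t0) <= w1.
  apply: le_trans ww1; rewrite ler_piMr ?(ltW w0)// -expR0 ler_expR.
  by rewrite mulNr oppr_le0 mulr_ge0 ?ltW.
have rhs := @rhs_extrema t0 xM xm ht0 hM hm; rewrite -oE oB B0 B1 in rhs.
have {}rhs := rhs isT.
have dexp : is_derive t0 1 (fun s => w * expR (- mu * s)) (- mu * (w * expR (- mu * t0))).
  have dl : is_derive t0 1 (fun s => - mu * s) (- mu).
    by apply: is_derive_eq; rewrite /GRing.scale/= mulr1.
  have ? := @is_derive_compf R (@expR R) _ t0 _ _ (is_derive_expR _) dl.
  by apply: is_derive_eq; rewrite /GRing.scale/=; ring.
have dM := sol_eq sol xM ht0; have dm := sol_eq sol xm ht0.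
have dg : is_derive t0 1 (fun s => f s xM - f s xm - w * expR (- mu * s))
    (muskat_rhs kp km rp rm h2 (f t0) xM - muskat_rhs kp km rp rm h2 (f t0) xm -
     - mu * (w * expR (- mu * t0))) by apply: is_derive_eq.
have := is_derive_ge0_left t00 dg.
(* The points [xM] and [xm] are frozen at the contact time. Earlier, the difference of values there
   is at most the oscillation, which lies below the barrier. *)
have left s : 0 <= s < t0 -> f s xM - f s xm - w * expR (- mu * s) <=
    f t0 xM - f t0 xm - w * expR (- mu * t0).
  move=> hs; rewrite -oE oB subrr; apply: ltW; apply: le_lt_trans (gneg s hs).
  have /andP[s0 st0] := hs; have hs' : 0 <= s <= T by rewrite s0 (le_trans (ltW st0))// ltW// (le_lt_trans t0t).
  have [yM [ym [-> yMh ymh]]] := osc_attained hs'.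
  by rewrite lerD2r; apply: lerB.
move=> /(_ left); apply/negP; rewrite -ltNge.
have : 0 < (nu - mu) * (w * expR (- mu * t0)) by rewrite mulr_gt0// subr_gt0.
move: rhs; move: (w * _) (muskat_rhs _ _ _ _ _ _ xM) (muskat_rhs _ _ _ _ _ _ xm) => B X Y.
by move=> *; lra.
Qed.

(** The barrier in [osc_lt] starts strictly above osc (f 0); here the initial factor becomes osc (f
    0) itself and the final time is included. *)
Lemma osc_decay mu t : 0 < mu < nu -> osc (f 0) < w1 -> 0 <= t <= T ->
  osc (f t) <= osc (f 0) * expR (- mu * t).
Proof.
move=> hmu w0w /andP[t_ge0]; set w0 := osc (f 0); rewrite -/w0 in w0w.
have before s : 0 <= s < T -> osc (f s) <= w0 * expR (- mu * s).
  move=> hs; rewrite leNgt; apply/negP => contra.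
  have E0 := expR_gt0 (- mu * s).
  (* If the bound failed at time s, this starting value would be admissible, yet its barrier is at
     most osc (f s) at time s. No passage to the limit in the starting value is needed. *)
  pose w := Num.min w1 (osc (f s) / expR (- mu * s)).
  have hw : w0 < w <= w1 by rewrite lt_min w0w ltr_pdivlMr// contra ge_min lexx.
  have := osc_lt hmu hw hs; apply/negP; rewrite -leNgt -ler_pdivlMr//.
  by rewrite ge_min lexx orbT.
rewrite le_eqVlt => /predU1P[->|tT]; last by rewrite before// t_ge0.
(* At t = T, where the equation is not assumed, the bound follows by continuity from earlier
   times. *)
rewrite leNgt; apply/negP; rewrite -subr_gt0 => contra.
have hT : 0 <= T <= T by rewrite ltW/=.
have c2 : 0 < (osc (f T) - w0 * expR (- mu * T)) / 2 by rewrite divr_gt0.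
have [d d0 hd] := barrier_dist mu w0 hT c2.
have m0 : 0 < Num.min d T by rewrite lt_min d0.
have md : Num.min d T <= d by rewrite ge_min lexx.
have mT : Num.min d T <= T by rewrite ge_min lexx orbT.
have hs : 0 <= T - Num.min d T / 2 < T by apply/andP; split; lra.
have := before _ hs; rewrite -subr_le0.
have : `|T - Num.min d T / 2 - T| < d.
  by rewrite addrAC subrr sub0r normrN gtr0_norm ?divr_gt0//; lra.
have hs' : 0 <= T - Num.min d T / 2 <= T by case/andP: hs => -> /ltW.
by move=> /(hd _ hs'); rewrite ler_norml => /andP[+ _]; lra.
Qed.

Lemma le_mean_osc t x : 0 <= t <= T -> f t x <= mean (f 0) + osc (f t).
Proof.
move=> ht; have [xM [xm [-> hM hm]]] := osc_attained ht.
have hmean : f t xm <= mean (f 0).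
  rewrite -(mean_solution h2_gt0 sol f_gt0 ht) -[leLHS]mean_cst; apply: le_mean => //.
  - by move=> y; exact: cvg_cst.
  - exact: (sol_continuous sol ht).
by have := hM x; lra.
Qed.

End barrier.

Lemma Linfty_norm_le (R : realType) (u : R -> R) (M : R) : (forall x, `|u x| <= M) ->
  (Linfty_norm u <= M%:E)%E.
Proof.
move=> uM; have M0 : 0 <= M := le_trans (normr_ge0 _) (uM 0).
rewrite /Linfty_norm unlock; case: ifPn => _; last by rewrite lee_fin.
apply/ess_supP/aeW => x /=; rewrite lee_fin patchE; case: ifPn => _ //.
by rewrite normr0.
Qed.

Theorem theorem1p1 (R : realType) (kp km rp rm h2 : R) (f0 : R -> R)
    (kp_gt0 : 0 < kp) (km_gt0 : 0 < km) (stable : 0 < rm - rp)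
    (h2_gt0 : 0 < h2) (small : decay_condition kp km h2 f0) :
  exists2 mu : R, 0 < mu &
    forall (T : R) (f : R -> R -> R), 0 < T ->
      smooth_solution kp km rp rm h2 T f ->
      (forall t x : R, 0 <= t <= T -> 0 < f t x) ->
      (forall x, f 0 x = f0 x) ->
      [/\ forall t : R, 0 <= t <= T -> osc (f t) <= osc f0 * expR (- mu * t),
          forall t x : R, 0 <= t <= T -> 0 <= f t x &
          forall t : R, 0 <= t <= T ->
            (Linfty_norm (f t) <= (mean f0 + osc f0 * expR (- mu * t))%:E)%E].
Proof.
(* Positivity of h2 + mean f0 and of the oscillation is read off from some solution starting at
   [f0]; if there is none, any rate will do. The rate itself is built from [f0] and the parameters,
   and serves all solutions. *)
have [[T [f [T_gt0 sol f_gt0 f0E]]]|nosol] := pselect (exists T f, [/\ 0 < T,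
  smooth_solution kp km rp rm h2 T f, forall t x : R, 0 <= t <= T -> 0 < f t x &
  forall x, f 0 x = f0 x]); last first.
  by exists 1 => // T f T_gt0 sol f_gt0 f0E; case: nosol; exists T, f.
have a_gt0 : 0 < h2 + mean f0.
  have -> : f0 = f 0 by apply/funext.
  have T0 : 0 <= (0 : R) <= T by rewrite lexx ltW.
  rewrite ltr_pwDl//; have {1}<- := @mean_cst R 0; apply: le_mean.
  - by move=> x; exact: cvg_cst.
  - exact: (sol_continuous sol T0).
  - by move=> x _; exact/ltW/f_gt0.
have osc_ge0 : 0 <= osc f0.
  have -> : f0 = f 0 by apply/funext.
  have T0 : 0 <= (0 : R) <= T by rewrite lexx ltW.
  have [xM ME hM] := torus_max_attained (sol_continuous sol T0) (solution_periodic sol T0).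
  have [xm mE hm] := torus_min_attained (sol_continuous sol T0) (solution_periodic sol T0).
  by rewrite /osc ME mE subr_ge0.
have [w1 w01 hw1] : exists2 w1, osc f0 < w1 &
    `|perm_ratio kp km| * cosh (w1 / 2) * sinh (h2 + mean f0 + w1) <=
    pi ^+ 2 * sinh ((h2 + mean f0) / 2) ^+ 6.
  apply: decay_condition_open => //; move: small; rewrite /decay_condition.
  by rewrite (_ : mean f0 + _ - _ + h2 = h2 + mean f0 + osc f0)// /osc; ring.
have w1_gt0 : 0 < w1 := le_lt_trans osc_ge0 w01.
pose nu := kp * (rm - rp) / 2 * (1 - Num.max `|perm_ratio kp km| (97 / 100)) * (tanh (w1 / 2) / w1).
have nu_gt0 : 0 < nu.
  apply: mulr_gt0; last by rewrite divr_gt0// tanh_gt0// divr_gt0.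
  apply: mulr_gt0; first by rewrite divr_gt0// mulr_gt0.
  by rewrite subr_gt0 gt_max norm_perm_ratio_lt1//=; lra.
(* Any rate strictly between 0 and nu works: the strict inequality produces the contradiction at the
   contact time. *)
exists (nu / 2); first by rewrite divr_gt0.
move=> T' g T'_gt0 sol' g_gt0 g0E.
have g0 : g 0 = f0 by apply/funext.
have small' : `|perm_ratio kp km| * cosh (w1 / 2) * sinh (h2 + mean (g 0) + w1) <=
    pi ^+ 2 * sinh ((h2 + mean (g 0)) / 2) ^+ 6 by rewrite g0.
have rate : 0 < nu / 2 < nu by rewrite divr_gt0// ltr_pdivrMr// ltr_pMr// ltr1n.
have decay t : 0 <= t <= T' -> osc (g t) <= osc f0 * expR (- (nu / 2) * t).
  rewrite -g0; apply: (osc_decay kp_gt0 km_gt0 stable h2_gt0 T'_gt0 sol' g_gt0 small' rate).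
  by rewrite g0.
split => // [t x ht|t ht]; first exact/ltW/g_gt0.
apply: Linfty_norm_le => x; rewrite ger0_norm; last exact/ltW/g_gt0.
apply: le_trans (le_mean_osc h2_gt0 sol' g_gt0 x ht) _.
by rewrite g0 lerD2l; exact: decay.
Qed.
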